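(* Let $D \in \{3,5\}$ be a constant. Then there exists a finite constant $\gamma_{D,D} > 0$ such that $$\left( \frac{|\mathcal{P}(2n,D,D)|}{(2n)!} \right)^{1/(2n)} \to \gamma_{D,D} \quad \text{as } n \to \infty.$$
   Context: For a positive integer $m$ and a constant $D$, $\mathcal{P}(m,D,D)$ denotes the set of all labelled (simple) planar graphs on the vertex set $\{1,2,\ldots,m\}$ in which every vertex has degree exactly $D$ (i.e. minimum degree at least $D$ and maximum degree at most $D$). *)

(* Defs.v *)
From mathcomp Require Import all_boot all_order all_algebra.
From mathcomp Require Import all_classical all_reals all_analysis.
Import Order.TTheory GRing.Theory Num.Theory.
Import numFieldNormedType.Exports.

Set Implicit Arguments.
Unset Strict Implicit.
Unset Printing Implicit Defensive.

Local Open Scope classical_set_scope.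
Local Open Scope ring_scope.

(* A graph on the vertex set V is given by its edge set E. *)
Definition simple_graph (V : finType) (E : {set {set V}}) : bool :=
  [forall e in E, #|e| == 2].

Definition degree (V : finType) (E : {set {set V}}) (v : V) : nat :=
  #|[set e in E | v \in e]%SET|.

(* A plane drawing: vertices are distinct points, each edge is a simple
   (continuous, injective) arc joining its two end vertices, and the relative
   interior of an arc contains no vertex and no interior point of another arc.
   The value of gamma outside E and outside [0, 1] is irrelevant. *)
Definition plane_drawing (R : realType) (V : finType) (E : {set {set V}})
    (pos : V -> R * R) (gamma : {set V} -> R -> R * R) : Prop :=
  [/\ injective pos,
      forall e, e \in E ->
        [/\ {within `[0, 1], continuous (gamma e)},
            {in `[0, 1] &, injective (gamma e)} &
            exists u v : V,
              [/\ e = [set u; v]%SET, gamma e 0 = pos u & gamma e 1 = pos v]],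
      forall e (t : R) v, e \in E -> t \in `]0, 1[ -> gamma e t <> pos v &
      forall e f (s t : R), e \in E -> f \in E -> e != f ->
        s \in `]0, 1[ -> t \in `]0, 1[ -> gamma e s <> gamma f t].

Definition planar (R : realType) (V : finType) (E : {set {set V}}) : Prop :=
  exists (pos : V -> R * R) (gamma : {set V} -> R -> R * R),
    plane_drawing E pos gamma.

(* P(m, d, D): labelled planar graphs on m vertices, labels shifted to
   0, ..., m - 1, with minimum degree >= d and maximum degree <= D. *)
Definition planar_graphs (R : realType) (m d D : nat) : {set {set {set 'I_m}}} :=
  [set E : {set {set 'I_m}} |
    [&& simple_graph E, `[< planar R E >] &
        [forall v, (d <= degree E v <= D)%N]]]%SET.

(* Main.v *)
(* Let [r_n] count the connected [D]-regular planar graphs on [n] labelled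
   vertices with an oriented root edge that is not a bridge.  Replacing the root
   edges [ab], [cd] of two such graphs by [ac], [bd] keeps the graph planar; the
   two vertex sets can be recovered from the edge [ac] and the size of one of
   them, so [r_n / n!] is supermultiplicative and Fekete's lemma applies.  A
   connected graph without vertices of degree [<= 1] has a non-bridge, so
   connected graphs number between [r_n / n^2] and [r_n].  Disconnected graphs
   do not change the growth rate, by the recursion [n a_n <= sum_k k c_k a_(n-k)]
   on the component of a vertex ([a], [c]: all, resp. connected, graphs over
   [n!]).

   Finiteness of the growth rate: a drawing is discretised into a labelling of
   the cells of a finite grid, for which [m <= 3 n] is proved by counting faces
   with linear algebra over [F_2]; the bound holds for all minors, and the
   contraction and twin-reduction argument of Norine, Seymour, Thomas and Wollan
   then gives at most [n! * 2 ^ O(n)] graphs.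

   Positivity: straight-line drawings of [K_4] and the prism for [D = 3], and of
   [D]-regular graphs with 12 and 22 vertices for [D = 5], so that every large
   even order is reached. *)

Require Import Defs.
From mathcomp Require Import all_boot all_order all_algebra perm.
From mathcomp Require Import all_classical all_reals all_analysis.
From mathcomp Require Import zify ssrZ ring lra.
From Stdlib Require Import Relation_Operators.
From Stdlib Require ZArith.
Import Order.TTheory GRing.Theory Num.Theory.
Import numFieldNormedType.Exports.

Set Implicit Arguments.
Unset Strict Implicit.
Unset Printing Implicit Defensive.

(** * Edge bounds for grid labellings *)

Section EvenSubgraphs.
Local Open Scope ring_scope.

(** Edges are drawn as arbitrary continuous arcs, so neither the Jordan curve theorem nor Euler's
    formula is applied to the drawing itself. A grid labelling keeps just what counting needs,
    connected label classes and contacts between them; there a cycle mod 2 is the coboundary of a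
    0-1 function on unit squares, obtained by summing along columns. Deleting vertices and
    contracting stars only renames labels, so one edge bound serves every quotient met in the
    recursion. The root must not be a bridge for two reasons: each half stays connected after losing
    its root edge, so that a vertex set cut off by only two edges cannot be confused with another
    one of the same size, and the new root edge is again no bridge because the second new edge still
    joins the halves. Supermultiplicativity propagates positivity only along sums of known orders.
    Two starting orders whose halves are coprime are therefore needed for each degree, as otherwise
    infinitely many even orders might be missed and the limit could not be taken over all [n]. *)

Lemma rank_le_nonzero_rows (F : fieldType) m n (A : 'M[F]_(m, n)) :
  (\rank A <= #|[set i | row i A != 0%R]%SET|)%N.
Proof.
have sA : (A <= \sum_(i | row i A != 0) <<row i A>>)%MS.
  apply/row_subP => i; case: (eqVneq (row i A) 0) => [->|nz]; first exact: sub0mx.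
  by apply: (submx_trans _ (sumsmx_sup i nz (submx_refl _))); rewrite genmxE.
apply: leq_trans (mxrankS sA) _.
apply: leq_trans (mxrank_sum_leqif _) _ => /=.
rewrite -sum1_card big_mkcond [leqRHS]big_mkcond /= leq_sum // => i _.
by rewrite inE; case: ifP => // _; rewrite mxrank_gen rank_rV; case: (_ != _).
Qed.

(** The kernel of [Bd] has dimension at least [k - n] and is spanned by the rows of [Phi], so at
    least that many rows are nonzero. A nonzero row is a cycle and has at least [g] nonzero entries,
    while a column has at most two: count the nonzero entries of [Phi] both ways. This is the half
    of Euler's formula that bounds the number of edges, without any assumption of connectedness. *)
Lemma euler_face_count (F : fieldType) (k n q g : nat) (Bd : 'M[F]_(k, n))
    (Phi : 'M[F]_(q, k)) :
  (kermx Bd <= Phi)%MS ->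
  Phi *m Bd = 0 ->
  (forall w : 'rV[F]_k, w != 0 -> w *m Bd = 0 ->
     (g <= #|[set c | w ord0 c != 0%R]%SET|)%N) ->
  (forall c, (#|[set f | Phi f c != 0%R]%SET| <= 2)%N) ->
  (g * (k - n) <= 2 * k)%N.
Proof.
move=> kerP PB girth col2.
have h1 : (k - n <= #|[set f | row f Phi != 0%R]%SET|)%N.
  apply: (leq_trans _ (rank_le_nonzero_rows Phi)).
  apply: (leq_trans _ (mxrankS kerP)); rewrite mxrank_ker.
  by apply: leq_sub2l; apply: rank_leq_col.
apply: (@leq_trans (\sum_(f in [set f | row f Phi != 0%R]%SET) #|[set c | Phi f c != 0%R]%SET|)%N).
  rewrite mulnC; apply: leq_trans (leq_mul h1 (leqnn g)) _.
  rewrite -sum_nat_const; apply: leq_sum => f; rewrite inE => nz.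
  have := girth _ nz; rewrite -row_mul PB row0 => /(_ erefl).
  by congr (_ <= _)%N; apply: eq_card => c; rewrite !inE mxE.
apply: (@leq_trans (\sum_f \sum_c (Phi f c != 0%R))%N).
  rewrite big_mkcond /=; apply: leq_sum => f _; case: ifP => // _.
  by rewrite -sum1_card big_mkcond; apply: leq_sum => c _; rewrite inE; case: (Phi f c != _).
rewrite exchange_big /= mulnC -[X in (_ <= X * 2)%N]card_ord -sum_nat_const.
apply: leq_sum => c _; apply: (leq_trans _ (col2 c)).
rewrite -sum1_card [leqRHS]big_mkcond; apply: leq_sum => f _.
by rewrite inE; case: (Phi f c != _).
Qed.

End EvenSubgraphs.

Definition cell_adj (p q : nat * nat) : bool :=
  ((p.1 == q.1) && ((p.2.+1 == q.2) || (q.2.+1 == p.2))) ||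
  ((p.2 == q.2) && ((p.1.+1 == q.1) || (q.1.+1 == p.1))).

(* The label [None] on the border rows and columns lets every sum over the grid
   be shifted by one without boundary terms. *)
Definition bounded_labelling (V : Type) (l : nat -> nat -> option V) (M : nat) :=
  forall i j, l i j <> None -> (0 < i < M)%N /\ (0 < j < M)%N.

Definition connected_labelling (V : eqType) (l : nat -> nat -> option V) :=
  forall p q, l p.1 p.2 <> None -> l p.1 p.2 = l q.1 q.2 ->
    clos_refl_trans _ (fun a b => cell_adj a b && (l a.1 a.2 == l b.1 b.2)) p q.

(** * Chains mod 2 on the grid and planar duality *)

Section GridChains.
Local Open Scope ring_scope.
Variables (V : finType) (l : nat -> nat -> option V) (M : nat).
Hypothesis lM : bounded_labelling l M.
Hypothesis lc : connected_labelling l.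

(* [z true i j] is the coefficient mod 2 of the edge from cell (i,j) to
   (i+1,j), and [z false i j] that of the edge from (i,j) to (i,j+1). *)
Implicit Type z : bool -> nat -> nat -> bool.

(** Boundary mod 2 of the chain [z] at the cell [(i+1, j+1)], addition of booleans being exclusive
    or. The shift makes the two backward edges available without predecessors; cells of row or
    column 0 carry no label. *)
Definition chain_bd z (i j : nat) : bool :=
  z true i.+1 j.+1 + z true i j.+1 + z false i.+1 j.+1 + z false i.+1 j.

Definition inner b (i j : nat) : bool :=
  (l i j != None) && (l i j == l (i + nat_of_bool b)%N (j + ~~ b)%N).

Lemma boolDD (a : bool) : a + a = 0. Proof. by case: a. Qed.

Lemma chain_step (p q : nat * nat) : l p.1 p.2 <> None -> l p.1 p.2 = l q.1 q.2 ->
  cell_adj p q ->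
  exists z, (forall b i j, z b i j -> inner b i j) /\
    forall i j, chain_bd z i j = ((i.+1, j.+1) == p) + ((i.+1, j.+1) == q).
Proof.
have step1 (b : bool) i j : l i j <> None -> l i j = l (i + nat_of_bool b)%N (j + ~~ b)%N ->
    exists z, (forall b i j, z b i j -> inner b i j) /\
    forall x y, chain_bd z x y =
      ((x.+1, y.+1) == (i, j)) + ((x.+1, y.+1) == ((i + nat_of_bool b)%N, (j + ~~ b)%N)).
  move=> li e; have [/andP[i0 _] /andP[j0 _]] := lM li.
  exists (fun b' x y => [&& b' == b, x == i & y == j]); split=> [b' x y|x y].
    by case/and3P=> /eqP-> /eqP-> /eqP->; rewrite /inner -e eqxx andbT; apply/eqP.
  case: i j i0 j0 {li e} => // i [//|j] _ _.
  rewrite /chain_bd !xpair_eqE; case: b; rewrite /= ?addn0 ?addn1 ?eqSS;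
  by do ![case: (_ == _) => //=].
have step2 (b : bool) i j : l (i + nat_of_bool b)%N (j + ~~ b)%N <> None ->
    l (i + nat_of_bool b)%N (j + ~~ b)%N = l i j ->
    exists z, (forall b i j, z b i j -> inner b i j) /\
    forall x y, chain_bd z x y =
      ((x.+1, y.+1) == ((i + nat_of_bool b)%N, (j + ~~ b)%N)) + ((x.+1, y.+1) == (i, j)).
  move=> li e; have [||z [zi zb]] := step1 b i j; rewrite -?e //.
  by exists z; split=> // x y; rewrite zb addrC.
case: p q => [i j] [i' j'] /= lp e /orP[]/andP[/eqP/= ee /orP[]/eqP/= e1]; subst.
- by have := step1 false i' j; rewrite /= addn0 addn1; apply.
- by have := step2 false i' j'; rewrite /= addn0 addn1; apply.
- by have := step1 true i j'; rewrite /= addn0 addn1; apply.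
- by have := step2 true i' j'; rewrite /= addn0 addn1; apply.
Qed.

Lemma chain_path (p q : nat * nat) : l p.1 p.2 <> None -> l p.1 p.2 = l q.1 q.2 ->
  exists z, (forall b i j, z b i j -> inner b i j) /\
    forall i j, chain_bd z i j = ((i.+1, j.+1) == p) + ((i.+1, j.+1) == q).
Proof.
(* The equality of labels is added to the statement because the transitive case needs the label of
   the intermediate cell. *)
move=> lp e; suff [] : (exists z, (forall b i j, z b i j -> inner b i j) /\
    forall i j, chain_bd z i j = ((i.+1, j.+1) == p) + ((i.+1, j.+1) == q)) /\
    l p.1 p.2 = l q.1 q.2 by [].
move: lp (lc lp e) => {e} + H; elim: H => {p q}.
- by move=> p q /andP[a /eqP e] lp; split => //; apply: chain_step.
- move=> p _; split=> //; exists (fun _ _ _ => false); split=> // i j.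
  by rewrite boolDD.
- move=> p q r _ + _ + lp => /(_ lp)[[z [zi zb]] e1].
  rewrite e1 in lp * => /(_ lp)[[z' [zi' zb']] e2]; split; last by rewrite -e2.
  exists (fun b i j => z b i j + z' b i j); split=> [b i j|i j].
    by have := zi b i j; have := zi' b i j; case: (z b i j) (z' b i j) => [] [] //= H1 H2 _; auto.
  transitivity (chain_bd z i j + chain_bd z' i j).
    by rewrite /chain_bd; ring.
  by rewrite zb zb'; case: (_ == p); case: (_ == q); case: (_ == r).
Qed.

(** Every cycle of the grid bounds. The value [x i j] belongs to the unit square between the cells
    [(i, j)] and [(i+1, j+1)]: it is the parity of the edges of [z] crossed on the straight way from
    that square to the border. *)
Lemma potential z : (forall i j, chain_bd z i j = 0) -> (forall i, z true i 0%N = 0) ->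
  (forall i, z false i 0%N = 0) ->
  exists x : nat -> nat -> bool,
    (forall i j, x i j.+1 + x i j = z true i j.+1) /\
    (forall i j, x i.+1 j + x i j = z false i.+1 j).
Proof.
move=> bd0 zt zf; exists (fun i j => \sum_(k < j.+1) z true i k); split=> i j.
  by rewrite big_ord_recr /= addrAC boolDD add0r.
elim: j => [|j IH]; first by rewrite !big_ord1 !zt zf.
rewrite big_ord_recr /= [X in _ + X]big_ord_recr /= addrACA IH.
have := bd0 i j; rewrite /chain_bd => {IH bd0}. 

by move: (z true i.+1 j.+1) (z true i j.+1) (z false i.+1 j.+1) (z false i.+1 j) => [] [] [] [].
Qed.

Lemma sum_shift n (g : nat -> bool) : g 0%N = 0 -> g n = 0 ->
  \sum_(i < n) g i.+1 = \sum_(i < n) g i.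
Proof.
move=> g0 gn; rewrite -[LHS]add0r -{1}g0.
by rewrite -(big_ord_recl n (fun i => g i)) big_ord_recr /= gn addr0.
Qed.

Definition at_label (v : V) i j : bool := l i j == Some v.

Lemma at_label_border v i j :
  ((i == 0) || (j == 0) || (M <= i) || (M <= j))%N -> at_label v i j = 0.
Proof.
move=> H; rewrite /at_label; case: (l i j =P Some v) => // e; exfalso.
have [/andP[? ?] /andP[? ?]] : (0 < i < M)%N /\ (0 < j < M)%N by apply: lM; rewrite e.
lia.
Qed.

(** Summation by parts: the indicator of a label class pairs with the boundary of [z] as its
    coboundary pairs with [z]. Shifting the indices loses nothing because the indicator vanishes on
    the border. *)
Lemma stokes z (v : V) :
  \sum_(i < M) \sum_(j < M) at_label v i.+1 j.+1 * chain_bd z i j =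
  \sum_(b : bool) \sum_(i < M) \sum_(j < M)
     z b i j * (at_label v i j + at_label v (i + nat_of_bool b)%N (j + ~~ b)%N).
Proof.
have B := at_label_border v.
have s1 (h : nat -> nat -> bool) (H : forall i j, ((i == 0) || (M <= i))%N -> h i j = 0) :
    \sum_(i < M) \sum_(j < M) h i.+1 j = \sum_(i < M) \sum_(j < M) h i j.
  rewrite exchange_big [RHS]exchange_big; apply: eq_bigr => j _.
  by apply: (@sum_shift M (fun i => h i j)); apply: H; rewrite ?eqxx ?leqnn ?orbT.
have s2 (h : nat -> nat -> bool) (H : forall i j, ((j == 0) || (M <= j))%N -> h i j = 0) :
    \sum_(i < M) \sum_(j < M) h i j.+1 = \sum_(i < M) \sum_(j < M) h i j.
  apply: eq_bigr => i _.
  by apply: (@sum_shift M (fun j => h i j)); apply: H; rewrite ?eqxx ?leqnn ?orbT.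
have e i j : at_label v i.+1 j.+1 * chain_bd z i j =
   (at_label v i.+1 j.+1 * z true i.+1 j.+1 + at_label v i.+1 j.+1 * z true i j.+1)
   + (at_label v i.+1 j.+1 * z false i.+1 j.+1 + at_label v i.+1 j.+1 * z false i.+1 j).
  by rewrite /chain_bd; ring.
under eq_bigr do under eq_bigr do rewrite e.
under eq_bigr do rewrite !big_split /=.
rewrite !big_split /= big_bool /=.
have ->: \sum_(i < M) \sum_(j < M) at_label v i.+1 j.+1 * z true i.+1 j.+1 =
    \sum_(i < M) \sum_(j < M) at_label v i j * z true i j.
  rewrite -[RHS](s1 (fun i j => at_label v i j * z true i j)); last first.
    by move=> i j /orP[]H; rewrite B ?mul0r // H ?orbT.
  apply: (s2 (fun i j => at_label v i.+1 j * z true i.+1 j)) => i j H; rewrite B ?mul0r//.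
  by move/orP: H => [->|->]; rewrite ?orbT.
have ->: \sum_(i < M) \sum_(j < M) at_label v i.+1 j.+1 * z false i.+1 j.+1 =
    \sum_(i < M) \sum_(j < M) at_label v i j * z false i j.
  rewrite -[RHS](s1 (fun i j => at_label v i j * z false i j)); last first.
    by move=> i j /orP[]H; rewrite B ?mul0r // H ?orbT.
  apply: (s2 (fun i j => at_label v i.+1 j * z false i.+1 j)) => i j H; rewrite B ?mul0r//.
  by move/orP: H => [->|->]; rewrite ?orbT.
have ->: \sum_(i < M) \sum_(j < M) at_label v i.+1 j.+1 * z true i j.+1 =
    \sum_(i < M) \sum_(j < M) at_label v i.+1 j * z true i j.
  apply: (s2 (fun i j => at_label v i.+1 j * z true i j)) => i j H; rewrite B ?mul0r//.
  by move/orP: H => [->|->]; rewrite ?orbT.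
have ->: \sum_(i < M) \sum_(j < M) at_label v i.+1 j.+1 * z false i.+1 j =
    \sum_(i < M) \sum_(j < M) at_label v i j.+1 * z false i j.
  rewrite -[RHS](s1 (fun i j => at_label v i j.+1 * z false i j)) // => i j H.
  by case/orP: H => H; rewrite B ?mul0r // H ?orbT.
congr (_ + _); rewrite -big_split; apply: eq_bigr => i _; rewrite -big_split; apply: eq_bigr => j _ /=;
by rewrite ?addn0 ?addn1; ring.
Qed.

Lemma sum_pick2 (F : nat -> nat -> bool) x y : (x < M)%N -> (y < M)%N ->
  \sum_(i < M) \sum_(j < M) F i j * ((x, y) == (i : nat, j : nat)) = F x y.
Proof.
move=> xM yM; rewrite (bigD1 (Ordinal xM)) //= (bigD1 (Ordinal yM)) //= eqxx mulr1.
rewrite !big1 ?addr0 //.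
  move=> i ne; rewrite big1 // => j _; rewrite xpair_eqE.
  case: eqP => [e|]; last by rewrite mulr0.
  by case/eqP: ne; apply: val_inj.
move=> j ne; rewrite xpair_eqE eqxx /=.
case: eqP => [e|]; last by rewrite mulr0.
by case/eqP: ne; apply: val_inj.
Qed.

Lemma sum_pick3 (F : bool -> nat -> nat -> bool) b x y : (x < M)%N -> (y < M)%N ->
  \sum_(b' : bool) \sum_(i < M) \sum_(j < M) ((b, x, y) == (b', i : nat, j : nat)) * F b' i j
  = F b x y.
Proof.
move=> xM yM; transitivity (\sum_(b' : bool) (b == b') * F b' x y).
  apply: eq_bigr => b' _; rewrite -(sum_pick2 (F b') xM yM) mulr_sumr.
  apply: eq_bigr => i _; rewrite mulr_sumr; apply: eq_bigr => j _.
  by rewrite !xpair_eqE; case: (b == b'); case: (x == i); case: (y == j); case: (F _ _ _).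
by rewrite big_bool; case: b; case: (F true _ _); case: (F false _ _).
Qed.

Section Contacts.
Variables (k : nat) (eps : 'I_k -> bool * nat * nat).
Hypothesis eps_inj : injective eps.
Definition contact b i j := [/\ l i j <> None, l (i + nat_of_bool b)%N (j + ~~ b)%N <> None
  & l i j <> l (i + nat_of_bool b)%N (j + ~~ b)%N].
Hypothesis epsP : forall c, contact (eps c).1.1 (eps c).1.2 (eps c).2.

Definition incidence b i j v : bool :=
  at_label v i j + at_label v (i + nat_of_bool b)%N (j + ~~ b)%N.
Definition eps_inc c v := incidence (eps c).1.1 (eps c).1.2 (eps c).2 v.

Lemma eps_bound c : (0 < (eps c).1.2 < M)%N /\ (0 < (eps c).2 < M)%N.
Proof. by have [/lM] := epsP c. Qed.

Lemma eps_reindex (w : 'I_k -> bool) (F : bool -> nat -> nat -> bool) :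
  \sum_(b : bool) \sum_(i < M) \sum_(j < M)
     (\sum_c w c * (eps c == (b, i : nat, j : nat))) * F b i j
  = \sum_c w c * F (eps c).1.1 (eps c).1.2 (eps c).2.
Proof.
transitivity (\sum_c \sum_(b : bool) \sum_(i < M) \sum_(j < M)
   w c * ((eps c == (b, i : nat, j : nat)) * F b i j)).
  rewrite [RHS]exchange_big; apply: eq_bigr => b _; rewrite [RHS]exchange_big.
  apply: eq_bigr => i _; rewrite [RHS]exchange_big; apply: eq_bigr => j _; rewrite mulr_suml.
  by apply: eq_bigr => c _; rewrite mulrA.
apply: eq_bigr => c _; have [/andP[_ e1] /andP[_ e2]] := eps_bound c.
rewrite -(sum_pick3 F (eps c).1.1 e1 e2) mulr_sumr; apply: eq_bigr => b _.
rewrite mulr_sumr; apply: eq_bigr => i _; rewrite mulr_sumr; apply: eq_bigr => j _.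
by case: (eps c) => [[? ?] ?].
Qed.

(** The grid edges that act as walls. Two squares separated by any other edge will belong to the
    same face. *)
Definition live b i j := inner b i j || [exists c, eps c == (b, i, j)].

(** Change of [x] across a grid edge, whose sides are the square [(i, j)] and the preceding one. At
    index 0 the predecessor is the square itself, so the change there is 0. *)
Definition dual_diff (x : nat -> nat -> bool) b i j : bool :=
  x i j + (if b then x i j.-1 else x i.-1 j).

(** An even set of contacts has an even number of ends in each label class. Joining every end to a
    fixed cell of its class through inner edges gives a cycle of the grid, which has a potential;
    the added edges are never contacts, so they do not disturb the values there. *)
Lemma even_lift (w : 'I_k -> bool) : (forall v, \sum_c w c * eps_inc c v = 0) ->
  exists x : nat -> nat -> bool,
    (forall c, dual_diff x (eps c).1.1 (eps c).1.2 (eps c).2 = w c) /\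
    (forall b i j, (0 < if b then j else i)%N -> ~~ live b i j -> dual_diff x b i j = 0).
Proof.
move=> ev.
have [rho rhoP] : exists rho : V -> nat * nat, forall v p, l p.1 p.2 = Some v ->
    l (rho v).1 (rho v).2 = Some v.
  suff /choice[f] : forall v, exists r, forall p, l p.1 p.2 = Some v -> l r.1 r.2 = Some v by exists f.
  move=> v.
  have [[p lp]|np] := pselect (exists p : nat * nat, l p.1 p.2 = Some v); first by exists p.
  by exists (0, 0)%N => p lp; case: np; exists p.
have [Z ZP] : exists Z : nat * nat -> bool -> nat -> nat -> bool, forall p,
    (forall b i j, Z p b i j -> inner b i j) /\ forall v, l p.1 p.2 = Some v ->
    forall x y, chain_bd (Z p) x y = ((x.+1, y.+1) == p) + ((x.+1, y.+1) == rho v).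
  suff /choice[f] : forall p, exists z, (forall b i j, z b i j -> inner b i j) /\
    forall v, l p.1 p.2 = Some v ->
    forall x y, chain_bd z x y = ((x.+1, y.+1) == p) + ((x.+1, y.+1) == rho v) by exists f.
  move=> p.
  case E: (l p.1 p.2) => [v|]; last by exists (fun _ _ _ => false).
  have [||z [zi zb]] := @chain_path p (rho v); rewrite ?E //.
    by rewrite (rhoP _ _ E).
  by exists z; split=> // v' [<-].
pose zC b i j : bool := \sum_c w c * (eps c == (b, i, j)).
have zC0 b i j : zC b i j -> l i j <> None /\ l (i + nat_of_bool b)%N (j + ~~ b)%N <> None.
  move=> H; have [c /eqP ec] : exists c, eps c == (b, i, j).
    apply/existsP; apply: contraTT H => /existsPn H; apply/negP.
    rewrite /zC big1 // => c _; by rewrite (negbTE (H c)) mulr0.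
  by have [] := epsP c; rewrite ec.
have bdC0 i j : chain_bd zC i j -> l i.+1 j.+1 <> None.
  have := @zC0 true i.+1 j.+1; have := @zC0 true i j.+1.
  have := @zC0 false i.+1 j.+1; have := @zC0 false i.+1 j.
  rewrite /chain_bd /= !(addn0, addn1).
  case: (zC true i.+1 j.+1) => [_ _ _ /(_ isT)[]//|].
  case: (zC true i j.+1) => [_ _ /(_ isT)[]//|].
  case: (zC false i.+1 j.+1) => [_ /(_ isT)[]//|].
  by case: (zC false i.+1 j) => [/(_ isT)[]//|].
pose z b x y : bool := zC b x y +
  \sum_(i < M) \sum_(j < M) chain_bd zC i j * Z (i.+1, j.+1) b x y.
have bdz x y : chain_bd z x y = 0.
  have -> : chain_bd z x y = chain_bd zC x y +
      \sum_(i < M) \sum_(j < M) chain_bd zC i j * chain_bd (Z (i.+1, j.+1)) x y.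
    rewrite {3}/chain_bd; under eq_bigr do under eq_bigr do rewrite !mulrDr.
    under eq_bigr do rewrite !big_split /=.
    by rewrite !big_split /= /z /chain_bd; ring.
  have -> : \sum_(i < M) \sum_(j < M) chain_bd zC i j * chain_bd (Z (i.+1, j.+1)) x y =
     \sum_(i < M) \sum_(j < M) (chain_bd zC i j * ((x, y) == (i : nat, j : nat)) +
       \sum_v ((x.+1, y.+1) == rho v) * (at_label v i.+1 j.+1 * chain_bd zC i j)).
    apply: eq_bigr => i _; apply: eq_bigr => j _.
    case: (boolP (chain_bd zC i j)) => [B|_]; last first.
      by rewrite !mul0r add0r big1 // => v _; rewrite !mulr0.
    case E: (l i.+1 j.+1) (bdC0 _ _ B) => [v|//] _.
    have [_ /(_ v E x y) ->] := ZP (i.+1, j.+1).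
    rewrite mulrDr !xpair_eqE !eqSS; congr (_ + _).
    rewrite (bigD1 v) //= /at_label E eqxx big1 ?addr0; first by do ![case: (_ == _)].
    move=> v' /negbTE ne; case: (Some v =P Some v') => [[e]|]; last by rewrite mul0r mulr0.
    by rewrite e eqxx in ne.
  under eq_bigr do rewrite big_split /=.
  rewrite big_split /= addrA.
  have -> : \sum_(i < M) \sum_(j < M) chain_bd zC i j * ((x, y) == (i : nat, j : nat)) = chain_bd zC x y.
    case: (boolP ((x < M) && (y < M))%N) => [/andP[xM yM]|nM].
      exact: (sum_pick2 (chain_bd zC)).
    rewrite big1 => [|i _].
      case: (boolP (chain_bd zC x y)) => // /bdC0/lM[/andP[_ x1] /andP[_ y1]].
      by case/negP: nM; rewrite (ltnW x1) (ltnW y1).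
    rewrite big1 // => j _; case: eqP => [[ex ey]|]; last by rewrite mulr0.
    by case/negP: nM; rewrite ex ey !ltn_ord.
  rewrite boolDD add0r.
  transitivity (\sum_v ((x.+1, y.+1) == rho v) *
     \sum_(i < M) \sum_(j < M) at_label v i.+1 j.+1 * chain_bd zC i j).
    under eq_bigr do rewrite exchange_big /=.
    rewrite exchange_big /=; apply: eq_bigr => v _; rewrite mulr_sumr.
    by apply: eq_bigr => i _; rewrite mulr_sumr.
  (* The representative of [v] is reached once for each end of a contact in the class of [v]; by
     [stokes] that number is even. *)
  rewrite big1 // => v _; rewrite stokes -[X in _ = X](mulr0 ((x.+1, y.+1) == rho v)).
  by congr (_ * _); rewrite -[RHS](ev v) -(eps_reindex w (fun b i j => incidence b i j v)).
have zP b i j : z b i j = zC b i j \/ inner b i j.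
  case: (boolP (inner b i j)) => [|ni]; [by right|left].
  rewrite /z big1 ?addr0 // => i' _; rewrite big1 // => j' _.
  have [H _] := ZP (i'.+1, j'.+1).
  by case: (boolP (Z _ _ _ _)) => [/H|_]; rewrite ?(negbTE ni) ?mulr0.
have z0 b i : z b i 0%N = 0.
  case: (boolP (z b i 0%N)) => // H.
  have lN j : l j 0%N = None by case E: (l j 0%N) => //; have [_ /andP[]] : (0 < j < M)%N /\ (0 < 0 < M)%N by apply: lM; rewrite E.
  by case: (zP b i 0%N) => [e|]; [move: H; rewrite e => /zC0[]|case/andP]; rewrite lN.
have [x [x1 x2]] := potential bdz (z0 true) (z0 false); exists x.
have dz b i j : (0 < if b then j else i)%N -> dual_diff x b i j = z b i j.
  by rewrite /dual_diff; case: b; [case: j => // j _|case: i => // i _]; rewrite /= ?x1 ?x2.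
split=> [c|b i j ij nl].
  have [/andP[i0 _] /andP[j0 _]] := eps_bound c; rewrite dz; last by case: ifP.
  case: (zP (eps c).1.1 (eps c).1.2 (eps c).2) => [->|/andP[_ /eqP e]]; last by have [_ _ []] := epsP c.
  rewrite /zC (bigD1 c) //= big1 => [|c' /negbTE ne].
    by rewrite addr0; case: (eps c) => [[? ?] ?]; rewrite eqxx mulr1.
  by rewrite -!surjective_pairing (inj_eq eps_inj) ne mulr0.
rewrite dz //; move: nl; rewrite /live negb_or => /andP[ni /existsPn ne].
case: (zP b i j) => [->|]; last by rewrite (negbTE ni).
by rewrite /zC big1 // => c _; rewrite (negbTE (ne c)) mulr0.
Qed.

Section Faces.
Variable M' : nat.
Hypothesis MS : M = M'.+1.

Let square : finType := ('I_M'.+1 * 'I_M'.+1)%type.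
Let sq (i j : nat) : square := (inord i, inord j).

Definition dual_adj (s t : square) := [exists b : bool, exists i : 'I_M'.+1, exists j : 'I_M'.+1,
  [&& (0 < if b then j : nat else i)%N, ~~ live b i j, s == sq i j
    & t == if b then sq i j.-1 else sq i.-1 j]].

Let same_face := [rel s t | dual_adj s t || dual_adj t s].
Let face (s : square) := fingraph.root same_face s.

Let same_face_sym : connect_sym same_face.
Proof. by apply: sym_connect_sym => s t /=; rewrite orbC. Qed.

Let face_dual b i j : (i < M)%N -> (j < M)%N -> (0 < if b then j else i)%N -> ~~ live b i j ->
  face (sq i j) = face (if b then sq i j.-1 else sq i.-1 j).
Proof.
move=> iM jM ij nl; apply/(fingraph.rootP same_face_sym)/connect1 => /=; apply/orP; left.
rewrite MS in iM jM.
by apply/existsP; exists b; apply/existsP; exists (Ordinal iM); apply/existsP;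
  exists (Ordinal jM); rewrite /= ij nl !eqxx.
Qed.

Let face_of c : square * square :=
  let: (b, i, j) := eps c in (face (sq i j), face (if b then sq i j.-1 else sq i.-1 j)).

Let indic f i j : bool := face (sq i j) == f.

Let indic_diff f c : ((face_of c).1 == f) + ((face_of c).2 == f)
  = dual_diff (indic f) (eps c).1.1 (eps c).1.2 (eps c).2.
Proof. by rewrite /face_of /dual_diff /indic; case: (eps c) => [[[] i] j]. Qed.

(** The coboundary of the indicator of a face has no boundary, and pairing it with a label class
    leaves only contacts: an inner edge has both ends in one class, an edge that is not live has the
    same face on both sides, and labels vanish on the border. *)
Let face_even f v : \sum_c (((face_of c).1 == f) + ((face_of c).2 == f)) * eps_inc c v = 0.
Proof.
have := stokes (dual_diff (indic f)) v.
rewrite big1 => [|i _]; last first.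
  rewrite big1 // => j _; rewrite /chain_bd /dual_diff /=.
  by case: at_label; case: (indic f i j); case: (indic f i.+1 j);
    case: (indic f i j.+1); case: (indic f i.+1 j.+1).
move=> H; rewrite [RHS]H; under eq_bigr do rewrite indic_diff.
rewrite -(eps_reindex (fun c => dual_diff (indic f) (eps c).1.1 (eps c).1.2 (eps c).2)
  (fun b i j => incidence b i j v)).
apply: eq_bigr => b _; apply: eq_bigr => i _; apply: eq_bigr => j _.
case: (boolP [exists c, eps c == (b, i : nat, j : nat)]) => [/existsP[c /eqP ec]|ne].
  congr (_ * _); rewrite (bigD1 c) //= ec eqxx mulr1 big1 ?addr0 // => c' /negbTE nc.
  by rewrite -ec (inj_eq eps_inj) nc mulr0.
rewrite big1 => [|c _]; last first.
  by move/existsPn: ne => /(_ c)/negbTE ->; rewrite mulr0.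
rewrite mul0r -/(incidence b i j v).
case: (boolP (inner b i j)) => [/andP[_ /eqP e]|ni].
  by rewrite /incidence /at_label -e boolDD mulr0.
case: (boolP (0 < if b then j : nat else i)%N) => [ij|].
  rewrite /dual_diff /indic (_ : face (sq i j) = face (if b then sq i j.-1 else sq i.-1 j)).
    by case: (b); rewrite boolDD mul0r.
  by apply: face_dual; rewrite // /live negb_or ni.
rewrite -eqn0Ngt; case: b {ni ne} => /eqP e.
  by rewrite /incidence !at_label_border ?mulr0 //= e ?addn0 ?orbT.
by rewrite /incidence !at_label_border ?mulr0 //= e ?addn0 ?orbT.
Qed.

Lemma contact_bound g :
  (forall w : {set 'I_k}, w != finset.set0 -> (forall v, \sum_(c in w) eps_inc c v = 0) ->
    (g <= #|w|)%N) ->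
  (g * (k - #|V|) <= 2 * k)%N.
Proof.
move=> girth.
pose Bd : 'M[bool]_(k, #|V|) := \matrix_(c, v) eps_inc c (enum_val v).
pose Phi : 'M[bool]_(#|square|, k) :=
  \matrix_(f, c) (((face_of c).1 == enum_val f) + ((face_of c).2 == enum_val f)).
apply: (@euler_face_count bool k #|V| #|square| g Bd Phi).
- apply/row_subP => r; set w := row r _.
  have wBd : w *m Bd = 0 by rewrite -row_mul mulmx_ker row0.
  (* The potential of an even set can change only across live edges, hence is constant on faces; the
     set is the sum of the boundaries of the faces on which the potential is 1. *)
  have [|x [x1 x2]] := @even_lift (fun c => w ord0 c).
    move=> v; have /matrixP/(_ ord0 (enum_rank v)) := wBd; rewrite !mxE => H.
    by rewrite -[RHS]H; apply: eq_bigr => c _; rewrite !mxE enum_rankK.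
  pose xs (s : square) := x s.1 s.2.
  have xsq i j : (i < M)%N -> (j < M)%N -> xs (sq i j) = x i j.
    by rewrite MS => iM jM; rewrite /xs /= !inordK.
  have xadj s t : dual_adj s t -> xs s = xs t.
    case/existsP=> b /existsP[i /existsP[j /and4P[ij nl /eqP-> /eqP->]]].
    have := x2 _ _ _ ij nl; have iM : (i < M)%N by rewrite MS.
    have jM : (j < M)%N by rewrite MS.
    have iM1 := leq_ltn_trans (leq_pred i) iM; have jM1 := leq_ltn_trans (leq_pred j) jM.
    rewrite /dual_diff (xsq i j) //; case: b {ij nl}; rewrite xsq //;
    by case: (x i j); case: (x _ _).
  have xface s : xs s = xs (face s).
    have /connectP[p sp e] := connect_root same_face s; rewrite [face s]e {e}.
    elim: p s sp => //= t p IH s /andP[/orP st pt]; rewrite -(IH t pt).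
    by case: st => /xadj.
  apply/submxP; exists (\row_f xs (enum_val f)); apply/rowP => c.
  have -> : w ord0 c = xs (face_of c).1 + xs (face_of c).2.
    rewrite -(x1 c) /face_of; have [/andP[_ iM] /andP[_ jM]] := eps_bound c.
    case: (eps c) iM jM => [[b i] j] /= iM jM.
    have iM1 := leq_ltn_trans (leq_pred i) iM; have jM1 := leq_ltn_trans (leq_pred j) jM.
    by rewrite -!xface /dual_diff xsq //; case: b; rewrite xsq.
  have pick s : xs s = \sum_(f < #|square|) xs (enum_val f) * (s == enum_val f).
    rewrite (bigD1 (enum_rank s)) //= enum_rankK eqxx mulr1 big1 ?addr0 // => f ne.
    case: eqP => [e|]; last by rewrite mulr0.
    by rewrite e enum_valK eqxx in ne.
  rewrite !mxE (pick (face_of c).1) (pick (face_of c).2) -big_split.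
  by apply: eq_bigr => f _; rewrite !mxE mulrDr.
- apply/matrixP => f v; rewrite !mxE -[RHS](face_even (enum_val f) (enum_val v)).
  by apply: eq_bigr => c _; rewrite !mxE.
- move=> w w0 wBd; apply: girth.
    apply: contra w0 => /eqP e; apply/eqP/rowP => c; rewrite mxE.
    by have := finset.in_set0 c; rewrite -e inE => /negbFE/eqP.
  move=> v; have /matrixP/(_ ord0 (enum_rank v)) := wBd; rewrite !mxE => H.
  rewrite -[RHS]H big_mkcond; apply: eq_bigr => c _; rewrite inE !mxE enum_rankK.
  by case: (w ord0 c) => /=; rewrite ?mul1r ?mul0r.
- move=> c; apply: leq_trans (_ : #|[set enum_rank (face_of c).1; enum_rank (face_of c).2]%SET| <= 2)%N.
    apply/subset_leq_card/fintype.subsetP => f; rewrite !inE mxE.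
    case: ((face_of c).1 =P enum_val f) => [->|_]; first by rewrite enum_valK eqxx.
    case: ((face_of c).2 =P enum_val f) => [->|_ //]; by rewrite enum_valK eqxx orbT.
  by rewrite cards2; case: (_ != _).
Qed.
End Faces.
End Contacts.
End GridChains.

(** The label classes are the branch sets of [g] as a minor of a finite grid. Adjacencies of [g]
    must be realised but not conversely, so the notion passes to subgraphs and chance contacts
    between classes do no harm. *)
Definition grid_model (V : finType) (g : rel V) : Prop :=
  exists (M : nat) (l : nat -> nat -> option V),
  [/\ bounded_labelling l M, connected_labelling l &
    forall u v, g u v -> u != v ->
      exists p q, [/\ cell_adj p q, l p.1 p.2 = Some u & l q.1 q.2 = Some v]].

(** * Edge bounds from the girth *)

Section EdgeBounds.
Variables (V : finType).
Implicit Types (E F : {set {set V}}).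

Definition even_edges F := forall v, ~~ odd #|[set e in F | v \in e]|.

Lemma sum_bool_odd (I : finType) (w : {set I}) (b : I -> bool) :
  (\sum_(c in w) b c)%R = odd #|[set c in w | b c]|.
Proof.
rewrite -sum1_card big_mkcond [in RHS]big_mkcond /=.
rewrite (big_morph odd oddD (erefl : odd 0 = false)).
by apply: eq_bigr => c _; rewrite inE; case: (c \in w); case: (b c).
Qed.

Definition pair_edges (g : rel V) E := forall e, e \in E -> exists u v, [/\ u != v, e = [set u; v] & g u v].

Lemma grid_edge_bound (g : rel V) E n : grid_model g -> pair_edges g E ->
  (forall F, F \subset E -> F != finset.set0 -> even_edges F -> n <= #|F|) ->
  n * (#|E| - #|V|) <= 2 * #|E|.
Proof.
move=> [M [l [lM lc lg]]] Eg girth.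
(* One contact is selected for each edge, oriented so that its second cell is the successor in one
   coordinate. The labels of its two cells determine the edge, which makes the selection
   injective. *)
have [eps epsP] : exists eps : {set V} -> bool * nat * nat, forall e, e \in E ->
    exists u v, [/\ u != v, e = [set u; v], l (eps e).1.2 (eps e).2 = Some u
     & l ((eps e).1.2 + nat_of_bool (eps e).1.1) ((eps e).2 + ~~ (eps e).1.1) = Some v].
  suff /choice[f] : forall e, exists t : bool * nat * nat, e \in E ->
    exists u v, [/\ u != v, e = [set u; v], l t.1.2 t.2 = Some u
     & l (t.1.2 + nat_of_bool t.1.1) (t.2 + ~~ t.1.1) = Some v] by exists f.
  move=> e; case: (boolP (e \in E)) => [eE|]; last by exists (true, 0, 0).
  have [u [v [uv -> guv]]] := Eg _ eE.
  have [[i j] [[i' j'] [/= a lu lv]]] := lg _ _ guv uv.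
  have uv' : v != u by rewrite eq_sym.
  case/orP: a => /andP[/eqP/= e1 /orP[]/eqP/= e2]; subst.
  - by exists (false, i', j) => _; exists u, v; rewrite /= addn0 addn1.
  - by exists (false, i', j') => _; exists v, u; rewrite /= addn0 addn1 finset.setUC.
  - by exists (true, i, j') => _; exists u, v; rewrite /= addn0 addn1.
  - by exists (true, i', j') => _; exists v, u; rewrite /= addn0 addn1 finset.setUC.
case: (posnP #|E|) => [->|E0]; first by rewrite sub0n muln0.
have k0 : 0 < #|E| by [].
pose ep (c : 'I_#|E|) := eps (enum_val c).
have epP c : exists u v, [/\ u != v, enum_val c = [set u; v], l (ep c).1.2 (ep c).2 = Some u
    & l ((ep c).1.2 + nat_of_bool (ep c).1.1) ((ep c).2 + ~~ (ep c).1.1) = Some v].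
  exact: epsP (enum_valP c).
have ep_inj : injective ep.
  move=> c c' e; apply: enum_val_inj.
  have [u [v [_ -> lu lv]]] := epP c.
  have [u' [v' [_ -> lu' lv']]] := epP c'.
  by move: lu lv; rewrite e lu' lv' => -[->] [->].
have epc c : contact l (ep c).1.1 (ep c).1.2 (ep c).2.
  have [u [v [uv _ lu lv]]] := epP c.
  by split; rewrite ?lu ?lv // => -[e]; rewrite e eqxx in uv.
have incE c v : eps_inc l ep c v = (v \in enum_val c).
  have [u [u' [uv e lu lv]]] := epP c.
  rewrite /eps_inc /incidence /at_label lu lv e !inE !(inj_eq (@Some_inj _)) ![_ == v]eq_sym.
  by case: (v =P u) => [->|_]; [rewrite (negbTE uv)|case: (v == u')].
have M0 : M = M.-1.+1.
  have [/lM[/andP[_]]] := epc (Ordinal k0); by case: M {lM}.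
apply: (@contact_bound V l M lM lc #|E| ep ep_inj epc M.-1 M0) => w w0 ev.
rewrite -(card_imset w enum_val_inj); apply: girth.
- by apply/fintype.subsetP => e /imsetP[c _ ->]; apply: enum_valP.
- by apply: contra w0; rewrite imset_eq0.
- move=> v; have := ev v; rewrite sum_bool_odd => /negbT; congr (~~ odd _).
  rewrite -(card_imset _ enum_val_inj); apply: eq_card => e; rewrite inE.
  apply/imsetP/andP => [[c]|[/imsetP[c cw ->] ve]].
    by rewrite inE incE => /andP[cw ve] ->; split=> //; apply: imset_f.
  by exists c; rewrite // inE cw incE.
Qed.

Lemma even_edge_other F (e : {set V}) v : even_edges F -> e \in F -> v \in e ->
  exists2 f, f \in F & (f != e) && (v \in f).
Proof.
move=> ev eF ve; have := ev v.
rewrite (cardsD1 e) inE eF ve /= negbK.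
case: (set_0Vmem ([set e0 in F | v \in e0] :\ e)) => [->|[f]]; first by rewrite cards0.
by rewrite !inE => /and3P[fe fF vf] _; exists f => //; rewrite fe.
Qed.

(** A nonempty even set contains an edge [uv], another edge at [u] and another at [v], and the last
    two differ since no two edges have the same ends. So the girth bound applies with 3. *)
Lemma planar_edge_bound (g : rel V) E : grid_model g -> pair_edges g E -> #|E| <= 3 * #|V|.
Proof.
move=> gm Eg; suff : 3 * (#|E| - #|V|) <= 2 * #|E| by lia.
apply: (grid_edge_bound gm Eg) => F FE F0 ev.
have FP f : f \in F -> exists u v, u != v /\ f = [set u; v].
  by move=> /(fintype.subsetP FE)/Eg[u [v [? ? _]]]; exists u, v.
have [e eF] := set0Pn _ F0; have [u [v [uv ee]]] := FP _ eF.
have ue : u \in e by rewrite ee !inE eqxx.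
have ve : v \in e by rewrite ee !inE eqxx orbT.
have [f fF /andP[fe uf]] := even_edge_other ev eF ue.
have [h hF /andP[he vh]] := even_edge_other ev eF ve.
have fh : f != h.
  apply: contraNneq fe => fh; rewrite -fh in vh.
  have [x [y [xy ef]]] := FP _ fF; rewrite eqEcard ee ef !cards2 uv xy andbT.
  apply/fintype.subsetP => z; rewrite ef !inE in uf vh *; move: uv.
  by case/orP: uf => /eqP->; case/orP: vh => /eqP->; rewrite ?eqxx // => _; rewrite // orbC.
have /card_uniqP/= <- : uniq [:: e; f; h].
  by rewrite /= !inE ![e == _]eq_sym negb_or fe he fh.
by apply/subset_leq_card/fintype.subsetP => z; rewrite !inE => /or3P[] /eqP->.
Qed.

(** Across a bipartition an even set cannot close up after three edges, so the girth bound applies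
    with 4. The constant 2, below 3, is what bounds the number of vertices of degree at least three
    in [twin_free_bound]. *)
Lemma bipartite_edge_bound (g : rel V) (A : {set V}) E : grid_model g -> pair_edges g E ->
  (forall u v, [set u; v] \in E -> (u \in A) != (v \in A)) -> #|E| <= 2 * #|V|.
Proof.
move=> gm Eg bip; suff : 4 * (#|E| - #|V|) <= 2 * #|E| by lia.
apply: (grid_edge_bound gm Eg) => F FE F0 ev.
have FP f x : f \in F -> x \in f -> exists y, [/\ (x \in A) != (y \in A), x != y & f = [set x; y]].
  move=> fF xf; have fE := fintype.subsetP FE _ fF; have [u [v [uv ef _]]] := Eg _ fE.
  have b := bip u v; rewrite -ef fE in b; move: xf; rewrite ef !inE => /orP[]/eqP->.
    by exists v; split=> //; apply: b.
  exists u; rewrite finset.setUC eq_sym; split=> //; last by rewrite eq_sym.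
  by rewrite b.
have [e eF] := set0Pn _ F0.
have [u0 [v0 [uv0 ee0 _]]] := Eg _ (fintype.subsetP FE _ eF).
have u0e : u0 \in e by rewrite ee0 !inE eqxx.
have [v [uvA uv ee]] := FP _ _ eF u0e; move: u0e; set u := u0 in uvA uv ee * => ue.
have ve : v \in e by rewrite ee !inE eqxx orbT.
have [f fF /andP[fe uf]] := even_edge_other ev eF ue.
have [h hF /andP[he vh]] := even_edge_other ev eF ve.
have [w [vwA vw eh]] := FP _ _ hF vh.
have wh : w \in h by rewrite eh !inE eqxx orbT.
have [i iF /andP[ih wi]] := even_edge_other ev hF wh.
have [y [uyA uy ef]] := FP _ _ fF uf.
have [z [wzA wz ei]] := FP _ _ iF wi.
have uw : u != w by apply: contraNneq he => uw; rewrite eh ee uw finset.setUC.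
have neA x x' : (x \in A) != (x' \in A) -> x != x' by apply: contraNneq => ->.
have uz : u != z.
  by apply: neA; move: uvA vwA wzA; case: (u \in A); case: (v \in A); case: (w \in A);
    case: (z \in A).
have fh : f != h.
  by apply: contraTneq uf => ->; rewrite eh !inE negb_or uw uv.
have ie : i != e.
  by apply: contraTneq wi => ->; rewrite ee !inE negb_or (eq_sym w u) uw (eq_sym w v) vw.
have if_ : i != f.
  by apply: contraTneq uf => <-; rewrite ei !inE negb_or uw uz.
have /card_uniqP/= c4 : uniq [:: e; f; h; i].
  by rewrite /= !inE !negb_or (eq_sym e f) fe (eq_sym e h) he (eq_sym e i) ie fh (eq_sym f i) if_ (eq_sym h i) ih.
apply: (@leq_trans #|[:: e; f; h; i]|); first by rewrite c4.
by apply/subset_leq_card/fintype.subsetP => t; rewrite !inE => /or4P[] /eqP->.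
Qed.
End EdgeBounds.

(** * Minors of grid models *)

Lemma cell_adj_sym p q : cell_adj p q = cell_adj q p.
Proof.
rewrite /cell_adj [p.1 == _]eq_sym [p.2 == _]eq_sym.
by rewrite [(q.2.+1 == _) || _]orbC [(q.1.+1 == _) || _]orbC.
Qed.

Lemma clos_rt_sym (T : Type) (r : T -> T -> bool) : symmetric r ->
  forall x y, clos_refl_trans _ (fun a b => r a b) x y -> clos_refl_trans _ (fun a b => r a b) y x.
Proof.
move=> rs x y; elim=> [a b ab|a|a b c _ H1 _ H2]; first by apply: rt_step; rewrite rs.
  exact: rt_refl.
exact: rt_trans H2 H1.
Qed.

(** Relabelling cells along the partial map [f] performs deletion (value [None]) and contraction at
    once. Each fibre is a star around a centre [c], so any cell of the new class reaches the old
    class of [c] through a contact. Stars suffice for matching edges, for twins and for vertices of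
    degree two. *)
Lemma grid_model_star_minor (V V' : finType) (g : rel V) (h : rel V') (f : V -> option V') :
  grid_model g -> irreflexive g ->
  (forall x, exists c, forall u, f u = Some x -> u = c \/ f c = Some x /\ g u c) ->
  (forall x y, h x y -> x != y -> exists u v, [/\ f u = Some x, f v = Some y & g u v]) ->
  grid_model h.
Proof.
move=> [M [l [lM lc lg]]] gi star hg.
pose l' i j := obind f (l i j).
exists M, l'; split.
- by move=> i j; rewrite /l'; case E: (l i j) => [v|//] _; apply: lM; rewrite E.
- move=> p q lp lpq.
  pose R := fun a b => cell_adj a b && (l' a.1 a.2 == l' b.1 b.2).
  rewrite -/(clos_refl_trans _ (fun a b => R a b) p q).
  have Rs : symmetric R by move=> a b; rewrite /R cell_adj_sym eq_sym.
  have same a b : l a.1 a.2 <> None -> l a.1 a.2 = l b.1 b.2 ->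
      clos_refl_trans _ (fun a b => R a b) a b.
    move=> la lab; elim: (lc _ _ la lab) => [x y /andP[xy /eqP e]|x|x y z _ H1 _ H2].
    - by apply: rt_step; rewrite /R xy /l' e eqxx.
    - exact: rt_refl.
    - exact: rt_trans H1 H2.
  case Ep: (l p.1 p.2) lp lpq => [u|] lp; last by rewrite /l' Ep in lp.
  rewrite {1}/l' Ep /=; case Eu: (f u) => [x|]; last by rewrite /l' Ep /= Eu in lp.
  rewrite /l'; case Eq: (l q.1 q.2) => [v|//] /= /esym Ev.
  have [c cP] := star x.
  have to_c a w : l a.1 a.2 = Some w -> f w = Some x -> w <> c ->
      exists2 b, l b.1 b.2 = Some c & clos_refl_trans _ (fun a b => R a b) a b.
    move=> la fw wc; have [//|[fc gwc]] := cP _ fw.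
    have [|a' [b [ab la' lb]]] := lg _ _ gwc; first by apply/eqP.
    exists b => //; apply: (rt_trans _ _ _ a').
      by apply: same; rewrite la ?la'.
    by apply: rt_step; rewrite /R ab /l' la' lb /= fw fc.
  have [euc|/eqP nuc] := eqVneq u c; have [evc|/eqP nvc] := eqVneq v c.
  + by apply: same; rewrite Ep ?Eq // euc evc.
  + have [b lb qb] := to_c _ _ Eq Ev nvc.
    apply: (rt_trans _ _ _ b); last exact: clos_rt_sym.
    by apply: same; rewrite Ep ?lb ?euc.
  + have [b lb pb] := to_c _ _ Ep Eu nuc.
    by apply: (rt_trans _ _ _ b) => //; apply: same; rewrite lb ?Eq ?evc.
  + have [b lb pb] := to_c _ _ Ep Eu nuc; have [b' lb' qb'] := to_c _ _ Eq Ev nvc.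
    apply: (rt_trans _ _ _ b) => //; apply: (rt_trans _ _ _ b'); last exact: clos_rt_sym.
    by apply: same; rewrite lb ?lb'.
- move=> x y hxy xy; have [u [v [fu fv guv]]] := hg _ _ hxy xy.
  have uv : u != v by apply: contraTneq guv => ->; rewrite gi.
  have [p [q [pq lp lq]]] := lg _ _ guv uv.
  by exists p, q; split=> //; rewrite /l' ?lp ?lq.
Qed.

Section Induced.
Variables (V : finType) (g : rel V).
Hypotheses (gi : irreflexive g) (gm : grid_model g).

Lemma grid_model_induced (W : {set V}) :
  grid_model (fun u v : {x | x \in W} => g (val u) (val v)).
Proof.
apply: (grid_model_star_minor (f := fun v => insub v) gm gi).
- move=> x; exists (val x) => u e; left.
  by case: insubP e => // u' _ <- [->].
- by move=> x y gxy _; exists (val x), (val y); rewrite !valK.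
Qed.

Lemma pair_edges_induced (W : {set V}) (E : {set {set V}}) : pair_edges g E ->
  (forall e, e \in E -> e \subset W) ->
  exists E' : {set {set {x | x \in W}}}, [/\ #|E'| = #|E|,
    pair_edges (fun u v : {x | x \in W} => g (val u) (val v)) E' &
    forall u v, [set u; v] \in E' -> [set val u; val v] \in E].
Proof.
move=> Eg EW; pose r (e : {set V}) := [set x : {x | x \in W} | val x \in e].
have rK e : e \in E -> [set val x | x in r e] = e.
  move=> eE; apply/setP => v; apply/imsetP/idP => [[x]|ve]; first by rewrite inE => xe ->.
  have vW := fintype.subsetP (EW _ eE) _ ve.
  by exists (Sub v vW); rewrite ?inE.
exists [set r e | e in E]; split.
- by apply: card_in_imset => e f eE fE ef; rewrite -(rK _ eE) ef rK.
- move=> _ /imsetP[e eE ->]; have [u [v [uv ee guv]]] := Eg _ eE.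
  have uW : u \in W by apply: (fintype.subsetP (EW _ eE)); rewrite ee !inE eqxx.
  have vW : v \in W by apply: (fintype.subsetP (EW _ eE)); rewrite ee !inE eqxx orbT.
  exists (Sub u uW), (Sub v vW); split=> //.
  by apply/setP => x; rewrite !inE ee !inE -!val_eqE.
- move=> u v /imsetP[e eE euv]; suff -> : [set val u; val v] = e by [].
  by rewrite -(rK _ eE) -euv imsetU !imset_set1.
Qed.

Lemma planar_edge_bound_in (W : {set V}) E : pair_edges g E ->
  (forall e, e \in E -> e \subset W) -> #|E| <= 3 * #|W|.
Proof.
move=> Eg EW; have [E' [<- E'g _]] := pair_edges_induced Eg EW.
have <- : #|{: {x | x \in W}}| = #|W| by rewrite card_sig; apply: eq_card.
by apply: planar_edge_bound (grid_model_induced W) E'g.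
Qed.

Lemma bipartite_edge_bound_in (W A : {set V}) E : pair_edges g E ->
  (forall e, e \in E -> e \subset W) ->
  (forall u v, [set u; v] \in E -> (u \in A) != (v \in A)) -> #|E| <= 2 * #|W|.
Proof.
move=> Eg EW bip; have [E' [<- E'g E'E]] := pair_edges_induced Eg EW.
have <- : #|{: {x | x \in W}}| = #|W| by rewrite card_sig; apply: eq_card.
apply: (bipartite_edge_bound (A := [set x | val x \in A]) (grid_model_induced W) E'g) => u v.
by rewrite !inE => /E'E/bip.
Qed.

End Induced.

(** * Independent vertices with distinct neighbourhoods *)

Section TwinFree.
Variables (V : finType) (g : rel V).
Hypotheses (gs : symmetric g) (gi : irreflexive g) (gm : grid_model g).

Definition nbhd v := [set w | g v w].

(** Count by degree. There is at most one vertex of degree 0 and at most [|X|] of degree 1. Those of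
    degree 2, merged into one of their neighbours, become distinct edges on [X], hence at most
    [3|X|]. The [j] vertices of degree at least 3 form a bipartite graph with [X], so
    [3j <= 2(j + |X|)] and [j <= 2|X|]. *)
Lemma twin_free_bound (X J : {set V}) : (forall j, j \in J -> j \notin X) ->
  (forall j, j \in J -> nbhd j \subset X) -> {in J &, injective nbhd} ->
  #|J| <= 6 * #|X| + 1.
Proof.
move=> JX nX ninj.
have sub (P : pred V) : {in [set j in J | P j] &, injective nbhd}.
  by move=> x y; rewrite !inE => /andP[? _] /andP[? _]; apply: ninj.
have nE j w : (w \in nbhd j) = g j w by rewrite inE.
pose Jd d := [set j in J | #|nbhd j| == d].
pose J3 := [set j in J | 3 <= #|nbhd j|].
have c0 : #|Jd 0| <= 1.
  rewrite -(card_in_imset (sub _)) -(cards1 (@finset.set0 V)).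
  apply/subset_leq_card/fintype.subsetP => e /imsetP[j]; rewrite !inE => /andP[_].
  by rewrite cards_eq0 => /eqP-> ->; rewrite eqxx.
have c1 : #|Jd 1| <= #|X|.
  rewrite -(card_in_imset (sub _)); apply: (leq_trans _ (leq_imset_card (@finset.set1 V) X)).
  apply/subset_leq_card/fintype.subsetP => e /imsetP[j]; rewrite inE => /andP[jJ].
  move=> /cards1P[x ex] ->; rewrite ex imset_f //.
  by apply: (fintype.subsetP (nX _ jJ)); rewrite ex set11.
have c2 : #|Jd 2| <= 3 * #|X|.
  rewrite -(card_in_imset (sub _)).
  pose h x y := [exists j in Jd 2, nbhd j == [set x; y]].
  have gh : grid_model h.
    apply: (grid_model_star_minor (f := fun v => if v \in X then Some v
              else if v \in Jd 2 then [pick x in nbhd v] else None) gm gi).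
    - move=> x; exists x => u; case: ifP => [_ [->]|uX]; first by left.
      case: ifP => // uJ; case: pickP => // y; rewrite inE => gux [<-]; right; split=> //.
      have -> // : y \in X; apply: (fintype.subsetP (nX u _)); last by rewrite inE.
      by move: uJ; rewrite inE => /andP[].
    - move=> x y /existsP[j /andP[jJ /eqP ej]] xy.
      have jJ' : j \in J by move: jJ; rewrite inE => /andP[].
      have [xX yX] : x \in X /\ y \in X.
        by split; apply: (fintype.subsetP (nX j jJ')); rewrite ej !inE eqxx ?orbT.
      have [gx gy] : g j x /\ g j y.
        by rewrite -!nE ej !inE !eqxx orbT.
      have : exists2 z, [pick x in nbhd j] = Some z & (z == x) || (z == y).
        case: pickP => [z|/(_ x)]; last by rewrite ej !inE eqxx.
        by rewrite ej !inE => zz; exists z.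
      case=> z ez /orP[]/eqP ezz; subst z.
        by exists j, y; rewrite (negbTE (JX _ jJ')) jJ ez yX.
      by exists x, j; rewrite (negbTE (JX _ jJ')) jJ ez xX gs.
  have hi : irreflexive h.
    move=> x; apply/negbTE/negP => /existsP[j /andP[]]; rewrite inE => /andP[_ /eqP cj] /eqP e.
    by move: cj; rewrite e finset.setUid cards1.
  apply: (@planar_edge_bound_in V h hi gh X (nbhd @: Jd 2)).
    move=> _ /imsetP[j jJ ->]; have/cards2P[x [y [xy e]]] : #|nbhd j| == 2 by move: jJ; rewrite inE => /andP[].
    by exists x, y; split=> //; apply/existsP; exists j; rewrite jJ e eqxx.
  by move=> _ /imsetP[j + ->]; rewrite inE => /andP[/nX].
have c3 : 3 * #|J3| <= 2 * (#|J3| + #|X|).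
  pose P : {set V * V} := [set p | (p.1 \in J3) && (p.2 \in nbhd p.1)].
  have J3J j : j \in J3 -> j \in J by rewrite inE => /andP[].
  have PX p : p \in P -> [/\ p.1 \in J3, p.2 \in X, p.1 \notin X & g p.1 p.2].
    rewrite !inE => /andP[pJ gp]; have pJ' := J3J p.1; rewrite inE pJ in pJ'.
    by split=> //; [apply: (fintype.subsetP (nX _ (pJ' isT))); rewrite inE|apply: JX; apply: pJ'].
  have cP : 3 * #|J3| <= #|P|.
    rewrite mulnC -sum_nat_const.
    have -> : #|P| = \sum_(j in J3) #|nbhd j|.
      rewrite -sum1_card (eq_bigl (fun p => (p.1 \in J3) && (p.2 \in nbhd p.1))).
        by rewrite -(pair_big_dep (fun j => j \in J3) (fun j w => w \in nbhd j) (fun _ _ => 1)) /=; apply: eq_bigr => j _; rewrite sum1_card.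
      by move=> p; rewrite inE.
    by apply: leq_sum => j; rewrite inE => /andP[].
  have inj : {in P &, injective (fun p => [set p.1; p.2])}.
    move=> [a b] [c d] /PX[/= _ bX aX _] /PX[/= _ dX cX _] /setP e.
    have := e a; rewrite !inE eqxx /= => /esym; rewrite -[_ || _]/(_).
    have nad : (a == d) = false by apply: contraNF aX => /eqP->.
    rewrite nad orbF => /eqP ->; congr (_, _).
    have := e b; rewrite !inE eqxx orbT => /esym /orP[]/eqP // bc.
    by rewrite -bc bX in cX.
  apply: leq_trans cP _; rewrite -(card_in_imset inj).
  have dXJ : #|J3 :|: X| <= #|J3| + #|X| by rewrite cardsU leq_subr.
  apply: (leq_trans _ (leq_mul (leqnn 2) dXJ)).
  apply: (bipartite_edge_bound_in gi gm (A := X)).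
  - move=> _ /imsetP[p /PX[_ pX p1 gp] ->]; exists p.1, p.2; split=> //.
    by apply: contraNneq p1 => ->.
  - move=> _ /imsetP[p /PX[p1 p2 _ _] ->]; apply/fintype.subsetP => x.
    by case/finset.set2P=> ->; rewrite finset.in_setU ?p1 ?p2 ?orbT.
  - move=> u v /imsetP[p /PX[_ pX p1 _] /setP e].
    have := e p.1; have := e p.2; rewrite !inE !eqxx orbT /=.
    have ne : p.1 != p.2 by apply: contraNneq p1 => ->.
    move=> /orP[]/eqP e2 /orP[]/eqP e1; rewrite -?e1 -?e2 ?pX ?(negbTE p1) //.
    + by rewrite e1 e2 eqxx in ne.
    + by rewrite e1 e2 eqxx in ne.
have JU : #|J| <= #|Jd 0| + #|Jd 1| + #|Jd 2| + #|J3|.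
  apply: (@leq_trans #|Jd 0 :|: Jd 1 :|: Jd 2 :|: J3|).
    apply/subset_leq_card/fintype.subsetP => j jJ; rewrite !inE jJ /=.
    by case: #|nbhd j| => [|[|[|]]].
  by do 3! [apply: leq_trans (leq_card_setU _ _) _; rewrite leq_add2r].
lia.
Qed.

End TwinFree.

(** * Counting graphs with sparse minors *)

Section Reduction.
Variables (V : finType) (g : rel V).
Hypotheses (gs : symmetric g) (gi : irreflexive g) (gm : grid_model g).

Definition quotient_rel (rep : V -> V) : rel V :=
  fun x y => (x != y) && [exists u, exists v, [&& rep u == x, rep v == y & g u v]].

Definition is_matching (M : seq (V * V)) :=
  uniq (unzip1 M ++ unzip2 M) && all (fun p => g p.1 p.2) M.

Lemma maximal_matching : exists2 M, is_matching M &
  forall u v, g u v -> (u \in unzip1 M ++ unzip2 M) || (v \in unzip1 M ++ unzip2 M).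
Proof.
pose P n := `[< exists2 M, is_matching M & size M = n >].
have P0 : exists n, P n by exists 0; apply/asboolP; exists [::].
have Pb n : P n -> n <= #|V|.
  move=> /asboolP[M /andP[uM _] <-]; move: uM; rewrite cat_uniq => /andP[u1 _].
  by rewrite -(size_map fst) -(card_uniqP u1) max_card.
case: (ex_maxnP P0 Pb) => n /asboolP[M mM sM] nmax; exists M => // u v guv.
apply: contraT; rewrite negb_or => /andP[uM vM].
have /nmax : P n.+1; last by rewrite ltnn.
apply/asboolP; exists ((u, v) :: M); last by rewrite /= sM.
move: mM => /andP[mM aM]; rewrite /is_matching /= guv aM andbT.
have uv : u != v by apply: contraTneq guv => ->; rewrite gi.
rewrite mem_cat inE negb_or -andbA.
move: uM vM; rewrite !mem_cat !negb_or => /andP[-> ->] /andP[v1 v2]; rewrite uv /=.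
move: mM; rewrite !cat_uniq /= v2 => /and3P[-> /negbTE H ->].
by rewrite negb_or v1 H.
Qed.

(** The first end of a matching edge represents both ends and [beta] marks the second, so that [rep]
    and [beta] together still determine the vertex while [size M] vertices disappear. *)
Lemma matching_quotient M : is_matching M -> exists (rep : V -> V) (beta : V -> bool),
  [/\ #|[set rep v | v : V]| + size M <= #|V|,
     forall u v, rep u = rep v -> beta u = beta v -> u = v &
     grid_model (quotient_rel rep)].
Proof.
move=> /andP[]; rewrite cat_uniq => /and3P[u1 dj u2] /allP aM.
pose rep v := nth v (unzip1 M) (index v (unzip2 M)).
have sz : size (unzip1 M) = size (unzip2 M) by rewrite !size_map.
have repN v : v \notin unzip2 M -> rep v = v.
  by move=> vM; rewrite /rep nth_default // memNindex // sz.
have repP p : p \in M -> rep p.2 = p.1.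
  move=> pM; have iM : index p M < size M by rewrite index_mem.
  rewrite /rep; have -> : index p.2 (unzip2 M) = index p M.
    rewrite -{1}(nth_index p pM) -(nth_map p p.2 snd iM) index_uniq ?size_map //.
  by rewrite (nth_map p) ?nth_index.
have not2 p : p \in M -> p.1 \notin unzip2 M.
  move=> pM; apply: contra dj => p2; apply/hasP; exists p.1 => //.
  exact: map_f.
have dec v : v \notin unzip2 M \/ exists2 p, p \in M & v = p.2.
  by case: (boolP (v \in unzip2 M)) => [/mapP[p pM ->]|]; [right; exists p|left].
exists rep, (fun v => v \in unzip2 M); split.
- have <- : #|[set v in unzip2 M]| = size M.
    by rewrite cardsE (card_uniqP u2) size_map.
  rewrite -(cardsC [set v in unzip2 M]) addnC leq_add2l.
  apply/subset_leq_card/fintype.subsetP => _ /imsetP[v _ ->].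
  rewrite !inE; case: (dec v) => [vM|[p pM ->]]; first by rewrite repN.
  by rewrite repP ?not2.
- move=> u v; case: (dec u) => [uM|[p pM ->]]; case: (dec v) => [vM|[q qM ->]].
  + by rewrite !repN.
  + by rewrite (negbTE uM) map_f.
  + by rewrite (negbTE vM) map_f.
  + rewrite !repP // => pq _.
    have iM (r : V * V) : r \in M -> index r.1 (unzip1 M) = index r M.
      move=> rM; have iM : index r M < size M by rewrite index_mem.
      by rewrite -{1}(nth_index r rM) -(nth_map r r.1 fst iM) index_uniq ?size_map.
    have := iM _ pM; rewrite pq iM // => e.
    by rewrite -(nth_index p pM) -e nth_index.
- apply: (grid_model_star_minor (f := fun v => Some (rep v)) gm gi).
    move=> x; exists x => u [<-]; case: (dec u) => [uM|[p pM ->]]; first by left; rewrite repN.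
    by right; rewrite repP // repN ?not2 // gs aM.
  move=> x y /andP[_ /existsP[u /existsP[v /and3P[/eqP<- /eqP<- guv]]]] _.
  by exists u, v.
Qed.

(** The vertices outside a maximal matching are independent, with all their neighbours among the at
    most [2 * size M] matched ones. One vertex per twin class leaves at most [6 * (2 * size M) + 1]
    of them, and the matched vertices are kept. *)
Lemma twin_quotient M : is_matching M ->
  (forall u v, g u v -> (u \in unzip1 M ++ unzip2 M) || (v \in unzip1 M ++ unzip2 M)) ->
  exists rep : V -> V,
  [/\ #|[set rep v | v : V]| <= 14 * size M + 1,
     forall u v, rep u = rep v -> nbhd g u = nbhd g v &
     grid_model (quotient_rel rep)].
Proof.
move=> _ mM; pose X := [set v in unzip1 M ++ unzip2 M].
have cX : #|X| <= 2 * size M.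
  by rewrite cardsE (leq_trans (card_size _)) // size_cat !size_map mul2n addnn.
pose tw v := [pick u | (u \notin X) && (nbhd g u == nbhd g v)].
pose rep v := if v \in X then v else odflt v (tw v).
have repX v : v \in X -> rep v = v by rewrite /rep => ->.
have repN v : v \notin X -> rep v \notin X /\ nbhd g (rep v) = nbhd g v.
  move=> vX; rewrite /rep (negbTE vX) /tw; case: pickP => //= u /andP[? /eqP ?].
  by [].
have rep_nb v : nbhd g (rep v) = nbhd g v.
  by case: (boolP (v \in X)) => [/repX->//|/repN[]].
have twE u v : u \notin X -> v \notin X -> nbhd g u = nbhd g v -> rep u = rep v.
  move=> uX vX e; rewrite /rep (negbTE uX) (negbTE vX) /tw e.
  by case: pickP => // /(_ v); rewrite vX eqxx.
have idem v : rep (rep v) = rep v.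
  case: (boolP (v \in X)) => vX; first by rewrite !(repX v vX).
  by have [rX e] := repN _ vX; apply: twE.
exists rep; split.
- pose J := [set rep v | v in ~: X].
  have JX j : j \in J -> j \notin X.
    by case/imsetP=> v; rewrite inE => /repN[rX _] ->.
  have : #|J| <= 6 * #|X| + 1.
    apply: (twin_free_bound gs gi gm) => //.
    - move=> j jJ; apply/fintype.subsetP => x; rewrite [_ \in nbhd _ _]inE => /mM.
      by have := JX _ jJ; rewrite ![_ \in X]inE => /negbTE ->.
    - move=> _ _ /imsetP[u uX ->] /imsetP[v vX ->]; rewrite !rep_nb => e.
      by apply: twE; rewrite ?e //; [move: uX|move: vX]; rewrite inE.
  suff : #|[set rep v | v : V]| <= #|X| + #|J| by lia.
  apply: leq_trans (leq_card_setU X J).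
  apply/subset_leq_card/fintype.subsetP => _ /imsetP[v _ ->]; rewrite finset.in_setU.
  by case: (boolP (v \in X)) => vX; [rewrite repX ?vX|rewrite imset_f ?orbT // inE].
- by move=> u v e; rewrite -(rep_nb u) e rep_nb.
- have nE u w : g u w = (w \in nbhd g u) by rewrite inE.
  apply: (grid_model_star_minor (f := fun v => if rep v == v then Some v else None) gm gi).
    by move=> x; exists x => u; case: ifP => // _ [->]; left.
  move=> x y /andP[_ /existsP[u /existsP[v /and3P[/eqP<- /eqP<- guv]]]] _.
  exists (rep u), (rep v); rewrite !idem !eqxx; split=> //.
  by rewrite nE rep_nb -nE gs nE rep_nb -nE gs.
Qed.

(** Either a maximal matching has at least [|V| / 30] edges and contracting it removes a thirtieth
    of the vertices, or twin reduction leaves at most [14 * size M + 1] classes with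
    [30 * size M < |V|], which is below [29|V| / 30] once [|V| >= 2]. Either way adjacency can be
    read off [rep] and [beta]. *)
Lemma sparse_quotient : 2 <= #|V| -> exists (rep : V -> V) (beta : V -> bool),
  [/\ 30 * #|[set rep v | v : V]| + #|V| <= 30 * #|V|,
     forall u u' v v', rep u = rep u' -> beta u = beta u' -> rep v = rep v' ->
       beta v = beta v' -> g u v = g u' v' &
     grid_model (quotient_rel rep)].
Proof.
move=> V2; have [M mM maxM] := maximal_matching.
have [big|small] := leqP #|V| (30 * size M).
  have [rep [beta [c inj q]]] := matching_quotient mM; exists rep, beta; split=> //.
    lia.
  by move=> u u' v v' e1 b1 e2 b2; rewrite (inj _ _ e1 b1) (inj _ _ e2 b2).
have [rep [c nb q]] := twin_quotient mM maxM; exists rep, (fun _ => false); split=> //.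
  lia.
move=> u u' v v' e1 _ e2 _; have nE a w : g a w = (w \in nbhd g a) by rewrite inE.
by rewrite nE (nb _ _ e1) -nE gs nE (nb _ _ e2) -nE gs.
Qed.

End Reduction.

(** * Codes of unlabelled graphs *)

Lemma bin_le_exp2 n m : 'C(n, m) <= 2 ^ n.
Proof.
have [mn|nm] := leqP m n; last by rewrite bin_small.
have mn' : m < n.+1 by [].
rewrite (expnDn 1 1 n) (bigD1 (Ordinal mn')) //=.
by rewrite !exp1n !muln1 leq_addr.
Qed.

(** Up to order a tuple is a multiset, and sorted tuples are counted by a binomial coefficient with
    upper index [n + #|L| - 1]. Counting all tuples instead would give [#|L| ^ n], too much when
    [#|L|] grows with [n]. *)
Lemma tuple_representatives (L : finType) n : exists O : {set n.-tuple L},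
  #|O| <= 2 ^ (n + #|L|) /\ forall t : n.-tuple L, exists2 t', t' \in O & perm_eq t t'.
Proof.
case: (pickP (mem L)) => [x0 _|noL]; last first.
  exists [set: n.-tuple L]; split; last by move=> t; exists t.
  rewrite cardsT card_tuple (eq_card0 noL).
  by case: n => [|n]; rewrite ?expn0 ?exp0n // expn_gt0.
have [c cL] : exists c, #|L| = c.+1.
  by exists #|L|.-1; rewrite prednK //; apply/card_gt0P; exists x0.
pose f (i : 'I_c.+1) := nth x0 (enum L) i.
have rk x : index x (enum L) < c.+1 by rewrite -cL cardE index_mem mem_enum.
pose r x : 'I_c.+1 := Ordinal (rk x).
have rK x : f (r x) = x by rewrite /f /r /= nth_index ?mem_enum.
exists [set map_tuple f t | t in [set t : n.-tuple 'I_c.+1 | sorted leq [seq val i | i <- t]]].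
split.
  apply: leq_trans (leq_imset_card _ _) _; rewrite card_sorted_tuples.
  apply: leq_trans (bin_le_exp2 _ _) _; rewrite leq_exp2l // cL; lia.
move=> t; pose st := sort (fun i j : 'I_c.+1 => i <= j) (map_tuple r t).
have sz : size st == n by rewrite size_sort size_tuple.
exists (map_tuple f (Tuple sz)).
  apply: imset_f; rewrite inE /= sorted_map.
  by apply: sort_sorted => i j; apply: leq_total.
rewrite /= perm_sym.
have -> : tval t = [seq f i | i <- map r t] by rewrite -map_comp map_id_in // => x _ /=.
by apply: perm_map; rewrite /st perm_sort.
Qed.

Lemma grid_model_card (n : nat) (g : rel 'I_n) : symmetric g -> irreflexive g -> grid_model g ->
  #|[set p : 'I_n * 'I_n | g p.1 p.2]| <= 6 * n.
Proof.
move=> gs gi gm; set P := [set p | _].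
pose E := [set [set p.1; p.2] | p in P].
have Eb : #|E| <= 3 * n.
  rewrite -[X in _ <= 3 * X]card_ord; apply: (planar_edge_bound gm).
  move=> _ /imsetP[p pP ->]; exists p.1, p.2; move: pP; rewrite inE => gp; split=> //.
  by apply: contraTneq gp => ->; rewrite gi.
have half (Q : pred ('I_n * 'I_n)) : (forall p q, Q p -> Q q -> [set p.1; p.2] = [set q.1; q.2] -> p = q) ->
    #|[set p in P | Q p]| <= 3 * n.
  move=> inj; apply: leq_trans Eb.
  rewrite -(card_in_imset (f := fun p : 'I_n * 'I_n => [set p.1; p.2])).
    apply/subset_leq_card/fintype.subsetP => _ /imsetP[p + ->].
    by rewrite inE => /andP[pP _]; apply: imset_f.
  by move=> p q; rewrite 2!inE => /andP[_ ?]; rewrite inE => /andP[_ ?]; apply: inj.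
have mem12 (p q : 'I_n * 'I_n) : [set p.1; p.2] = [set q.1; q.2] ->
    ((p.1 == q.1) || (p.1 == q.2)) && ((p.2 == q.1) || (p.2 == q.2)).
  by move/setP=> e; have := e p.1; have := e p.2; rewrite !inE !eqxx orbT /= => <- <-.
have h1 := half (fun p => p.1 < p.2); have h2 := half (fun p => p.2 < p.1).
have : P \subset [set p in P | (fun p : 'I_n * 'I_n => p.1 < p.2) p] :|:
                 [set p in P | (fun p : 'I_n * 'I_n => p.2 < p.1) p].
  apply/fintype.subsetP => p pP; move: pP; rewrite finset.in_setU !inE => gp.
  by rewrite gp -neq_ltn; apply: contraTneq gp => /val_inj ->; rewrite gi.
move/subset_leq_card/leq_trans; apply; apply: leq_trans (leq_card_setU _ _) _.
rewrite (_ : 6 = 3 + 3) // mulnDl; apply: leq_add; [apply: h1|apply: h2];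
  move=> -[a b] [c d] ab cd /mem12/= /andP[/orP[]/eqP e1 /orP[]/eqP e2];
  by move: ab cd; rewrite /= e1 e2 ?ltnn // => ab /(ltn_trans ab); rewrite ltnn.
Qed.

Definition unlabelled_cover k n (R : {set {set 'I_n * 'I_n}}) :=
  #|R| <= 2 ^ (k * n) /\
  forall g : rel 'I_n, symmetric g -> irreflexive g -> grid_model g ->
    exists (s : {perm 'I_n}) (h : {set 'I_n * 'I_n}),
      h \in R /\ forall x y, g x y = ((s x, s y) \in h).

Section Decode.
Variables (m n : nat).
(** Pairs of labels (class, bit) that can be adjacent when the quotient is [h]. A graph is coded by
    a subset of these pairs together with the tuple of its vertex labels. *)
Definition compatible (h : {set 'I_m * 'I_m}) : {set ('I_m * bool) * ('I_m * bool)} :=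
  [set q | (q.1.1 == q.2.1) || ((q.1.1, q.2.1) \in h)].
Definition decode (q : {set ('I_m * bool) * ('I_m * bool)} * n.-tuple ('I_m * bool)) :
  {set 'I_n * 'I_n} := [set p | (tnth q.2 p.1, tnth q.2 p.2) \in q.1].

Lemma card_compatible h : #|compatible h| <= 4 * (m + #|h|).
Proof.
pose c (q : ('I_m * bool) * ('I_m * bool)) := ((q.1.1, q.2.1), (q.1.2, q.2.2)).
have cinj : injective c by move=> [[a b] [d e]] [[a' b'] [d' e']] [-> -> -> ->].
rewrite -(card_imset _ cinj).
apply: (@leq_trans #|finset.setX ([set (x, x) | x : 'I_m] :|: h) [set: bool * bool]|).
  apply/subset_leq_card/fintype.subsetP => _ /imsetP[q + ->]; rewrite inE => qh.
  rewrite finset.in_setX !inE andbT /=; case/orP: qh => [/eqP <-|->]; last by rewrite orbT.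
  by rewrite imset_f.
rewrite finset.cardsX cardsT card_prod card_bool mulnC leq_mul2l /=.
apply: leq_trans (leq_card_setU _ _) _; rewrite leq_add2r.
by apply: leq_trans (leq_imset_card _ _) _; rewrite card_ord.
Qed.
End Decode.

Lemma quotient_code n (g : rel 'I_n.+1) (rep : 'I_n.+1 -> 'I_n.+1) (beta : 'I_n.+1 -> bool)
    (m k : nat) (R : {set {set 'I_m * 'I_m}}) :
  symmetric g -> irreflexive g ->
  #|[set rep v | v : 'I_n.+1]| = m ->
  (forall u u' v v', rep u = rep u' -> beta u = beta u' -> rep v = rep v' ->
     beta v = beta v' -> g u v = g u' v') ->
  grid_model (quotient_rel g rep) ->
  unlabelled_cover k R ->
  exists (h : {set 'I_m * 'I_m}) (T : {set ('I_m * bool) * ('I_m * bool)})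
    (lab : 'I_n.+1 -> 'I_m * bool),
  [/\ h \in R, #|compatible h| <= 28 * m, T \subset compatible h &
    forall u v, g u v = ((lab u, lab v) \in T)].
Proof.
move=> gs gi cI H gq [_ Rcov]; set I := [set rep v | v : 'I_n.+1] in cI.
have I0 : rep ord0 \in I by apply: imset_f.
pose rk v : 'I_m := cast_ord cI (enum_rank_in I0 v).
pose vl x : 'I_n.+1 := enum_val (cast_ord (esym cI) x).
have rkK v : v \in I -> vl (rk v) = v.
  by move=> vI; rewrite /vl /rk cast_ordK enum_rankK_in.
have vlK x : rk (vl x) = x by rewrite /rk /vl enum_valK_in cast_ordKV.
have repI v : rep v \in I by apply: imset_f.
pose q x y := quotient_rel g rep (vl x) (vl y).
have qs : symmetric (quotient_rel g rep).
  move=> x y; rewrite /quotient_rel eq_sym; congr (_ && _).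
  apply/existsP/existsP => -[u /existsP[v /and3P[e1 e2 guv]]]; exists v;
  by apply/existsP; exists u; rewrite e1 e2 gs.
have qi : irreflexive (quotient_rel g rep) by move=> x; rewrite /quotient_rel eqxx.
have qm : grid_model q.
  apply: (grid_model_star_minor (f := fun v => if v \in I then Some (rk v) else None) gq qi).
    move=> x; exists (vl x) => u; case: ifP => // uI [<-]; left; by rewrite rkK.
  move=> x y qxy _; exists (vl x), (vl y); split=> //.
  - by rewrite enum_valP vlK.
  - by rewrite enum_valP vlK.
have [s [h [hR hq]]] : exists (s : {perm 'I_m}) (h : {set 'I_m * 'I_m}),
    h \in R /\ forall x y, q x y = ((s x, s y) \in h).
  by apply: Rcov => // [x y|x]; [apply: qs|apply: qi].
pose lab u := (s (rk (rep u)), beta u).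
exists h, [set p | [exists u, exists v, [&& lab u == p.1, lab v == p.2 & g u v]]], lab; split=> //.
(* The quotient has at most [6 * m] ordered adjacent pairs, whence [4 * (m + 6 * m) = 28 * m]. *)
- apply: leq_trans (card_compatible h) _.
  have : #|h| <= 6 * m; last by lia.
  have q1 : symmetric q by move=> x y; apply: qs.
  have q2 : irreflexive q by move=> x; apply: qi.
  apply: leq_trans (grid_model_card q1 q2 qm).
  have sinj : injective (fun p : 'I_m * 'I_m => (s p.1, s p.2)).
    by move=> [a b] [c d] [/perm_inj -> /perm_inj ->].
  rewrite -(card_imset [set p : 'I_m * 'I_m | q p.1 p.2] sinj).
  apply/subset_leq_card/fintype.subsetP => -[a b] ab; apply/imsetP.
  exists ((s^-1)%g a, (s^-1)%g b); last by rewrite /= !permKV.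
  by rewrite inE /= hq !permKV.
- apply/fintype.subsetP => -[a b]; rewrite !inE /=.
  move=> /existsP[u /existsP[v /and3P[/eqP<- /eqP<- guv]]] /=.
  have [->|ne] := eqVneq (rep u) (rep v); first by rewrite eqxx.
  rewrite -hq /q !rkK // /quotient_rel ne /= orbC; apply/orP; left.
  by apply/existsP; exists u; apply/existsP; exists v; rewrite !eqxx.
- move=> u v; rewrite inE; apply/idP/existsP => /= [guv|[u' /existsP[v' /and3P[]]]].
    by exists u; apply/existsP; exists v; rewrite !eqxx.
  have rkE x y : s (rk (rep x)) = s (rk (rep y)) -> rep x = rep y.
    by move=> /perm_inj e; rewrite -(rkK _ (repI x)) e rkK.
  move=> /eqP[/rkE e1 b1] /eqP[/rkE e2 b2] g'.
  by rewrite (H _ _ _ _ (esym e1) (esym b1) (esym e2) (esym b2)).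
Qed.

Lemma card_bigcup_leq (I T : finType) (P : pred I) (F : I -> {set T}) :
  #|\bigcup_(i | P i) F i| <= \sum_(i | P i) #|F i|.
Proof.
elim/big_rec2: _ => [|i k A _ H]; first by rewrite cards0.
by apply: leq_trans (leq_card_setU _ _) _; rewrite leq_add2l.
Qed.

(** A graph is coded by its quotient on [m <= 29n / 30] vertices, a subset of at most [28m]
    compatible pairs, and a multiset of [n] labels out of [2m]. The exponents add up to
    [960m + 28m + (n + 2m) <= 958n], and the choice of [m] costs at most a further [2 ^ n]. An
    exponent [k] works as soon as [(k + 30) * 29 / 30 + 2 <= k], that is from 930 on. *)
Lemma unlabelled_bound n : exists R : {set {set 'I_n * 'I_n}}, unlabelled_cover 960 R.
Proof.
have [N] := ubnP n; elim: N n => // N IH [|[|n]] nN.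
- exists [set: {set 'I_0 * 'I_0}]; split=> [|g _ _ _].
    by rewrite -powersetT card_powerset cardsT card_prod card_ord.
  by exists 1%g, finset.set0; split; [rewrite inE|case].
- exists [set: {set 'I_1 * 'I_1}]; split=> [|g _ _ _].
    by rewrite -powersetT card_powerset cardsT card_prod card_ord leq_exp2l.
  exists 1%g, [set p | g p.1 p.2]; split; first by rewrite inE.
  by move=> x y; rewrite !perm1 inE.
pose n2 := n.+2.
have Rm (m : 'I_n2) : {R : {set {set 'I_m * 'I_m}} | unlabelled_cover 960 R}.
  by apply: cid; apply: IH; apply: leq_trans (ltn_ord m) _.
have Om (m : 'I_n2) : {O : {set n2.-tuple ('I_m * bool)} | #|O| <= 2 ^ (n2 + #|{: 'I_m * bool}|) /\
    forall t : n2.-tuple ('I_m * bool), exists2 t', t' \in O & perm_eq t t'}.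
  by apply: cid; apply: tuple_representatives.
pose codes (m : 'I_n2) (h : {set 'I_m * 'I_m}) :=
  [set decode q | q in finset.setX (powerset (compatible h)) (sval (Om m))].
exists (\bigcup_(m : 'I_n2 | 30 * m + n2 <= 30 * n2)
  \bigcup_(h in sval (Rm m) | #|compatible h| <= 28 * m) codes m h).
split.
  apply: leq_trans (card_bigcup_leq _ _) _.
  apply: (@leq_trans (\sum_(m < n2) 2 ^ (959 * n2))).
    apply: (@leq_trans (\sum_(m < n2 | 30 * m + n2 <= 30 * n2) 2 ^ (959 * n2))); last first.
      by rewrite [leqLHS]big_mkcond; apply: leq_sum => m _; case: ifP.
    apply: leq_sum => m mn; apply: leq_trans (card_bigcup_leq _ _) _.
    apply: (@leq_trans (\sum_(h in sval (Rm m)) 2 ^ (28 * m + (n2 + 2 * m)))).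
      rewrite big_mkcondr; apply: leq_sum => h _; case: ifP => // ch.
      apply: leq_trans (leq_imset_card _ _) _; rewrite finset.cardsX card_powerset [leqRHS]expnD.
      apply: leq_mul; first by rewrite leq_exp2l.
      apply: leq_trans (proj1 (proj2_sig (Om m))) _.
      by rewrite card_prod card_ord card_bool [2 * m]mulnC.
    rewrite sum_nat_const; have [cR _] := proj2_sig (Rm m).
    apply: leq_trans (leq_mul cR (leqnn _)) _.
    by rewrite -expnD leq_exp2l //; lia.
  rewrite sum_nat_const card_ord; apply: leq_trans (leq_mul (ltnW (ltn_expl n2 (ltnSn 1))) (leqnn _)) _.
  by rewrite -expnD leq_exp2l //; lia.
move=> g gs gi gm.
have [|rep [beta [c H q]]] := sparse_quotient gs gi gm; first by rewrite card_ord.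
rewrite card_ord in c.
set m0 := #|[set rep v | v : 'I_n2]| in c.
have mn : m0 < n2 by rewrite /n2 in c *; lia.
pose m := Ordinal mn.
have [h [T [lab [hR ch Th gT]]]] := @quotient_code _ g rep beta m _ _ gs gi erefl H q (proj2_sig (Rm m)).
have [_ OP] := proj2_sig (Om m).
(* The permutation that brings the tuple of labels to its representative is the isomorphism from [g]
   to the decoded graph. *)
have [t tO /tuple_permP[p tp]] := OP [tuple lab u | u < n2].
exists p, (decode (T, t)); split.
  apply/bigcupP; exists m => //; apply/bigcupP; exists h; first by rewrite hR.
  by apply: imset_f; rewrite finset.in_setX powersetE Th.
move=> x y; rewrite inE /= gT.
have lp u : lab u = tnth t (p u).
  have := congr1 (fun s => nth (lab u) s u) tp.
  by rewrite -!tnth_nth !tnth_mktuple.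
by rewrite !lp.
Qed.

Lemma labelled_bound n (T : finType) (S : {set T}) (G : T -> rel 'I_n) :
  (forall x, x \in S -> [/\ symmetric (G x), irreflexive (G x) & grid_model (G x)]) ->
  (forall x y, x \in S -> y \in S -> G x =2 G y -> x = y) ->
  #|S| <= n`! * 2 ^ (960 * n).
Proof.
move=> SG Ginj; have [R [cR Rcov]] := unlabelled_bound n.
have /choice[f fP] : forall x, exists sh : {perm 'I_n} * {set 'I_n * 'I_n}, x \in S ->
    sh.2 \in R /\ forall u v, G x u v = ((sh.1 u, sh.1 v) \in sh.2).
  move=> x; case: (boolP (x \in S)) => [/SG[gs gi gm]|]; last by exists (1%g, finset.set0).
  by have [s [h H]] := Rcov _ gs gi gm; exists (s, h).
rewrite -(card_in_imset (f := f)); last first.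
  move=> x y xS yS e; apply: Ginj => // u v.
  by have [_ ->] := fP _ xS; have [_ ->] := fP _ yS; rewrite e.
have -> : n`! * 2 ^ (960 * n) = #|[set: {perm 'I_n}]| * 2 ^ (960 * n).
  by rewrite cardsT card_Sn.
apply: (@leq_trans #|finset.setX [set: {perm 'I_n}] R|); last first.
  by rewrite finset.cardsX leq_mul2l cR orbT.
apply/subset_leq_card/fintype.subsetP => _ /imsetP[x /fP[fR _] ->].
by case: (f x) fR => s h hR; rewrite finset.in_setX inE.
Qed.

(** * Discretization of planar drawings *)

Section UnitIntervalContinuity.
Local Open Scope classical_set_scope.
Local Open Scope ring_scope.
Variable R : realType.

Definition dist_lt (p q : R * R) (eps : R) := `|p.1 - q.1| < eps /\ `|p.2 - q.2| < eps.

Lemma within_unitP (f : R -> R * R) : {within `[0, 1], continuous f} <->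
  forall s, 0 <= s <= 1 -> forall eps, 0 < eps -> exists2 eta, 0 < eta &
    forall t, 0 <= t <= 1 -> `|s - t| < eta -> dist_lt (f s) (f t) eps.
Proof.
split.
  move=> /subspace_continuousP cf s s01 eps e0.
  have /cf/cvgrPdist_lt/(_ _ e0) : `[0, 1]%classic s by rewrite /= in_itv.
  rewrite near_withinE near_nbhs => /nbhs_ballP[eta e1 H]; exists eta => // t t01 st.
  have := H t st; rewrite /= in_itv => /(_ t01).
  by rewrite prod_normE /= gt_max => /andP[].
move=> H; apply/subspace_continuousP => s; rewrite /= in_itv => s01.
apply/cvgrPdist_lt => eps e0; rewrite near_withinE near_nbhs.
have [eta e1 {}H] := H _ s01 _ e0; apply/nbhs_ballP; exists eta => // t st /=.
rewrite in_itv => t01; have [h1 h2] := H t t01 st.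
by rewrite prod_normE /= gt_max h1.
Qed.

(** Compactness of the unit interval in the one form used below, both for uniform continuity and for
    positive distances: a threshold that exists near each point exists globally. *)
Lemma unit_compact (P : nat -> R -> Prop) :
  (forall s, 0 <= s <= 1 -> exists2 eta, 0 < eta & exists N, forall n t, (N <= n)%N ->
     0 <= t <= 1 -> `|s - t| < eta -> P n t) ->
  exists N, forall n t, (N <= n)%N -> 0 <= t <= 1 -> P n t.
Proof.
move=> H; have /compact_near_coveringP cov := @segment_compact R 0 1.
have [|N _ HN] := cov nat \oo (fun n t => 0 <= t <= 1 -> P n t).
  move=> s; rewrite /= in_itv => /H[eta e0 [N HN]].
  exists (ball s eta, [set n | (N <= n)%N]) => /=.
    by split; [apply: nbhsx_ballx|exists N].
  by move=> [t n] /= [st Nn] t01; apply: HN.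
by exists N => n t Nn t01; apply: (HN n Nn t) => //; rewrite /= in_itv.
Qed.

Lemma unit_uniformly_continuous (f : R -> R * R) eps : {within `[0, 1], continuous f} ->
  0 < eps -> exists N, forall n s t, (N <= n)%N -> 0 <= s <= 1 -> 0 <= t <= 1 ->
    `|s - t| <= n.+1%:R^-1 -> dist_lt (f s) (f t) eps.
Proof.
move=> /within_unitP cf e0.
have [|N HN] := @unit_compact (fun n s => forall t, 0 <= t <= 1 ->
    `|s - t| <= n.+1%:R^-1 -> dist_lt (f s) (f t) eps).
  move=> s s01; have e20 : 0 < eps / 2 by rewrite divr_gt0.
  have [eta eta0 H] := cf s s01 _ e20; exists (eta / 2); first by rewrite divr_gt0.
  exists (Num.truncn (2 / eta)) => n t Nn t01 st t' t'01 tt'.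
  have n1 : n.+1%:R^-1 < eta / 2.
    rewrite invf_plt ?posrE ?ltr0Sn ?divr_gt0 // invf_div.
    apply: lt_le_trans (truncnS_gt _) _; by rewrite ler_nat ltnS.
  have [a1 a2] : dist_lt (f s) (f t) (eps / 2) by apply: H => //; lra.
  have [b1 b2] : dist_lt (f s) (f t') (eps / 2).
    apply: H => //; rewrite (_ : s - t' = (s - t) + (t - t')); last by lra.
    by apply: le_lt_trans (ler_normD _ _) _; rewrite [ltRHS]splitr ltrD // (le_lt_trans tt').
  split.
    rewrite (_ : (f t).1 - (f t').1 = ((f s).1 - (f t').1) - ((f s).1 - (f t).1)); last by lra.
    by apply: le_lt_trans (ler_normB _ _) _; lra.
  rewrite (_ : (f t).2 - (f t').2 = ((f s).2 - (f t').2) - ((f s).2 - (f t).2)); last by lra.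
  by apply: le_lt_trans (ler_normB _ _) _; lra.
by exists N => n s t Nn s01 t01; apply: HN.
Qed.

Definition dist_far (p q : R * R) (d : R) := d <= `|p.1 - q.1| \/ d <= `|p.2 - q.2|.

Lemma dist_far_le p q d d' : d' <= d -> dist_far p q d -> dist_far p q d'.
Proof. by move=> dd' [h|h]; [left|right]; apply: le_trans dd' h. Qed.

Lemma compact_far (f : R -> R * R) (a b : R) p : 0 <= a -> b <= 1 -> {within `[0, 1], continuous f} ->
  (forall t, a <= t <= b -> f t <> p) ->
  exists N, forall t, a <= t <= b -> dist_far (f t) p N.+1%:R^-1.
Proof.
move=> a0 b1 /within_unitP cf fp.
have [|N HN] := @unit_compact (fun n t => a <= t <= b -> dist_far (f t) p n.+1%:R^-1).
  move=> s s01; have [sab|nsab] := boolP (a <= s <= b).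
    pose m := Num.max `|(f s).1 - p.1| `|(f s).2 - p.2|.
    have m0 : 0 < m.
      rewrite lt_max !normr_gt0 !subr_eq0 -negb_and; apply/negP => /andP[/eqP e1 /eqP e2].
      by apply: (fp s sab); rewrite [LHS]surjective_pairing e1 e2 -surjective_pairing.
    have m20 : 0 < m / 2 by rewrite divr_gt0.
    have [eta eta0 H] := cf s s01 _ m20; exists eta => //.
    exists (Num.truncn (2 / m)) => n t Nn t01 st _; have [h1 h2] := H t t01 st.
    have n1 : n.+1%:R^-1 < m / 2.
      rewrite invf_plt ?posrE ?ltr0Sn ?divr_gt0 // invf_div.
      apply: lt_le_trans (truncnS_gt _) _; by rewrite ler_nat ltnS.
    have tri (x y z : R) : `|x - z| <= `|x - y| + `|y - z| by apply: ler_distD.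
    have t1 := tri (f s).1 (f t).1 p.1; have t2 := tri (f s).2 (f t).2 p.2.
    have [e|e] : m = `|(f s).1 - p.1| \/ m = `|(f s).2 - p.2|.
      by rewrite /m maxEle; case: ifP; [right|left].
    - by left; move: (n.+1%:R^-1) n1 h1 t1; rewrite e => *; lra.
    - by right; move: (n.+1%:R^-1) n1 h2 t2; rewrite e => *; lra.
  have [sa|sb] : s < a \/ b < s by move: nsab; rewrite negb_and -!ltNge => /orP.
    exists (a - s); first by lra.
    by exists 0%N => n t _ _; rewrite ltr_norml => ? ?; lra.
  exists (s - b); first by lra.
  by exists 0%N => n t _ _; rewrite ltr_norml => ? ?; lra.
exists N => t tab; apply: HN => //; lra.
Qed.

Lemma arcs_far (f g : R -> R * R) (a b c d : R) : 0 <= a -> b <= 1 -> 0 <= c -> d <= 1 ->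
  {within `[0, 1], continuous f} -> {within `[0, 1], continuous g} ->
  (forall s t, a <= s <= b -> c <= t <= d -> f s <> g t) ->
  exists N, forall n s t, (N <= n)%N -> a <= s <= b -> c <= t <= d ->
    dist_far (f s) (g t) n.+1%:R^-1.
Proof.
move=> a0 b1 c0 d1 cf cg fg; have /within_unitP cf' := cf.
have [|N HN] := @unit_compact (fun n s => a <= s <= b -> forall t, c <= t <= d ->
    dist_far (f s) (g t) n.+1%:R^-1).
  move=> s s01; have [sab|nsab] := boolP (a <= s <= b).
    have [|N HN] := @compact_far g c d (f s) c0 d1 cg.
      by move=> t tcd e; apply: (fg s t).
    have N0 : 0 < (N.+1%:R^-1 / 2 : R) by rewrite divr_gt0 // invr_gt0 ltr0Sn.
    have [eta eta0 H] := cf' s s01 _ N0; exists eta => //.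
    exists (2 * N.+1)%N => n s' Nn s'01 ss' _ t tcd; have [h1 h2] := H s' s'01 ss'.
    have n1 : n.+1%:R^-1 < (N.+1%:R^-1 / 2 : R).
      rewrite -invfM ltf_pV2 ?posrE ?mulr_gt0 ?ltr0Sn //.
      by rewrite -natrM ltr_nat ltnS mulnC.
    have tri (x y z : R) : `|x - z| <= `|z - y| + `|y - x| by rewrite distrC; apply: ler_distD.
    have t1 := tri (g t).1 (f s').1 (f s).1; have t2 := tri (g t).2 (f s').2 (f s).2.
    move: (n.+1%:R^-1) (N.+1%:R^-1) n1 h1 h2 t1 t2 (HN t tcd) => q Q n1 h1 h2 t1 t2 [h|h]; [left|right]; lra.
  have [sa|sb] : s < a \/ b < s by move: nsab; rewrite negb_and -!ltNge => /orP.
    exists (a - s); first by lra.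
    by exists 0%N => n t _ _; rewrite ltr_norml => ? ?; lra.
  exists (s - b); first by lra.
  by exists 0%N => n t _ _; rewrite ltr_norml => ? ?; lra.
exists N => n s t Nn sab tcd; apply: HN => //; lra.
Qed.
End UnitIntervalContinuity.

(** * From cell paths to a grid labelling *)

Section CellPaths.
Variables (V : finType) (E : {set {set V}}) (src tgt : {set V} -> V) (L : nat).
Variables (cell : {set V} -> nat -> nat * nat) (hub : V -> nat * nat).

(* The initial and final thirds of the cell paths belong to the stars of the
   two ends of the edge, the middle third belongs to the edge. *)
Definition star v p := exists e a, [/\ e \in E, cell e a = p &
  (v = src e /\ a <= 2 * L) \/ (v = tgt e /\ 4 * L <= a <= 6 * L)].
Definition middle e p := exists a, cell e a = p /\ 2 * L <= a <= 4 * L.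

Hypotheses (endsP : forall e, e \in E -> e = [set src e; tgt e] /\ src e != tgt e)
  (cell0 : forall e, e \in E -> cell e 0 = hub (src e))
  (cell1 : forall e, e \in E -> cell e (6 * L) = hub (tgt e))
  (cell_step : forall e a, e \in E -> a < 6 * L ->
     cell e a = cell e a.+1 \/ cell_adj (cell e a) (cell e a.+1))
  (cell_gt0 : forall e a, 0 < (cell e a).1 /\ 0 < (cell e a).2)
  (star_disj : forall u v p, star u p -> star v p -> u = v)
  (middle_disj : forall e f p, e \in E -> f \in E -> middle e p -> middle f p -> e = f)
  (star_middle : forall v e p, e \in E -> star v p -> middle e p -> v \in e).

(** Along the middle third take the last cell in the star of the source, then the first later cell
    in the star of the target. Only the stars of these two ends can meet the middle third, so the
    cells strictly between are in no star. *)
Lemma middle_split e : e \in E -> exists a0 a1, [/\ 2 * L <= a0 < a1, a1 <= 4 * L,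
  star (src e) (cell e a0), star (tgt e) (cell e a1) &
  forall a, a0 < a < a1 -> forall v, ~ star v (cell e a)].
Proof.
move=> eE; have [ee /eqP st] := endsP eE.
pose P a := (2 * L <= a <= 4 * L) && `[< star (src e) (cell e a) >].
have exP : exists a, P a.
  exists (2 * L); rewrite /P leqnn leq_mul2r orbT /=; apply/asboolP.
  by exists e, (2 * L); split=> //; left.
have bP a : P a -> a <= 4 * L by case/andP=> /andP[].
case: (ex_maxnP exP bP) => a0 /andP[/andP[a0l a0u] /asboolP s0] a0max.
have s1 : star (tgt e) (cell e (4 * L)).
  by exists e, (4 * L); split=> //; right; split=> //; rewrite leqnn leq_mul2r orbT.
have a04 : a0 < 4 * L.
  rewrite ltn_neqAle a0u andbT; apply/eqP => ea.
  by apply: st; apply: star_disj s0 _; rewrite ea.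
pose Q a := (a0 < a) && `[< star (tgt e) (cell e a) >].
have exQ : exists a, Q a by exists (4 * L); rewrite /Q a04; apply/asboolP.
case: (ex_minnP exQ) => a1 /andP[a01 /asboolP s1'] a1min.
have a14 : a1 <= 4 * L by apply: a1min; rewrite /Q a04; apply/asboolP.
exists a0, a1; split=> //; first by rewrite a0l.
move=> a /andP[aa0 aa1] v sv.
have : v \in e.
  apply: (star_middle eE sv); exists a; split=> //.
  by rewrite (leq_trans a0l (ltnW aa0)) (leq_trans (ltnW aa1) a14).
rewrite ee !inE => /orP[]/eqP ev; rewrite ev in sv.
  have : P a; last by move/a0max; rewrite leqNgt aa0.
  apply/andP; split; last exact/asboolP.
  by rewrite (leq_trans a0l (ltnW aa0)) (leq_trans (ltnW aa1) a14).
have : Q a; last by move/a1min; rewrite leqNgt aa1.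
by rewrite /Q aa0; apply/asboolP.
Qed.

Lemma cell_paths_grid_model : grid_model (fun u v => [set u; v] \in E).
Proof.
have /choice[aa aaP] : forall e, exists c : nat * nat, e \in E ->
  [/\ 2 * L <= c.1 < c.2, c.2 <= 4 * L, star (src e) (cell e c.1), star (tgt e) (cell e c.2) &
  forall a, c.1 < a < c.2 -> forall v, ~ star v (cell e a)].
  move=> e; case: (boolP (e \in E)) => [/middle_split[a0 [a1 H]]|]; last by exists (0, 0).
  by exists (a0, a1).
pose interior e p := exists a, cell e a = p /\ (aa e).1 < a < (aa e).2.
(* Stars take precedence and free middle cells go to the source, so the contact of an edge occurs
   where its path enters the star of the target. *)
pose l i j := if [pick v | `[< star v (i, j) >]] is Some v then Some v
  else if [pick e | (e \in E) && `[< interior e (i, j) >]] is Some e then Some (src e) else None.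
have lstar v p : star v p -> l p.1 p.2 = Some v.
  rewrite /l -surjective_pairing => sv; case: pickP => [w /asboolP sw|/(_ v)/asboolP//].
  by rewrite (star_disj sw sv).
have intmid e p : e \in E -> interior e p -> middle e p.
  move=> eE [a [<- /andP[h1 h2]]]; have [/andP[h3 _] h4 _ _ _] := aaP _ eE.
  by exists a; split=> //; rewrite (leq_trans h3 (ltnW h1)) (leq_trans (ltnW h2) h4).
have lint e p : e \in E -> interior e p -> l p.1 p.2 = Some (src e).
  move=> eE ie; rewrite /l -surjective_pairing; case: pickP => [w /asboolP sw|_].
    case: ie sw => a [<- h]; have [_ _ _ _ H] := aaP _ eE.
    by move/H: h => H' /H'.
  case: pickP => [f /andP[fE /asboolP fi]|/(_ e)]; last by rewrite eE => /asboolP.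
  by rewrite (middle_disj fE eE (intmid _ _ fE fi) (intmid _ _ eE ie)).
have lP p v : l p.1 p.2 = Some v -> star v p \/ exists e, [/\ e \in E, src e = v & interior e p].
  rewrite /l -surjective_pairing; case: pickP => [w /asboolP sw [<-]|_]; first by left.
  by case: pickP => // e /andP[eE /asboolP ie] [<-]; right; exists e.
pose M := (\max_(e in E) \max_(a < (6 * L).+1) maxn (cell e a).1 (cell e a).2).+1.
have cellM e a : e \in E -> a <= 6 * L -> (0 < (cell e a).1 < M) /\ (0 < (cell e a).2 < M).
  move=> eE aL; have [-> ->] := cell_gt0 e a; rewrite !ltnS.
  have aL' : a < (6 * L).+1 by [].
  suff : maxn (cell e a).1 (cell e a).2 <= \max_(e in E) \max_(a < (6 * L).+1) maxn (cell e a).1 (cell e a).2.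
    by rewrite geq_max => /andP.
  apply: leq_trans (leq_bigmax_cond _ eE).
  exact: (leq_bigmax_cond (F := fun a : 'I_(6 * L).+1 => maxn (cell e a).1 (cell e a).2) (Ordinal aL')).
have cellP p v : l p.1 p.2 = Some v -> exists e a, [/\ e \in E, a <= 6 * L & cell e a = p].
  move/lP=> [[e [a [eE ca H]]]|[e [eE _ [a [ca /andP[_ h]]]]]]; exists e, a; split=> //.
    by case: H => [[_ h]|[_ /andP[_ //]]]; apply: leq_trans h _; rewrite leq_mul2r orbT.
  by have [_ h4 _ _ _] := aaP _ eE; lia.
exists M, l; split.
- move=> i j; case E1: (l i j) => [v|//] _.
  by have [e [a [eE aL e1]]] := cellP (i, j) v E1; have := cellM e a eE aL; rewrite e1.
- pose Rl := fun a b : nat * nat => cell_adj a b && (l a.1 a.2 == l b.1 b.2).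
  have Rs : symmetric Rl by move=> a b; rewrite /Rl cell_adj_sym eq_sym.
  have seg e a b v : e \in E -> a <= b -> b <= 6 * L ->
      (forall c, a <= c <= b -> l (cell e c).1 (cell e c).2 = Some v) ->
      clos_refl_trans _ (fun a b => Rl a b) (cell e a) (cell e b).
    move=> eE; elim: b => [|b IH]; first by rewrite leqn0 => /eqP-> _ _; apply: rt_refl.
    rewrite leq_eqVlt => /orP[/eqP->|ab bL H]; first by move=> _ _; apply: rt_refl.
    apply: (rt_trans _ _ _ (cell e b)).
      apply: IH => //; first exact: ltnW.
      by move=> c /andP[h1 h2]; apply: H; rewrite h1 leqW.
    have [->|adj] := cell_step eE bL; first exact: rt_refl.
    apply: rt_step; rewrite /Rl adj (H b); last by rewrite leqnSn andbT.
    by rewrite (H b.+1) ?eqxx // leqnn (ltnW ab).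
  have star_hub v p : star v p -> clos_refl_trans _ (fun a b => Rl a b) p (hub v).
    case=> e [a [eE <- [[-> aL]|[-> /andP[La aL]]]]].
      rewrite -cell0 //; apply: clos_rt_sym => //; apply: (seg e 0 a (src e)) => //; first by lia.
      by move=> c /andP[_ ca]; apply: lstar; exists e, c; split=> //; left; split=> //; lia.
    rewrite -cell1 //; apply: (seg e a (6 * L) (tgt e)) => //.
    by move=> c /andP[h1 h2]; apply: lstar; exists e, c; split=> //; right; split=> //; lia.
  have lab_hub v p : l p.1 p.2 = Some v -> clos_refl_trans _ (fun a b => Rl a b) p (hub v).
    move/lP=> [/star_hub//|[e [eE <- [a [<- /andP[h1 h2]]]]]].
    have [h3 h4 s0 _ _] := aaP _ eE.
    apply: (rt_trans _ _ _ (cell e (aa e).1)); last exact: star_hub.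
    apply: clos_rt_sym => //; apply: (seg e _ a (src e)) => //; [exact: ltnW|lia|].
    move=> c /andP[c1 c2]; move: c1; rewrite leq_eqVlt => /orP[/eqP <-|c1].
      exact: lstar.
    by apply: lint => //; exists c; split=> //; rewrite c1 (leq_ltn_trans c2).
  move=> p q lp lpq; rewrite -/(clos_refl_trans _ (fun a b => Rl a b) p q).
  case Ep: (l p.1 p.2) lp lpq => [v|//] _ /esym Eq.
  apply: (rt_trans _ _ _ (hub v)); first exact: lab_hub.
  by apply: clos_rt_sym => //; apply: lab_hub.
- have contact e : e \in E -> exists p q,
      [/\ cell_adj p q, l p.1 p.2 = Some (src e) & l q.1 q.2 = Some (tgt e)].
    move=> eE; have [/andP[h3 h1] h4 s0 s1 _] := aaP _ eE; have [_ /eqP st] := endsP eE.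
    have e1 : (aa e).2 = (aa e).2.-1.+1 by lia.
    have lp : l (cell e (aa e).2.-1).1 (cell e (aa e).2.-1).2 = Some (src e).
      have [e0|ne] := eqVneq (aa e).2.-1 (aa e).1; first by rewrite e0; apply: lstar.
      by apply: lint => //; exists (aa e).2.-1; split=> //; lia.
    exists (cell e (aa e).2.-1), (cell e (aa e).2); split=> //; last exact: lstar.
    have [|eq|] := @cell_step e (aa e).2.-1 eE; rewrite -?e1 //; first by lia.
    by case: st; move: lp; rewrite eq -e1 (lstar _ _ s1) => -[].
  move=> u v uvE uv; have [ee st] := endsP uvE.
  have [p [q [pq lp lq]]] := contact _ uvE.
  have : u \in [set src [set u; v]; tgt [set u; v]] by rewrite -ee !inE eqxx.
  have : v \in [set src [set u; v]; tgt [set u; v]] by rewrite -ee !inE eqxx orbT.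
  rewrite !inE => /orP[]/eqP ev /orP[]/eqP eu.
  + by case/eqP: uv; apply: etrans eu (esym ev).
  + by exists q, p; rewrite cell_adj_sym; split=> //; [rewrite lq -eu|rewrite lp -ev].
  + by exists p, q; split=> //; [rewrite lp -eu|rewrite lq -ev].
  + by case/eqP: uv; apply: etrans eu (esym ev).
Qed.
End CellPaths.

Lemma half_le_three a L : a <= 6 * L -> a./2 <= 3 * L /\ uphalf a <= 3 * L.
Proof. lia. Qed.

Lemma half_lt_three a L : a < 6 * L -> a./2 < 3 * L.
Proof. lia. Qed.

Lemma odd_half_lt_three a L : odd a -> a <= 6 * L -> a./2 < 3 * L.
Proof. lia. Qed.

Lemma half_third a L i : 2 * L * i <= a <= 2 * L * i.+1 -> i * L <= a./2 <= i.+1 * L.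
Proof.
move=> /andP[h1 h2]; apply/andP; split.
  by rewrite -(doubleK (i * L)) half_leq // -mul2n [i * L]mulnC mulnA.
by rewrite -(doubleK (i.+1 * L)) half_leq // -mul2n [i.+1 * L]mulnC mulnA.
Qed.

(** * Sampling a drawing on a fine mesh *)

Section Discretization.
Local Open Scope ring_scope.

Lemma finite_uniform (I : finType) (P : I -> nat -> Prop) :
  (forall x, exists N, forall n, (N <= n)%N -> P x n) -> exists N, forall x, P x N.
Proof.
move=> /choice[f fP]; exists (\max_x f x)%N => x; apply: fP.
exact: (leq_bigmax_cond (F := f)).
Qed.

Variable R : realType.

Section Cells.
Variables (B d : R).
Hypothesis d0 : 0 < d.
(** Index of the mesh interval of width [d] containing [x], counted from [- B]. The successor keeps
    every cell off row and column 0. *)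
Definition cell_coord (x : R) : nat := (Num.truncn ((x + B) / d)).+1.

Lemma cell_coord_bounds x : - B <= x ->
  (cell_coord x).-1%:R * d <= x + B < (cell_coord x)%:R * d.
Proof.
move=> Bx; have x0 : 0 <= (x + B) / d by apply: divr_ge0; [rewrite -[B]opprK subr_ge0|exact: ltW].
by rewrite -ler_pdivlMr // -ltr_pdivrMr // [_.-1]/= truncn_itv.
Qed.

Lemma cell_coord_close x y : - B <= x -> - B <= y -> `|x - y| < d ->
  (cell_coord x <= (cell_coord y).+1)%N.
Proof.
move=> Bx By xy; have /andP[h1 _] := cell_coord_bounds Bx; have /andP[_ h2] := cell_coord_bounds By.
rewrite leqNgt; apply/negP => lt.
have : (cell_coord y).+1%:R * d <= (cell_coord x).-1%:R * d.
  by rewrite ler_pM2r // ler_nat -ltnS prednK.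
move: xy; rewrite ltr_norml -natr1 mulrDl mul1r => /andP[? ?] ?; lra.
Qed.

Lemma coord_close_cell x y k : - B <= x -> - B <= y -> (cell_coord x <= cell_coord y + k)%N ->
  x - y < k.+1%:R * d.
Proof.
move=> Bx By xy; have /andP[_ h1] := cell_coord_bounds Bx; have /andP[h2 _] := cell_coord_bounds By.
have : (cell_coord x)%:R * d <= (cell_coord y).-1%:R * d + k.+1%:R * d.
  by rewrite -mulrDl -natrD ler_pM2r // ler_nat addnS -addSn prednK.
lra.
Qed.
End Cells.

Lemma dist_three_quarters (x y d : R) : 0 < d -> x - y < 3%:R * (d / 4) ->
  y - x < 3%:R * (d / 4) -> `|x - y| < d.
Proof. by move=> *; rewrite ltr_norml; lra. Qed.

Variables (V : finType) (E : {set {set V}}) (pos : V -> R * R) (gamma : {set V} -> R -> R * R).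
Hypotheses (Es : simple_graph E) (D : plane_drawing E pos gamma).

Lemma simple_ends u v : [set u; v]%SET \in E -> u != v.
Proof. by move=> /(forall_inP Es); rewrite cards2; case: (u != v). Qed.

Variables (src tgt : {set V} -> V).
Hypothesis endsP : forall e, e \in E ->
  [/\ e = [set src e; tgt e]%SET, src e != tgt e,
     gamma e 0 = pos (src e) & gamma e 1 = pos (tgt e)].

Definition third_end (i : 'I_3) e : option V :=
  if i == 0%N :> nat then Some (src e) else if i == 1%N :> nat then None else Some (tgt e).

(** Pairs of thirds that a drawing keeps disjoint, hence at positive distance by compactness. Left
    out are consecutive thirds of one edge, which share a point, and outer thirds of two edges at a
    common end. The outer thirds of one edge are listed in one order only. *)
Definition apart (x y : {set V} * 'I_3) :=
  (x.1 \in E) && (y.1 \in E) && (if x.1 == y.1 then (x.2 == 0%N :> nat) && (y.2 == 2%N :> nat)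
     else (third_end x.2 x.1 == None) || (third_end x.2 x.1 != third_end y.2 y.1)).

Lemma third_cases (i : 'I_3) e (s : R) : e \in E -> i%:R / 3 <= s <= i.+1%:R / 3 ->
  (0 <= s <= 1) /\
  ((s \in `]0, 1[) \/ (exists2 x : V, third_end i e = Some x & gamma e s = pos x)).
Proof.
move=> eE is_; have [_ _ g0 g1] := endsP eE.
have s01 : 0 <= s <= 1.
  by case: i is_ => -[|[|[|//]]] lti /=; lra.
split=> //; have [e0|n0] := eqVneq s 0.
  right; exists (src e); last by rewrite e0.
  by move: is_; rewrite e0; case: i => -[|[|[|//]]] lti //= h; exfalso; clear g0 g1; lra.
have [e1|n1] := eqVneq s 1.
  right; exists (tgt e); last by rewrite e1.
  by move: is_; rewrite e1; case: i => -[|[|[|//]]] lti //= h; exfalso; clear g0 g1; lra.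
by left; rewrite in_itv /= !lt_neqAle eq_sym n0 n1 /=; lra.
Qed.

Lemma apart_disjoint x y s t : apart x y ->
  x.2%:R / 3 <= s <= x.2.+1%:R / 3 -> y.2%:R / 3 <= t <= y.2.+1%:R / 3 ->
  gamma x.1 s <> gamma y.1 t.
Proof.
case: x y => [e i] [f j] /andP[/andP[/= eE fE] H] si tj st.
have [pinj De Dv Df] := D; have [_ ginj _] := De e eE.
have [s01 s_] := third_cases eE si; have [t01 t_] := third_cases fE tj.
case: eqVneq H => [ef /andP[/eqP i0 /eqP j2]|ef H].
  subst f; have st' : s = t by apply: ginj => //; rewrite in_itv.
  by move: si tj; rewrite i0 j2 st'; lra.
case: s_ => [s_|[x ex gx]].
  case: t_ => [t_|[y ey gy]]; first by apply: (Df e f s t).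
  by apply: (Dv e s y) => //; rewrite st.
case: t_ => [t_|[y ey gy]]; first by apply: (Dv f t x) => //; rewrite -st.
by move: H; rewrite ex ey /= (_ : x = y) ?eqxx //; apply: pinj; rewrite -gx st.
Qed.

Lemma apart_far : exists N, forall x y, apart x y -> forall s t,
  x.2%:R / 3 <= s <= x.2.+1%:R / 3 -> y.2%:R / 3 <= t <= y.2.+1%:R / 3 ->
  dist_far (gamma x.1 s) (gamma y.1 t) N.+1%:R^-1.
Proof.
have [_ De _ _] := D.
have [|N HN] := @finite_uniform (({set V} * 'I_3) * ({set V} * 'I_3))%type
  (fun xy n => apart xy.1 xy.2 -> forall s t,
    xy.1.2%:R / 3 <= s <= xy.1.2.+1%:R / 3 -> xy.2.2%:R / 3 <= t <= xy.2.2.+1%:R / 3 ->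
    dist_far (gamma xy.1.1 s) (gamma xy.2.1 t) n.+1%:R^-1); last first.
  by exists N => x y; apply: (HN (x, y)).
move=> [x y] /=; case: (boolP (apart x y)) => [a|]; last by exists 0%N.
have /andP[/andP[xE yE] _] := a.
have b3 (i : 'I_3) : 0 <= (i%:R / 3 : R) /\ (i.+1%:R / 3 : R) <= 1.
  by case: i => -[|[|[|//]]] lti /=; lra.
have [a0 a1] := b3 x.2; have [b0 b1] := b3 y.2.
have [cx _ _] := De _ xE; have [cy _ _] := De _ yE.
have [N HN] := arcs_far a0 a1 b0 b1 cx cy (fun s t => apart_disjoint a (s:=s) (t:=t)).
by exists N => n Nn _ s t; apply: HN.
Qed.

Lemma edges_uniform eps : 0 < eps -> exists N, forall e, e \in E -> forall s t,
  0 <= s <= 1 -> 0 <= t <= 1 -> `|s - t| <= N.+1%:R^-1 -> dist_lt (gamma e s) (gamma e t) eps.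
Proof.
move=> e0; have [_ De _ _] := D.
apply: (@finite_uniform _ (fun e n => e \in E -> forall s t,
  0 <= s <= 1 -> 0 <= t <= 1 -> `|s - t| <= n.+1%:R^-1 -> dist_lt (gamma e s) (gamma e t) eps)) => e.
case: (boolP (e \in E)) => [eE|]; last by exists 0%N.
have [ce _ _] := De _ eE; have [N HN] := unit_uniformly_continuous ce e0.
by exists N => n Nn _ s t; apply: HN.
Qed.

Lemma oriented_planar_grid_model : grid_model (fun u v => [set u; v]%SET \in E).
Proof.
have [N1 far] := apart_far.
set d : R := N1.+1%:R^-1 in far; have d0 : 0 < d by rewrite invr_gt0.
(* Sampled points whose cells coincide can be off by one mesh step on either side, so their
   coordinates differ by less than three mesh widths; with mesh [d / 4] this stays below [d]. *)
have de0 : 0 < d / 4 by lra.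
have [N2 unif] := edges_uniform de0.
pose L := N2.+1; pose t (k : nat) : R := k%:R / (3 * L)%:R.
have L0 : 0 < (3 * L)%:R :> R by rewrite ltr0n.
have L1 : 0 < L%:R :> R by rewrite ltr0n.
pose sx e k := (gamma e (t k)).1; pose sy e k := (gamma e (t k)).2.
pose B := \sum_(e : {set V}) \sum_(k < (3 * L).+1) (`|sx e k| + `|sy e k|).
have Bge e k : (k <= 3 * L)%N -> - B <= sx e k /\ - B <= sy e k.
  move=> kL; have kL' : (k < (3 * L).+1)%N by [].
  have : `|sx e k| + `|sy e k| <= B.
    rewrite /B (bigD1 e) //= (bigD1 (Ordinal kL')) //= -addrA lerDl addr_ge0 ?sumr_ge0 // => *;
    by rewrite ?sumr_ge0 // => *; rewrite addr_ge0.
  have := ler_norm (- sx e k); have := ler_norm (- sy e k); rewrite !normrN.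
  have := normr_ge0 (sx e k); have := normr_ge0 (sy e k).
  by move=> *; split; rewrite lerNl; [apply: (@le_trans _ _ `|sx e k|)|apply: (@le_trans _ _ `|sy e k|)] => //;
    apply: le_trans (_ : `|sx e k| + `|sy e k| <= _) => //; rewrite ?lerDl ?lerDr.
pose K := cell_coord B (d / 4).
have t01 k : (k <= 3 * L)%N -> 0 <= t k <= 1.
  by move=> kL; rewrite divr_ge0 ?ler0n //= ler_pdivrMr // mul1r ler_nat.
have tstep k : `|t k - t k.+1| <= N2.+1%:R^-1.
  rewrite /t -mulrBl -natr1 opprD addrA subrr add0r normrM normrN normr1 mul1r.
  by rewrite ger0_norm ?invr_ge0 ?ler0n // lef_pV2 ?posrE // ler_nat /L; lia.
have close e k : e \in E -> (k < 3 * L)%N -> dist_lt (gamma e (t k)) (gamma e (t k.+1)) (d / 4).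
  by move=> eE kL; apply: unif => //; apply: t01 => //; apply: ltnW.
have Kstep e k : e \in E -> (k < 3 * L)%N ->
    [/\ (K (sx e k) <= (K (sx e k.+1)).+1)%N, (K (sx e k.+1) <= (K (sx e k)).+1)%N,
     (K (sy e k) <= (K (sy e k.+1)).+1)%N & (K (sy e k.+1) <= (K (sy e k)).+1)%N].
  move=> eE kL; have [b1 b2] := Bge e k (ltnW kL); have [b3 b4] := Bge e k.+1 kL.
  have [c1 c2] := close _ _ eE kL.
  by split; apply: cell_coord_close => //; rewrite distrC.
(* A staircase: the first coordinate moves half a step ahead of the second, so consecutive cells
   differ in at most one coordinate, by at most one. Two cells per sample turn [3 * L] samples into
   [6 * L] steps. *)
pose cell e a := (K (sx e (uphalf a)), K (sy e a./2)).
pose hub v := (K (pos v).1, K (pos v).2).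
have meet e f a b : e \in E -> f \in E -> (a <= 6 * L)%N -> (b <= 6 * L)%N ->
    cell e a = cell f b -> dist_lt (gamma e (t a./2)) (gamma f (t b./2)) d.
  move=> eE fE aL bL em.
  have ex : K (sx e (uphalf a)) = K (sx f (uphalf b)) := congr1 fst em.
  have ey : K (sy e a./2) = K (sy f b./2) := congr1 snd em; have [a1 a2] := half_le_three aL; have [b1 b2] := half_le_three bL.
  have near1 g c : g \in E -> (c <= 6 * L)%N -> (K (sx g c./2) <= (K (sx g (uphalf c))).+1)%N /\
      (K (sx g (uphalf c)) <= (K (sx g c./2)).+1)%N.
    move=> gE cL; case: (boolP (odd c)) => oc; last first.
      by rewrite uphalf_half (negbTE oc).
    rewrite uphalf_half oc add1n; have kL := odd_half_lt_three oc cL.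
    by have [] := Kstep _ _ gE kL.
  have [p1 p2] := near1 _ _ eE aL; have [q1 q2] := near1 _ _ fE bL.
  have [Ba Ba'] := Bge e _ a1; have [Bb Bb'] := Bge f _ b1.
  have x1 : sx e a./2 - sx f b./2 < 3%:R * (d / 4).
    by apply: (coord_close_cell de0 Ba Bb); rewrite (leq_trans p1) // ex addn2 ltnS.
  have x2 : sx f b./2 - sx e a./2 < 3%:R * (d / 4).
    by apply: (coord_close_cell de0 Bb Ba); rewrite (leq_trans q1) // -ex addn2 ltnS.
  have y1 : sy e a./2 - sy f b./2 < 3%:R * (d / 4).
    by apply: (coord_close_cell de0 Ba' Bb'); rewrite -/K ey leq_addr.
  have y2 : sy f b./2 - sy e a./2 < 3%:R * (d / 4).
    by apply: (coord_close_cell de0 Bb' Ba'); rewrite -/K -ey leq_addr.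
  by split; apply: dist_three_quarters.
have piece (i : 'I_3) a : (2 * L * i <= a <= 2 * L * i.+1)%N ->
    i%:R / 3 <= t a./2 <= i.+1%:R / 3.
  move=> /half_third/andP[h1 h2]; rewrite /t natrM.
  rewrite ler_pdivlMr ?ltr0n ?mulr_gt0 // ler_pdivrMr ?mulr_gt0 //.
  rewrite !mulrA !divfK ?pnatr_eq0 // -!natrM !ler_nat.
  by apply/andP; split.
have no_meet e f (i j : 'I_3) a b : apart (e, i) (f, j) ->
    (2 * L * i <= a <= 2 * L * i.+1)%N -> (2 * L * j <= b <= 2 * L * j.+1)%N ->
    cell e a <> cell f b.
  move=> ap ai bj em; have /andP[/andP[/= eE fE] _] := ap.
  have [||m1 m2] := meet e f a b eE fE _ _ em.
  - by move: ai => /andP[_ h]; apply: leq_trans h _; rewrite (_ : 6 = 2 * 3)%N // -!mulnA [(3 * _)%N]mulnC !leq_mul2l ltn_ord !orbT.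
  - by move: bj => /andP[_ h]; apply: leq_trans h _; rewrite (_ : 6 = 2 * 3)%N // -!mulnA [(3 * _)%N]mulnC !leq_mul2l ltn_ord !orbT.
  have := far _ _ ap _ _ (piece _ _ ai) (piece _ _ bj).
  by move=> [h|h] /=; [move: (lt_le_trans m1 h)|move: (lt_le_trans m2 h)]; rewrite ltxx.
pose i0 : 'I_3 := ord0; pose i1 : 'I_3 := inord 1; pose i2 : 'I_3 := inord 2.
have i1E : i1 = 1%N :> nat by rewrite inordK.
have i2E : i2 = 2%N :> nat by rewrite inordK.
have starE v p : star E src tgt L cell v p -> exists e a (i : 'I_3),
    [/\ e \in E, cell e a = p, third_end i e = Some v & (2 * L * i <= a <= 2 * L * i.+1)%N].
  case=> e [a [eE ca [[-> aL]|[-> aL]]]].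
    by exists e, a, i0; split=> //; rewrite muln0 muln1.
  by exists e, a, i2; rewrite /third_end !i2E; split=> //; move: aL => /andP[? ?]; apply/andP; split; lia.
apply: (@cell_paths_grid_model V E src tgt L cell hub).
- by move=> e /endsP[? ? _ _].
- move=> e /endsP[_ _ g0 _]; rewrite /cell /hub -g0 /sx /sy /= (_ : t 0%N = 0) //.
  by rewrite /t mul0r.
- move=> e /endsP[_ _ _ g1]; have u6 : uphalf (6 * L) = (3 * L)%N by lia.
  have h6 : (6 * L)./2 = (3 * L)%N by lia.
  rewrite /cell u6 h6 /hub -g1 /sx /sy; by rewrite (_ : t (3 * L)%N = 1) // /t divff // gt_eqF.
- move=> e a eE aL; rewrite /cell /=.
  have kL := half_lt_three aL.
  have [k1 k2 k3 k4] := Kstep _ _ eE kL.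
  rewrite /cell_adj /= uphalf_half; case: (odd a) => /=; rewrite ?add1n ?add0n eqxx /=.
    case: (eqVneq (K (sy e a./2)) (K (sy e a./2.+1))) => [->|ne]; [by left|right].
    by apply/orP; left; lia.
  case: (eqVneq (K (sx e a./2)) (K (sx e a./2.+1))) => [->|ne]; [by left|right].
  by rewrite orbC; apply/orP; left; lia.
- by [].
- move=> u v p /starE[e [a [i [eE ca iu ai]]]] /starE[f [b [j [fE cb jv bj]]]].
  apply/eqP/negPn/negP => uv; have : cell e a = cell f b by rewrite ca cb.
  have [ef|ef] := eqVneq e f.
    subst f; have uv' : u <> v by apply/eqP.
    have ij : (i == 0%N :> nat) && (j == 2%N :> nat) || (j == 0%N :> nat) && (i == 2%N :> nat).
      move: iu jv; rewrite /third_end; case: i {ai} => -[|[|[|//]]] lti //= [eu];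
      by case: j {bj} => -[|[|[|//]]] ltj //= [ev]; case: uv'; rewrite -eu -ev.
    case/orP: ij => ij; first by apply: (no_meet e e i j) => //; rewrite /apart /= eE eqxx.
    by move/esym; apply: (no_meet e e j i) => //; rewrite /apart /= eE eqxx.
  by apply: (no_meet e f i j) => //; rewrite /apart /= eE fE (negbTE ef) iu jv orbC (inj_eq Some_inj) uv.
- move=> e f p eE fE [a [ca ha]] [b [cb hb]]; apply/eqP/negPn/negP => ef.
  have : cell e a = cell f b by rewrite ca cb.
  by apply: (no_meet e f i1 i1); rewrite ?i1E ?muln1 //;
    [rewrite /apart /= eE fE (negbTE ef) /third_end i1E|lia|lia].
- move=> v e p eE /starE[f [a [i [fE ca iv ai]]]] [b [cb hb]].
  apply/negPn/negP => ve; have : cell f a = cell e b by rewrite ca cb.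
  have fe : f != e.
    apply: contraNneq ve => fe; have [ee _ _ _] := endsP eE.
    move: iv; rewrite fe ee /third_end -ee; case: i {ai} => -[|[|[|//]]] lti //= [<-].
      by rewrite {2}ee !inE eqxx.
    by rewrite {2}ee !inE eqxx orbT.
  by apply: (no_meet f e i i1) => //; rewrite ?i1E; [rewrite /apart /= eE fE (negbTE fe) iv /third_end i1E|lia].
Qed.

End Discretization.

Lemma planar_grid_model (R : realType) (V : finType) (E : {set {set V}}) :
  simple_graph E -> planar R E -> grid_model (fun u v => [set u; v]%SET \in E).
Proof.
move=> Es [pos [gamma D]]; have [v0 _|noV] := pickP (fun _ : V => true); last first.
  exists 0%N, (fun _ _ => None); split=> // u; by have := noV u.
have [_ De _ _] := D.
have /choice[st stP] : forall e : {set V}, exists s : V * V, e \in E ->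
    [/\ e = [set s.1; s.2]%SET, s.1 != s.2, gamma e 0%R = pos s.1 & gamma e 1%R = pos s.2].
  move=> e; case: (boolP (e \in E)) => [eE|_]; last by exists (v0, v0).
  have [_ _ [u [v [ee gu gv]]]] := De e eE; exists (u, v) => _; split=> //=.
  by apply: (simple_ends Es); rewrite -ee.
exact: (@oriented_planar_grid_model R V E pos gamma Es D (fun e => (st e).1) (fun e => (st e).2) stP).
Qed.

(** * Gluing drawings along an edge *)

Section Inversion.
Local Open Scope ring_scope.
Variable R : realType.
Implicit Types (p z c w : R * R).

Definition sqdist p z : R := (p.1 - z.1) ^+ 2 + (p.2 - z.2) ^+ 2.

Lemma sqdist_gt0 p z : p <> z -> 0 < sqdist p z.
Proof.
case: p z => [x y] [x' y'] ne; rewrite /sqdist /= lt_neqAle addr_ge0 ?sqr_ge0 // andbT eq_sym.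
rewrite paddr_eq0 ?sqr_ge0 // !sqrf_eq0 !subr_eq0.
by apply/negP => /andP[/eqP e1 /eqP e2]; apply: ne; rewrite e1 e2.
Qed.

Definition eps_continuous_at (F : R * R -> R * R) z := forall eps, 0 < eps ->
  exists2 eta, 0 < eta & forall z', dist_lt z z' eta -> dist_lt (F z) (F z') eps.

Lemma cvg_eps_continuous F z : {for z, continuous F} -> eps_continuous_at F z.
Proof.
move=> cF eps e0; move/cvgrPdist_lt : cF => /(_ _ e0).
rewrite near_nbhs => /nbhs_ballP[eta eta0 H]; exists eta => // z' [h1 h2].
have := H z' (conj h1 h2); by rewrite prod_normE /= gt_max => /andP[].
Qed.

(* Inversion at the point [c + w] of the circle of center [c], followed by an
   affine map: it sends the exterior of the circle to the upper half plane. *)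
Lemma exterior_to_half_plane c (r : R) p1 p2 : 0 < r -> p1 <> p2 ->
  sqdist p1 c = r ^+ 2 -> sqdist p2 c = r ^+ 2 ->
  exists (s : R * R) (F : R * R -> R * R),
  [/\ sqdist s c = r ^+ 2 /\ (s <> p1 /\ s <> p2),
      forall z z', z <> s -> z' <> s -> F z = F z' -> z = z',
      forall z, z <> s -> eps_continuous_at F z,
      forall z, r ^+ 2 < sqdist z c -> 0 < (F z).2
    & F p1 = (0, 0) /\ F p2 = (1, 0)].
Proof.
move=> r0 p12 c1 c2.
have [w [w2 [wp1 wp2]]] : exists w, w.1 ^+ 2 + w.2 ^+ 2 = r ^+ 2 /\
    ((c.1 + w.1, c.2 + w.2) <> p1 /\ (c.1 + w.1, c.2 + w.2) <> p2).
  have ex w w' p : w <> w' -> (c.1 + w.1, c.2 + w.2) = p -> (c.1 + w'.1, c.2 + w'.2) <> p.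
    move=> ne <- [e1 e2]; apply: ne.
    by case: w w' e1 e2 => [? ?] [? ?] /= /addrI -> /addrI ->.
  (* Of three distinct points of the circle, one differs from both [p1] and [p2]. *)
  pose wa : R * R := (r, 0); pose wb : R * R := (- r, 0); pose wc : R * R := (0, r).
  have ab : wa <> wb by move=> [e]; lra.
  have ac : wa <> wc by move=> [e _]; lra.
  have bc : wb <> wc by move=> [e _]; lra.
  have na : wa.1 ^+ 2 + wa.2 ^+ 2 = r ^+ 2 by rewrite /=; ring.
  have nb : wb.1 ^+ 2 + wb.2 ^+ 2 = r ^+ 2 by rewrite /=; ring.
  have nc : wc.1 ^+ 2 + wc.2 ^+ 2 = r ^+ 2 by rewrite /=; ring.
  have [a1|a1] := pselect ((c.1 + wa.1, c.2 + wa.2) = p1).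
    have [b2|b2] := pselect ((c.1 + wb.1, c.2 + wb.2) = p2).
      by exists wc; split=> //; split; [apply: ex ac a1|apply: ex bc b2].
    by exists wb; split=> //; split=> //; apply: ex ab a1.
  have [a2|a2] := pselect ((c.1 + wa.1, c.2 + wa.2) = p2); last by exists wa.
  have [b1|b1] := pselect ((c.1 + wb.1, c.2 + wb.2) = p1).
    by exists wc; split=> //; split; [apply: ex bc b1|apply: ex ac a2].
  by exists wb; split=> //; split=> //; apply: ex ab a2.
set s := (c.1 + w.1, c.2 + w.2) in wp1 wp2.
pose X z := ((z.2 - s.2) * w.1 - (z.1 - s.1) * w.2) / sqdist z s.
pose Y z := 1 + 2 * ((z.1 - s.1) * w.1 + (z.2 - s.2) * w.2) / sqdist z s.
(* Expanding the squared distance to [c = s - w] around [s] shows that the sign of [Y] separates the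
   exterior of the circle from its interior. *)
have YE z : z <> s -> Y z = (sqdist z c - r ^+ 2) / sqdist z s.
  move=> /sqdist_gt0 zs; rewrite /Y -w2; apply: (mulIf (lt0r_neq0 zs)).
  rewrite mulrDl !divfK ?lt0r_neq0 // mul1r /sqdist /s /=; ring.
have r20 : 0 < r ^+ 2 by rewrite exprn_gt0.
have XYinj z z' : z <> s -> z' <> s -> X z = X z' -> Y z = Y z' -> z = z'.
  move=> zs zs' eX /addrI eY.
  have D0 := sqdist_gt0 zs; have D0' := sqdist_gt0 zs'.
  (* The inverted points, relative to [s]: [Y] and [X] give their components along and across [w],
     and their norms give back the distances of [z] and [z'] to [s]. *)
  have [u1 uE1] : exists u, u = (z.1 - s.1) / sqdist z s by eexists.
  have [u2 uE2] : exists u, u = (z.2 - s.2) / sqdist z s by eexists.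
  have [v1 vE1] : exists u, u = (z'.1 - s.1) / sqdist z' s by eexists.
  have [v2 vE2] : exists u, u = (z'.2 - s.2) / sqdist z' s by eexists.
  have eA : u2 * w.1 - u1 * w.2 = v2 * w.1 - v1 * w.2.
    transitivity (X z); first by rewrite uE1 uE2 /X; ring.
    by rewrite eX vE1 vE2 /X; ring.
  have eB : u1 * w.1 + u2 * w.2 = v1 * w.1 + v2 * w.2.
    move: eY; rewrite -!mulrA => /(mulfI (lt0r_neq0 (ltr0Sn _ 1))) eY.
    transitivity (((z.1 - s.1) * w.1 + (z.2 - s.2) * w.2) / sqdist z s).
      by rewrite uE1 uE2; ring.
    by rewrite eY vE1 vE2; ring.
  have e1 : u1 = v1.
    have : (u1 - v1) * r ^+ 2 = 0.
      rewrite -w2; transitivity (w.1 * (u1 * w.1 + u2 * w.2 - (v1 * w.1 + v2 * w.2)) -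
        w.2 * (u2 * w.1 - u1 * w.2 - (v2 * w.1 - v1 * w.2))); first by ring.
      by rewrite eA eB !subrr !mulr0 subrr.
    by move/eqP; rewrite mulf_eq0 (gt_eqF r20) orbF subr_eq0 => /eqP.
  have e2 : u2 = v2.
    have : (u2 - v2) * r ^+ 2 = 0.
      rewrite -w2; transitivity (w.2 * (u1 * w.1 + u2 * w.2 - (v1 * w.1 + v2 * w.2)) +
        w.1 * (u2 * w.1 - u1 * w.2 - (v2 * w.1 - v1 * w.2))); first by ring.
      by rewrite eA eB !subrr !mulr0 addr0.
    by move/eqP; rewrite mulf_eq0 (gt_eqF r20) orbF subr_eq0 => /eqP.
  have q1 : u1 ^+ 2 + u2 ^+ 2 = (sqdist z s)^-1.
    rewrite uE1 uE2 !expr_div_n -mulrDl -/(sqdist z s) expr2 invfM mulrA divff ?mul1r //.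
    exact: lt0r_neq0.
  have q2 : v1 ^+ 2 + v2 ^+ 2 = (sqdist z' s)^-1.
    rewrite vE1 vE2 !expr_div_n -mulrDl -/(sqdist z' s) expr2 invfM mulrA divff ?mul1r //.
    exact: lt0r_neq0.
  have eD : sqdist z s = sqdist z' s by apply: invr_inj; rewrite -q1 -q2 e1 e2.
  move: e1 e2; rewrite uE1 uE2 vE1 vE2 eD.
  move/(mulIf (invr_neq0 (lt0r_neq0 D0')))/addIr => e1.
  move/(mulIf (invr_neq0 (lt0r_neq0 D0')))/addIr => e2.
  by rewrite [z]surjective_pairing e1 e2 -surjective_pairing.
have p1s : p1 <> s by apply: nesym. have p2s : p2 <> s by apply: nesym.
have Y1 : Y p1 = 0 by rewrite YE // c1 subrr mul0r.
have Y2 : Y p2 = 0 by rewrite YE // c2 subrr mul0r.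
have X12 : X p2 - X p1 != 0.
  by rewrite subr_eq0; apply/eqP => e; apply: p12; apply: XYinj; rewrite ?Y1 ?Y2.
pose F z := ((X z - X p1) / (X p2 - X p1), Y z).
exists s, F; split.
- by rewrite /sqdist /s /= -w2; split=> //; ring.
- move=> z z' zs zs' [/(mulIf (invr_neq0 X12))/addIr eX eY]; exact: XYinj.
- move=> z /sqdist_gt0 zs; apply: cvg_eps_continuous.
  have c1' : {for z, continuous (fun z : R * R => z.1 - s.1)}.
    by apply: cvgB; [exact: cvg_fst|exact: cvg_cst].
  have c2' : {for z, continuous (fun z : R * R => z.2 - s.2)}.
    by apply: cvgB; [exact: cvg_snd|exact: cvg_cst].
  have cD : {for z, continuous (fun z => (sqdist z s)^-1)}.
    apply: continuousV; first exact: lt0r_neq0.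
    by apply: continuousD; rewrite /=; [apply: (continuousM c1' c1')|apply: (continuousM c2' c2')].
  have k (a : R) : {for z, continuous (fun _ : R * R => a)} by apply: cvg_cst.
  have cX : {for z, continuous X}.
    exact: (continuousM (continuousB (continuousM c2' (k w.1)) (continuousM c1' (k w.2))) cD).
  have cY : {for z, continuous Y}.
    apply: (continuousD (k 1) _).
    exact: (continuousM (continuousM (k 2) (continuousD (continuousM c1' (k w.1)) (continuousM c2' (k w.2)))) cD).
  have cX' : {for z, continuous (fun z => (X z - X p1) / (X p2 - X p1))}.
    exact: (continuousM (continuousB cX (k _)) (k _)).
  exact: (cvg_pair cX' cY).
- move=> z rz; rewrite /F /= YE; last first.
    by move=> e; move: rz; rewrite e /sqdist /s /= -w2 addrAC subrr add0r addrAC subrr add0r ltxx.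
  rewrite divr_gt0 ?subr_gt0 ?sqdist_gt0 // => e.
  by move: rz; rewrite e /sqdist /s /= -w2 addrAC subrr add0r addrAC subrr add0r ltxx.
- by rewrite /F subrr mul0r Y1 Y2 divff.
Qed.
End Inversion.

(** * Cutting an edge and opening the drawing into a half plane *)

Section CutEdge.
Local Open Scope classical_set_scope.
Local Open Scope ring_scope.
Variable R : realType.
Implicit Types (g : R -> R * R) (F : R * R -> R * R) (c p : R * R).

Definition arc g := {within `[0, 1], continuous g} /\ {in `[0, 1] &, injective g}.

Lemma affine_unit (u v t : R) : 0 <= u <= 1 -> 0 <= v <= 1 -> 0 <= t <= 1 ->
  0 <= u + (v - u) * t <= 1.
Proof.
move=> /andP[u0 u1] /andP[v0 v1] /andP[t0 t1].
have -> : u + (v - u) * t = (1 - t) * u + t * v by ring.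
apply/andP; split; first by rewrite addr_ge0 ?mulr_ge0 ?subr_ge0.
have h1 : (1 - t) * u <= (1 - t) * 1 by rewrite ler_wpM2l ?subr_ge0.
have h2 : t * v <= t * 1 by rewrite ler_wpM2l.
by rewrite mulr1 in h1; rewrite mulr1 in h2; lra.
Qed.

Lemma arc_transport g F (u v : R) : arc g -> 0 <= u <= 1 -> 0 <= v <= 1 -> u != v ->
  (forall t, 0 <= t <= 1 -> eps_continuous_at F (g (u + (v - u) * t))) ->
  (forall t t', 0 <= t <= 1 -> 0 <= t' <= 1 ->
     F (g (u + (v - u) * t)) = F (g (u + (v - u) * t')) ->
     g (u + (v - u) * t) = g (u + (v - u) * t')) ->
  arc (fun t => F (g (u + (v - u) * t))).
Proof.
move=> [/within_unitP cg ig] u01 v01 uv cF iF; split.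
  apply/within_unitP => s s01 eps /(cF s s01)[eta1 e1 H1].
  have [eta2 e2 H2] := cg _ (affine_unit u01 v01 s01) _ e1.
  exists eta2 => // t t01 st; apply/H1/H2; first exact: affine_unit.
  rewrite opprD addrACA subrr add0r -mulrBr normrM.
  apply: le_lt_trans st; rewrite -[leRHS]mul1r ler_wpM2r // ler_norml.
  by move: u01 v01 => /andP[? ?] /andP[? ?]; apply/andP; split; lra.
move=> s t; rewrite !in_itv => s01 t01 /(iF _ _ s01 t01).
move/ig; rewrite !in_itv /= => /(_ (affine_unit u01 v01 s01) (affine_unit u01 v01 t01)).
by move/addrI/mulfI; apply; rewrite subr_eq0 eq_sym.
Qed.

Lemma eps_continuous_id p : eps_continuous_at id p.
Proof. by move=> eps e0; exists eps. Qed.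

Lemma arc_image g F : arc g -> (forall t, 0 <= t <= 1 -> eps_continuous_at F (g t)) ->
  (forall t t', 0 <= t <= 1 -> 0 <= t' <= 1 -> F (g t) = F (g t') -> g t = g t') ->
  arc (fun t => F (g t)).
Proof.
move=> ag cF iF; have e t : 0 + (1 - 0) * t = t :> R by rewrite subr0 mul1r add0r.
have := @arc_transport g F 0 1 ag.
have -> : (fun t => F (g (0 + (1 - 0) * t))) = (fun t => F (g t)) by apply/funext => t; rewrite e.
rewrite !lexx !ler01 eq_sym oner_neq0; apply=> // [t t01|t t' t01 t'01]; rewrite !e; first exact: cF.
exact: iF.
Qed.

Lemma arc_reverse g : arc g -> arc (fun t => id (g (1 + (0 - 1) * t))).
Proof.
move=> ag; apply: (@arc_transport g id 1 0) => //; rewrite ?lexx ?ler01 ?oner_neq0 // => t _.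
exact: eps_continuous_id.
Qed.

Lemma sqdist_continuous g c s eps : {within `[0, 1], continuous g} -> 0 <= s <= 1 -> 0 < eps ->
  exists2 eta, 0 < eta & forall t, 0 <= t <= 1 -> `|s - t| < eta ->
    `|sqdist (g s) c - sqdist (g t) c| < eps.
Proof.
move=> /within_unitP cg s01 e0; set z := g s.
have k (a : R) : {for z, continuous (fun _ : R * R => a)} by apply: cvg_cst.
have c1' : {for z, continuous (fun z : R * R => z.1 - c.1)}.
  exact: (continuousB (cvg_fst) (k c.1)).
have c2' : {for z, continuous (fun z : R * R => z.2 - c.2)}.
  exact: (continuousB (cvg_snd) (k c.2)).
have cq : {for z, continuous (fun z => sqdist z c)}.
  exact: (continuousD (continuousM c1' c1') (continuousM c2' c2')).
move/cvgrPdist_lt : cq => /(_ _ e0); rewrite near_nbhs => /nbhs_ballP[eta eta0 H].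
have [eta' e' H'] := cg s s01 _ eta0; exists eta' => // t t01 st.
by have [h1 h2] := H' t t01 st; exact: H (g t) (conj h1 h2).
Qed.

(** Take the infimum of the times spent in the closed disc. A distance above [r] there contradicts
    the times approaching it, a distance below [r] the times before it. *)
Lemma first_hit g c (r : R) : {within `[0, 1], continuous g} ->
  r < sqdist (g 0) c -> sqdist (g (1 / 2)) c < r ->
  exists t1, [/\ 0 < t1 < 1 / 2, sqdist (g t1) c = r &
    forall t, 0 <= t < t1 -> r < sqdist (g t) c].
Proof.
move=> cg g0 g1; pose T := [set t | 0 <= t <= 1 / 2 /\ sqdist (g t) c <= r].
have T12 : T (1 / 2) by split; [lra|exact: ltW].
have lbT : lbound T 0 by move=> t [/andP[]].
have hT : has_inf T by split; [exists (1 / 2)|exists 0].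
have low t : T t -> inf T <= t by move=> Tt; apply: inf_lbound; [case: hT|].
have i0 : 0 <= inf T by apply: lb_le_inf; [exists (1 / 2)|].
have i1 : inf T <= 1 / 2 := low _ T12.
have i01 : 0 <= inf T <= 1 by lra.
have above t : 0 <= t < inf T -> r < sqdist (g t) c.
  move=> /andP[t0 t1]; rewrite ltNge; apply/negP => gt.
  by have /low : T t; [split=> //; lra|lra].
have eqr : sqdist (g (inf T)) c = r.
  apply/eqP; rewrite eq_le; apply/andP; split; rewrite leNgt; apply/negP => lt.
    have e0 : 0 < sqdist (g (inf T)) c - r by rewrite subr_gt0.
    have [eta eta0 H] := sqdist_continuous c cg i01 e0.
    have [t Tt tlt] := inf_adherent eta0 hT.
    have [t01 gt] := Tt; have tl := low _ Tt.
    have : `|sqdist (g (inf T)) c - sqdist (g t) c| < sqdist (g (inf T)) c - r.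
      by apply: H; [lra|rewrite ltr_norml; lra].
    by rewrite ltr_norml; lra.
  have ipos : 0 < inf T.
    by rewrite lt_neqAle i0 andbT; apply/eqP => e; move: lt; rewrite -e => ?; lra.
  have e0 : 0 < r - sqdist (g (inf T)) c by rewrite subr_gt0.
  have [eta eta0 H] := sqdist_continuous c cg i01 e0.
  pose t := Num.max 0 (inf T - eta / 2).
  have t0 : 0 <= t < inf T by rewrite /t le_max lexx gt_max ipos /=; lra.
  have td : inf T - eta / 2 <= t by rewrite /t le_max lexx orbT.
  have : `|sqdist (g (inf T)) c - sqdist (g t) c| < r - sqdist (g (inf T)) c.
    by apply: H; [lra|rewrite ltr_norml; lra].
  by have := above t t0; rewrite ltr_norml; lra.
exists (inf T); split=> //; apply/andP; split.
  by rewrite lt_neqAle i0 andbT; apply/eqP => e; move: eqr; rewrite -e => ?; lra.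
by rewrite lt_neqAle i1 andbT; apply/eqP => e; move: eqr; rewrite e => ?; lra.
Qed.

Lemma far_sqdist p c (d r : R) : 0 < r < d -> dist_far p c d -> r ^+ 2 < sqdist p c.
Proof.
move=> /andP[r0 rd] far; have d0 := lt_trans r0 rd.
have rd2 : r ^+ 2 < d ^+ 2 by rewrite ltr_pXn2r ?nnegrE ?ltW.
apply: lt_le_trans rd2 _; rewrite /sqdist.
have sq (x : R) : d <= `|x| -> d ^+ 2 <= x ^+ 2.
  by move=> h; rewrite -[x ^+ 2]real_normK ?num_real // ler_pXn2r ?nnegrE // ltW.
by case: far => /sq h; [rewrite ler_wpDr ?sqr_ge0|rewrite ler_wpDl ?sqr_ge0].
Qed.

(** One of the two stubs of a cut edge, leading from the vertex [a] to a point [p] of the boundary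
    line. *)
Definition half_arc (V : finType) (E : {set {set V}}) (pos : V -> R * R)
    (gamma : {set V} -> R -> R * R) (al : R -> R * R) p (a : V) :=
  [/\ arc al, al 0 = pos a /\ al 1 = p, forall t, 0 <= t < 1 -> 0 < (al t).2,
     forall t v, 0 < t < 1 -> al t <> pos v &
     forall f s t, f \in E -> 0 < s < 1 -> 0 < t < 1 -> al s <> gamma f t].

Lemma oriented_edge (V : finType) (E : {set {set V}}) (pos : V -> R * R)
    (gamma : {set V} -> R -> R * R) a b : plane_drawing E pos gamma ->
  [set a; b]%SET \in E -> a != b ->
  exists g, [/\ arc g, g 0 = pos a, g 1 = pos b &
    forall t, 0 < t < 1 -> exists2 t', 0 < t' < 1 & g t = gamma [set a; b]%SET t'].
Proof.
move=> [pinj De _ _] abE ab; have [cg ig [u [v [e gu gv]]]] := De _ abE.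
set g := gamma _ in cg ig gu gv *; have ag : arc g by [].
have [[eu ev]|[eu ev]] : (u = a /\ v = b) \/ (u = b /\ v = a).
  have := finset.set21 a b; have := finset.set22 a b; rewrite e !inE.
  move=> /orP[]/eqP eb /orP[]/eqP ea; rewrite -?ea -?eb; auto;
  by rewrite ea eb eqxx in ab.
- by exists g; split; rewrite ?gu ?gv ?eu ?ev // => t t01; exists t.
- exists (fun t => id (g (1 + (0 - 1) * t))); split.
  + exact: arc_reverse.
  + by rewrite mulr0 addr0 gv ev.
  + by rewrite mulr1 addrC subrK gu eu.
  + by move=> t t01; exists (1 + (0 - 1) * t) => //; lra.
Qed.

(** A small circle around an inner point of the edge misses the rest of the drawing by compactness,
    and its exterior is mapped to the upper half plane. The edge itself may enter the disc many
    times, so it is cut where it first meets the circle from either end and the part between is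
    dropped. *)
Lemma cut_edge (V : finType) (E : {set {set V}}) (pos : V -> R * R)
    (gamma : {set V} -> R -> R * R) a b : plane_drawing E pos gamma ->
  [set a; b]%SET \in E -> a != b ->
  let E' := (E :\ [set a; b])%SET in
  exists pos' gamma' al be, [/\ plane_drawing E' pos' gamma',
    (forall v, 0 < (pos' v).2) /\
    (forall f t, f \in E' -> 0 <= t <= 1 -> 0 < (gamma' f t).2),
    half_arc E' pos' gamma' al (0, 0) a, half_arc E' pos' gamma' be (1, 0) b &
    forall s t, 0 < s < 1 -> 0 < t < 1 -> al s <> be t].
Proof.
move=> D abE ab E'; have [pinj De Dv Df] := D.
have [g [[cg ig] g0 g1 gint]] := oriented_edge D abE ab.
have h01 : 0 < (1 / 2 : R) < 1 by lra.
pose c := g (1 / 2); have [tc tc01 cE] := gint _ h01.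
have gDf f s t : f \in E' -> 0 < s < 1 -> 0 < t < 1 -> g s <> gamma f t.
  move=> /setD1P[fe fE] s01 t01; have [s' s'01 ->] := gint _ s01.
  by apply: Df; rewrite // 1?eq_sym // in_itv.
have gDv v s : 0 < s < 1 -> g s <> pos v.
  by move=> s01; have [s' s'01 ->] := gint _ s01; apply: Dv; rewrite // in_itv.
have gDf' f s t : f \in E' -> 0 < s < 1 -> 0 <= t <= 1 -> gamma f t <> g s.
  move=> fE' s01 t01; have /setD1P[fe fE] := fE'.
  have [_ _ [u [v [_ gu gv]]]] := De _ fE.
  have [->|n0] := eqVneq t 0; first by rewrite gu; apply/nesym/gDv.
  have [->|n1] := eqVneq t 1; first by rewrite gv; apply/nesym/gDv.
  apply/nesym/gDf => //; move: t01 => /andP[t0 t1].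
  by rewrite !lt_neqAle eq_sym n0 t0 n1 t1.
have [N HN] : exists N, forall x : V + {set V}, match x with
    | inl v => dist_far (pos v) c N.+1%:R^-1
    | inr f => f \in E' -> forall t, 0 <= t <= 1 -> dist_far (gamma f t) c N.+1%:R^-1 end.
  have mono (n m : nat) p q : (n <= m)%N -> dist_far p q n.+1%:R^-1 -> dist_far p q m.+1%:R^-1.
    by move=> nm; apply: dist_far_le; rewrite lef_pV2 ?posrE ?ltr0Sn // ler_nat.
  apply: finite_uniform => -[v|f].
    have [N HN] := @compact_far R (fun _ => pos v) 0 1 c (lexx _) (lexx _)
      (continuous_subspaceT (@cst_continuous _ _ (pos v))) (fun t _ => nesym (gDv v _ h01)).
    by exists N => n Nn; apply: mono Nn (HN 0 _); rewrite lexx ler01.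
  case: (boolP (f \in E')) => [fE'|_]; last by exists 0%N.
  have /setD1P[_ fE] := fE'; have [cf _ _] := De _ fE.
  have [N HN] := compact_far (lexx _) (lexx _) cf (fun t t01 => gDf' f _ t fE' h01 t01).
  by exists N => n Nn _ t t01; apply: mono Nn (HN t t01).
(* Strictly below the distance [N.+1%:R^-1], so that the rest of the drawing lies strictly outside
   the circle. *)
pose r : R := N.+2%:R^-1; have r0 : 0 < r by rewrite invr_gt0.
have rN : 0 < r < N.+1%:R^-1.
  by rewrite r0 /= /r ltf_pV2 ?posrE ?ltr0Sn // ltr_nat ltnSn.
have vout v : r ^+ 2 < sqdist (pos v) c := far_sqdist rN (HN (inl v)).
have fout f t : f \in E' -> 0 <= t <= 1 -> r ^+ 2 < sqdist (gamma f t) c.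
  by move=> fE' t01; apply: far_sqdist rN (HN (inr f) fE' t t01).
have qc : sqdist c c < r ^+ 2 by rewrite /sqdist !subrr !expr0n /= addr0 exprn_gt0.
have [t1 [t1b q1 a1]] : exists t1, [/\ 0 < t1 < 1 / 2, sqdist (g t1) c = r ^+ 2 &
    forall t, 0 <= t < t1 -> r ^+ 2 < sqdist (g t) c].
  by apply: first_hit => //; rewrite g0.
have [t2 [t2b q2 a2]] : exists t2, [/\ 0 < t2 < 1 / 2, sqdist (g (1 + (0 - 1) * t2)) c = r ^+ 2 &
    forall t, 0 <= t < t2 -> r ^+ 2 < sqdist (g (1 + (0 - 1) * t)) c].
  apply: (@first_hit (fun t => id (g (1 + (0 - 1) * t)))).
  - by have [] := arc_reverse (conj cg ig).
  - by rewrite mulr0 addr0 g1.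
  - by rewrite (_ : 1 + (0 - 1) * (1 / 2) = 1 / 2) //; lra.
pose t3 := 1 + (0 - 1) * t2.
have p12 : g t1 <> g t3.
  by move/ig; rewrite !in_itv /= /t3 => /(_ _ _)H; have := H; lra.
have [s [F [[qs [sp1 sp2]] Finj Fcont Fpos [F1 F2]]]] := exterior_to_half_plane r0 p12 q1 q2.
have outs z : r ^+ 2 < sqdist z c -> z <> s by move=> zr e'; move: zr; rewrite e' qs ltxx.
have Fin x y : r ^+ 2 < sqdist x c -> r ^+ 2 < sqdist y c -> F x = F y -> x = y.
  by move=> /outs xs /outs ys; apply: Finj.
have t1b' : 0 < t1 < 1 / 2 := t1b; have t3b : 1 / 2 < t3 < 1 by rewrite /t3; lra.
have ta t : 0 <= t < 1 -> r ^+ 2 < sqdist (g (0 + (t1 - 0) * t)) c.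
  by move=> /andP[t0 tl1]; apply: a1; rewrite subr0 add0r; nra.
have tb t : 0 <= t < 1 -> r ^+ 2 < sqdist (g (1 + (t3 - 1) * t)) c.
  move=> /andP[t0 tl1]; have -> : 1 + (t3 - 1) * t = 1 + (0 - 1) * (t2 * t) by rewrite /t3; ring.
  by apply: a2; nra.
have ea1 : 0 + (t1 - 0) * 1 = t1 by ring.
have eb1 : 1 + (t3 - 1) * 1 = t3 by ring.
have le1 (t : R) : 0 <= t <= 1 -> t = 1 \/ 0 <= t < 1.
  by move=> /andP[t0]; rewrite le_eqVlt => /orP[/eqP|]; [left|right; rewrite t0].
have sa t : 0 <= t <= 1 -> g (0 + (t1 - 0) * t) <> s.
  by case/le1=> [->|/ta/outs//]; rewrite ea1; apply: nesym.
have sb t : 0 <= t <= 1 -> g (1 + (t3 - 1) * t) <> s.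
  by case/le1=> [->|/tb/outs//]; rewrite eb1; apply: nesym.
have ina t : 0 < t < 1 -> 0 < 0 + (t1 - 0) * t < 1 / 2.
  by move=> /andP[t0 tl1]; rewrite subr0 add0r; nra.
have inb t : 0 < t < 1 -> 1 / 2 < 1 + (t3 - 1) * t < 1.
  by move=> /andP[t0 tl1]; nra.
have w01 (t : R) : 0 < t < 1 -> 0 <= t < 1 by move=> /andP[/ltW -> ->].
have wt (t : R) : 0 < t < 1 -> 0 <= t <= 1 by move=> /andP[/ltW -> /ltW ->].
have i01 (t : R) : 0 < t < 1 / 2 -> 0 < t < 1 by lra.
have j01 (t : R) : 1 / 2 < t < 1 -> 0 < t < 1 by lra.
exists (fun v => F (pos v)), (fun f t => F (gamma f t)),
  (fun t => F (g (0 + (t1 - 0) * t))), (fun t => F (g (1 + (t3 - 1) * t))); split.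
- split.
  + by move=> u v /Fin e; apply/pinj/e.
  + move=> f fE'; have /setD1P[_ fE] := fE'; have [cf if_ [u [v [ef fu fv]]]] := De _ fE.
    have [? ?] : arc (fun t => F (gamma f t)).
      apply: arc_image => // [t /(fout _ _ fE')/outs/Fcont//|t t' t01 t'01].
      by apply: Fin; apply: fout.
    by split=> //; exists u, v; rewrite fu fv.
  + move=> f t v fE'; rewrite in_itv => t01 /Fin e; have /setD1P[_ fE] := fE'.
    apply: (Dv f t v) => //; apply: e => //; apply: fout => //; exact: wt.
  + move=> f h s' t fE' hE' fh; rewrite !in_itv => s01 t01 /Fin e.
    have /setD1P[_ fE] := fE'; have /setD1P[_ hE] := hE'.
    by apply: (Df f h s' t) => //; rewrite ?in_itv //; apply: e; apply: fout => //; apply: wt.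
- by split=> [v|f t fE' t01]; apply: Fpos => //; apply: fout.
- split.
  + have u01 : 0 <= (0 : R) <= 1 by lra.
    have v01 : 0 <= t1 <= 1 by lra.
    have uv : 0 != t1 by rewrite lt_eqF //; lra.
    apply: (arc_transport (conj cg ig) u01 v01 uv).
      by move=> t t01; apply/Fcont/sa.
    by move=> t t' t01 t'01; apply: Finj; apply: sa.
  + by rewrite ea1 mulr0 addr0 g0.
  + by move=> t /ta/Fpos.
  + move=> t v t01 /Fin e; apply: (gDv v (0 + (t1 - 0) * t)); first exact/i01/ina.
    by apply: e => //; apply/ta/w01.
  + move=> f s' t fE' s01 t01 /Fin e; apply: (gDf f (0 + (t1 - 0) * s') t) => //; first exact/i01/ina.
    by apply: e; [apply/ta/w01|apply: fout => //; apply: wt].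
- split.
  + have u01 : 0 <= (1 : R) <= 1 by lra.
    have v01 : 0 <= t3 <= 1 by lra.
    have uv : 1 != t3 by rewrite gt_eqF //; lra.
    apply: (arc_transport (conj cg ig) u01 v01 uv).
      by move=> t t01; apply/Fcont/sb.
    by move=> t t' t01 t'01; apply: Finj; apply: sb.
  + by rewrite eb1 mulr0 addr0 g1.
  + by move=> t /tb/Fpos.
  + move=> t v t01 /Fin e; apply: (gDv v (1 + (t3 - 1) * t)); first exact/j01/inb.
    by apply: e => //; apply/tb/w01.
  + move=> f s' t fE' s01 t01 /Fin e; apply: (gDf f (1 + (t3 - 1) * s') t) => //; first exact/j01/inb.
    by apply: e; [apply/tb/w01|apply: fout => //; apply: wt].
- move=> s' t s01 t01 /(Fin _ _ (ta _ (w01 _ s01)) (tb _ (w01 _ t01)))/ig.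
  have /andP[b1 b2] := inb _ t01; have /andP[a3 a4] := ina _ s01.
  have lt := lt_trans a4 b1; rewrite !in_itv /= (ltW a3) (ltW b2) (ltW (lt_trans a4 _)); last by lra.
  rewrite (ltW (lt_trans _ b1)); last by lra.
  by move=> /(_ isT isT) e; move: lt; rewrite e ltxx.
Qed.
End CutEdge.

(** * Joining two half-plane drawings *)

Definition glue_edges (V1 V2 V : finType) (h1 : V1 -> V) (h2 : V2 -> V)
    (E1 : {set {set V1}}) (a b : V1) (E2 : {set {set V2}}) (c d : V2) : {set {set V}} :=
  [set h1 @: (e : {set V1}) | e in E1 :\ [set a; b]]
  :|: [set h2 @: (f : {set V2}) | f in E2 :\ [set c; d]]
  :|: [set [set h1 a; h2 c]; [set h1 b; h2 d]].

Section Glue.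
Local Open Scope ring_scope.
Variable R : realType.

(** The second arc is run backwards, since both stubs end at the boundary line. *)
Definition arc_cat (f g : R -> R * R) (t : R) := if t <= 1 / 2 then f (2 * t) else g (2 - 2 * t).

Lemma arc_catP (f g : R -> R * R) : arc f -> arc g -> f 1 = g 1 ->
  (forall s t, 0 <= s <= 1 -> 0 <= t <= 1 -> f s = g t -> s = 1 /\ t = 1) ->
  arc (arc_cat f g).
Proof.
move=> [/within_unitP cf jf] [/within_unitP cg jg] fg1 fg; split.
  apply/within_unitP => s /andP[s0 s1] eps e0; rewrite /arc_cat.
  have [lt|gt|->] := ltgtP s (1 / 2).
  - have s01 : 0 <= 2 * s <= 1 by lra.
    have [eta eta0 H] := cf _ s01 _ e0.
    exists (Num.min (eta / 2) (1 / 2 - s)); first by rewrite lt_min; lra.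
    move=> t /andP[t0 t1]; rewrite lt_min ltr_norml => /andP[/andP[h1 h2]].
    rewrite ltr_norml => /andP[h3 h4]; have -> : t <= 1 / 2 by lra.
    by apply: H; rewrite ?ltr_norml; lra.
  - have s01 : 0 <= 2 - 2 * s <= 1 by lra.
    have [eta eta0 H] := cg _ s01 _ e0.
    exists (Num.min (eta / 2) (s - 1 / 2)); first by rewrite lt_min; lra.
    move=> t /andP[t0 t1]; rewrite lt_min ltr_norml => /andP[/andP[h1 h2]].
    rewrite ltr_norml => /andP[h3 h4].
    have -> : (t <= 1 / 2) = false by apply/negbTE; rewrite -ltNge; lra.
    by apply: H; rewrite ?ltr_norml; lra.
  - have o01 : 0 <= (1 : R) <= 1 by lra.
    have [eta eta0 H] := cf _ o01 _ e0; have [eta' eta0' H'] := cg _ o01 _ e0.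
    exists (Num.min (eta / 2) (eta' / 2)); first by rewrite lt_min; lra.
    move=> t /andP[t0 t1]; rewrite lt_min !ltr_norml => /andP[/andP[h1 h2] /andP[h3 h4]].
    have -> : 2 * (1 / 2) = 1 :> R by lra.
    case: ifP => ht; first by apply: H; rewrite ?ltr_norml; lra.
    have := negbT ht; rewrite -ltNge => ht'.
    by rewrite fg1; apply: H'; rewrite ?ltr_norml; lra.
move=> s t; rewrite !in_itv /= /arc_cat => s01 t01.
case: (leP s (1 / 2)) => hs; case: (leP t (1 / 2)) => ht.
- move/jf; rewrite !in_itv /= => H.
  have e : 2 * s = 2 * t by apply: H; lra.
  lra.
- move/fg => H; have [e1 e2] : 2 * s = 1 /\ 2 - 2 * t = 1 by apply: H; lra.
  lra.
- move/esym/fg => H; have [e1 e2] : 2 * t = 1 /\ 2 - 2 * s = 1 by apply: H; lra.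
  lra.
- move/jg; rewrite !in_itv /= => H.
  have e : 2 - 2 * s = 2 - 2 * t by apply: H; lra.
  lra.
Qed.

(** Assigning to each edge a set of points that it owns replaces the comparison of arcs by the
    disjointness of these sets, which is easier to check for edges assembled from several pieces. *)
Lemma planar_of_regions (V : finType) (E : {set {set V}}) (pos : V -> R * R)
    (I : {set V} -> R * R -> Prop) : injective pos ->
  (forall e, e \in E -> exists g, arc g /\
     (exists u v, [/\ e = [set u; v]%SET, g 0 = pos u & g 1 = pos v]) /\
     (forall t, 0 < t < 1 -> I e (g t))) ->
  (forall e p v, I e p -> p <> pos v) ->
  (forall e f p, I e p -> I f p -> e = f) ->
  planar R E.
Proof.
move=> pinj arcs Iv Iuniq.
have /choice[gamma gP] : forall e, exists g, e \in E -> arc g /\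
     (exists u v, [/\ e = [set u; v]%SET, g 0 = pos u & g 1 = pos v]) /\
     (forall t, 0 < t < 1 -> I e (g t)).
  move=> e; case: (boolP (e \in E)) => [/arcs[g H]|_]; first by exists g.
  by exists (fun _ => (0, 0)).
exists pos, gamma; split=> //.
- by move=> e /gP[[? ?] [? _]].
- by move=> e t v /gP[_ [_ H]]; rewrite in_itv => /H/Iv; apply.
- move=> e f s t /gP[_ [_ H]] /gP[_ [_ H']] /eqP ef; rewrite !in_itv => /H s01 /H' t01 est.
  by apply: ef; apply: Iuniq s01 _; rewrite est.
Qed.

Section Pieces.
Variables (V1 V : finType) (h : V1 -> V) (E' : {set {set V1}}) (pos : V1 -> R * R)
  (gamma : {set V1} -> R -> R * R) (al be : R -> R * R) (pa pb : R * R) (a b : V1)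
  (ac bd : {set V}).
Hypotheses (D : plane_drawing E' pos gamma)
  (upper : forall e t, e \in E' -> 0 <= t <= 1 -> 0 < (gamma e t).2)
  (hal : half_arc E' pos gamma al pa a) (hbe : half_arc E' pos gamma be pb b)
  (albe : forall s t, 0 < s < 1 -> 0 < t < 1 -> al s <> be t).

(** The share of one open half plane in the edge [k] of the glued graph: a whole old edge, or the
    stub of a new one. *)
Definition piece (k : {set V}) (p : R * R) :=
  [\/ exists e t, [/\ e \in E', k = (h @: e)%SET, 0 < t < 1 & p = gamma e t],
      k = ac /\ (exists2 t, 0 < t < 1 & p = al t) |
      k = bd /\ (exists2 t, 0 < t < 1 & p = be t)].

Let weak (t : R) : 0 < t < 1 -> (0 <= t <= 1) /\ (0 <= t < 1).
Proof. by move=> /andP[/ltW-> t1]; rewrite ltW. Qed.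

Lemma piece_upper k p : piece k p -> 0 < p.2.
Proof.
have [_ _ ua _ _] := hal; have [_ _ ub _ _] := hbe.
by case=> [[e [t [eE _ /weak[? _] ->]]]|[_ [t /weak[_ ?] ->]]|[_ [t /weak[_ ?] ->]]];
  [apply: upper|apply: ua|apply: ub].
Qed.

Lemma piece_vertex k p v : piece k p -> p <> pos v.
Proof.
have [_ _ _ va _] := hal; have [_ _ _ vb _] := hbe; have [_ _ Dv _] := D.
by case=> [[e [t [eE _ t01 ->]]]|[_ [t t01 ->]]|[_ [t t01 ->]]];
  [apply: Dv; rewrite // in_itv|apply: va|apply: vb].
Qed.

Lemma piece_uniq k k' p : piece k p -> piece k' p -> k = k'.
Proof.
have [_ _ _ _ fa] := hal; have [_ _ _ _ fb] := hbe; have [_ _ _ Df] := D.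
case=> [[e [t [eE -> t01 ->]]]|[-> [t t01 ->]]|[-> [t t01 ->]]];
  case=> [[f [s [fE -> s01]]]|[-> [s s01]]|[-> [s s01]]] //.
- have [->//|ef] := eqVneq e f; move=> e'; exfalso.
  by apply: (Df e f t s) => //; rewrite in_itv.
- by move/esym/fa; case.
- by move/esym/fb; case.
- by move/fa; case.
- by move/albe; case.
- by move/fb; case.
- by move/esym/albe; case.
Qed.
End Pieces.

Definition flip (p : R * R) : R * R := (p.1, - p.2).

Lemma flipK : involutive flip.
Proof. by case=> x y; rewrite /flip /= opprK. Qed.

Lemma upper_neq_flip (p q : R * R) : 0 < p.2 -> 0 < q.2 -> p <> flip q.
Proof. by move=> h1 h2 e; move: h1; rewrite e /= oppr_gt0 ltNge ltW. Qed.

Lemma arc_flip g : arc g -> arc (fun t => flip (g t)).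
Proof.
move=> ag; apply: (arc_image (F := flip) ag) => [t _ eps e0|t t' _ _ /(can_inj flipK)//].
exists eps => // z' [h1 h2]; split=> //=.
by rewrite -opprD normrN.
Qed.

(** The second drawing is reflected into the lower half plane. The stubs at [a] and [c] meet at
    [(0, 0)], those at [b] and [d] at [(1, 0)], and the two half planes have nothing else in
    common. *)
Lemma planar_glue (V1 V2 V : finType) (h1 : V1 -> V) (h2 : V2 -> V)
    (E1 : {set {set V1}}) (a b : V1) (E2 : {set {set V2}}) (c d : V2) :
  injective h1 -> injective h2 -> (forall x y, h1 x <> h2 y) ->
  (forall v, (exists x, v = h1 x) \/ (exists y, v = h2 y)) ->
  a != b -> c != d -> [set a; b]%SET \in E1 -> [set c; d]%SET \in E2 ->
  planar R E1 -> planar R E2 -> planar R (glue_edges h1 h2 E1 a b E2 c d).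
Proof.
move=> i1 i2 dis cov ab cd abE cdE [pos1 [gamma1 D1]] [pos2 [gamma2 D2]].
have [p1 [g1 [al1 [be1 [{}D1 [vu1 fu1] ha1 hb1 ab1]]]]] := cut_edge D1 abE ab.
have [p2 [g2 [al2 [be2 [{}D2 [vu2 fu2] ha2 hb2 ab2]]]]] := cut_edge D2 cdE cd.
pose ac := [set h1 a; h2 c]%SET; pose bd := [set h1 b; h2 d]%SET.
have /choice[pos posP] : forall v, exists p, (forall x, v = h1 x -> p = p1 x) /\
    (forall y, v = h2 y -> p = flip (p2 y)).
  move=> v; case: (cov v) => [[x ->]|[y ->]].
    by exists (p1 x); split=> [x' /i1->//|y /dis].
  by exists (flip (p2 y)); split=> [x /esym/dis|y' /i2->//].
have pos1E x : pos (h1 x) = p1 x by have [H _] := posP (h1 x); apply: H.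
have pos2E y : pos (h2 y) = flip (p2 y) by have [_ H] := posP (h2 y); apply: H.
pose P1 := piece h1 (E1 :\ [set a; b])%SET g1 al1 be1 ac bd.
pose P2 := piece h2 (E2 :\ [set c; d])%SET g2 al2 be2 ac bd.
have up1 k p : P1 k p -> 0 < p.2 := @piece_upper _ _ h1 _ p1 g1 al1 be1 _ _ a b ac bd fu1 ha1 hb1 k p.
have up2 k p : P2 k p -> 0 < p.2 := @piece_upper _ _ h2 _ p2 g2 al2 be2 _ _ c d ac bd fu2 ha2 hb2 k p.
pose I k p := [\/ P1 k p, P2 k (flip p), k = ac /\ p = (0, 0) | k = bd /\ p = (1, 0)].
apply: (planar_of_regions (pos := pos) (I := I)).
- have [inj1 _ _ _] := D1; have [inj2 _ _ _] := D2.
  move=> u v; case: (cov u) => [[x ->]|[x ->]]; case: (cov v) => [[y ->]|[y ->]]; rewrite ?pos1E ?pos2E.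
  + by move/inj1->.
  + by move/(upper_neq_flip (vu1 x) (vu2 y)).
  + by move/esym/(upper_neq_flip (vu1 y) (vu2 x)).
  + by move/(can_inj flipK)/inj2->.
- have [_ De1 _ _] := D1; have [_ De2 _ _] := D2.
  have cat f g k x y z : k = [set h1 x; h2 y]%SET ->
      half_arc (E1 :\ [set a; b])%SET p1 g1 f z x -> half_arc (E2 :\ [set c; d])%SET p2 g2 g z y ->
      z.2 = 0 -> (forall t, 0 < t < 1 -> P1 k (f t)) -> (forall t, 0 < t < 1 -> P2 k (g t)) ->
      I k z -> exists g0, arc g0 /\
       (exists u v, [/\ k = [set u; v]%SET, g0 0 = pos u & g0 1 = pos v]) /\
       (forall t, 0 < t < 1 -> I k (g0 t)).
    move=> ek [af [f0 f1] fpos _ _] [ag [g0 g1'] gpos _ _] z0 If Ig Iz.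
    exists (arc_cat f (fun t => flip (g t))); split; [|split].
    + apply: arc_catP => //; first exact: arc_flip.
        by rewrite f1 g1' /flip z0 oppr0 -z0 -surjective_pairing.
      move=> s t /andP[s0 s1] /andP[t0 t1] est.
      have fs : 0 <= (f s).2.
        move: s1; rewrite le_eqVlt => /orP[/eqP->|s1]; first by rewrite f1 z0.
        by apply/ltW/fpos; rewrite s0.
      have gt : 0 <= (g t).2.
        move: t1; rewrite le_eqVlt => /orP[/eqP->|t1]; first by rewrite g1' z0.
        by apply/ltW/gpos; rewrite t0.
      split; apply/eqP; rewrite eq_le ?s1 ?t1 leNgt; apply/negP => lt1.
        by have := fpos s; rewrite s0 lt1 est /= => /(_ isT); lra.
      by have := gpos t; rewrite t0 lt1 => /(_ isT); move: fs; rewrite est /=; lra.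
    + exists (h1 x), (h2 y); split=> //.
        by rewrite pos1E /arc_cat mulr0 ifT // divr_ge0.
      rewrite pos2E /arc_cat ifF; last by apply/negbTE; rewrite -ltNge; lra.
      by rewrite mulr1 subrr g0.
    + move=> t t01; rewrite /arc_cat; have [lt|gt|->] := ltgtP t (1 / 2).
      * by constructor 1; apply: If; lra.
      * by constructor 2; rewrite flipK; apply: Ig; lra.
      * have -> : 2 * (1 / 2) = 1 :> R by lra.
        by rewrite f1.
  move=> k; rewrite !inE => /orP[/orP[/imsetP[e eE ->]|/imsetP[e eE ->]]|/orP[]/eqP->].
  + have [cg ig [u [v [ee gu gv]]]] := De1 _ eE; exists (g1 e); split=> //; split.
      by exists (h1 u), (h1 v); rewrite !pos1E gu gv {1}ee imsetU !imset_set1.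
    by move=> t t01; constructor 1; constructor 1; exists e, t.
  + have [cg ig [u [v [ee gu gv]]]] := De2 _ eE; exists (fun t => flip (g2 e t)).
    split; first exact: arc_flip; split.
      by exists (h2 u), (h2 v); rewrite !pos2E gu gv {1}ee imsetU !imset_set1.
    by move=> t t01; constructor 2; rewrite flipK; constructor 1; exists e, t.
  + apply: (cat al1 al2 ac a c (0, 0)) => //; last by constructor 3.
      by move=> t t01; constructor 2; split=> //; exists t.
    by move=> t t01; constructor 2; split=> //; exists t.
  + apply: (cat be1 be2 bd b d (1, 0)) => //; last by constructor 4.
      by move=> t t01; constructor 3; split=> //; exists t.
    by move=> t t01; constructor 3; split=> //; exists t.
- move=> k p v kp; case: (cov v) => [[x ->]|[x ->]]; rewrite ?pos1E ?pos2E => e.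
    case: kp => [kp|/up2 kp|[_ e']|[_ e']].
    + exact: (piece_vertex D1 ha1 hb1 kp e).
    + by apply: (upper_neq_flip (vu1 x) kp); rewrite flipK.
    + by have := vu1 x; rewrite -e e' /= ltxx.
    + by have := vu1 x; rewrite -e e' /= ltxx.
  case: kp => [/up1 kp|kp|[_ e']|[_ e']].
  + by apply: (upper_neq_flip kp (vu2 x)).
  + have e' : flip p = p2 x by rewrite e flipK.
    exact: (piece_vertex D2 ha2 hb2 kp e').
  + by have := vu2 x; rewrite -[p2 x]flipK -e e' /= oppr0 ltxx.
  + by have := vu2 x; rewrite -[p2 x]flipK -e e' /= oppr0 ltxx.
- move=> k k' p.
  case=> [kp|kp|[-> e]|[-> e]]; case=> [kp'|kp'|[-> e']|[-> e']] //.
  + exact: (piece_uniq D1 ha1 hb1 ab1 kp kp').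
  + by case: (upper_neq_flip (up1 _ _ kp) (up2 _ _ kp')); rewrite flipK.
  + by have := up1 _ _ kp; rewrite e' ltxx.
  + by have := up1 _ _ kp; rewrite e' ltxx.
  + by case: (upper_neq_flip (up1 _ _ kp') (up2 _ _ kp)); rewrite flipK.
  + exact: (piece_uniq D2 ha2 hb2 ab2 kp kp').
  + by have := up2 _ _ kp; rewrite e' /= oppr0 ltxx.
  + by have := up2 _ _ kp; rewrite e' /= oppr0 ltxx.
  + by have := up1 _ _ kp'; rewrite e ltxx.
  + by have := up2 _ _ kp'; rewrite e /= oppr0 ltxx.
  + by exfalso; move: e; rewrite e' => -[] /eqP; rewrite ?oner_eq0 // eq_sym oner_eq0.
  + by have := up1 _ _ kp'; rewrite e ltxx.
  + by have := up2 _ _ kp'; rewrite e /= oppr0 ltxx.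
  + by exfalso; move: e; rewrite e' => -[] /eqP; rewrite ?oner_eq0 // eq_sym oner_eq0.
Qed.

Lemma planar_pullback (V' V : finType) (h : V' -> V) (E : {set {set V}}) :
  injective h -> planar R E -> planar R [set e : {set V'} | (h @: e)%SET \in E]%SET.
Proof.
move=> hi [pos [gamma [pinj De Dv Df]]].
exists (fun v => pos (h v)), (fun e : {set V'} => gamma (h @: e)%SET); split.
- by move=> u v /pinj/hi.
- move=> e; rewrite inE => eE; have [? ? [u [v [ee gu gv]]]] := De _ eE; split=> //.
  have /imsetP[u' u'e eu] : u \in (h @: e)%SET by rewrite ee !inE eqxx.
  have /imsetP[v' v'e ev] : v \in (h @: e)%SET by rewrite ee !inE eqxx orbT.
  exists u', v'; rewrite -eu -ev; split=> //.
  by apply: (imset_inj hi); rewrite ee imsetU !imset_set1 eu ev.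
- by move=> e t v; rewrite inE => eE; apply: Dv.
- move=> e f s t; rewrite !inE => eE fE ef; apply: Df => //.
  by apply: contraNneq ef => /(imset_inj hi) ->.
Qed.
End Glue.

(** * Rooted regular graphs and supermultiplicativity *)

Section Graphs.
Variable V : finType.
Implicit Types (E : {set {set V}}) (u v w x y : V).

Definition adj E : rel V := fun u v => [set u; v] \in E.
Definition connected_graph E := [forall u, forall v, connect (adj E) u v].

Lemma adj_sym E : symmetric (adj E).
Proof. by move=> u v; rewrite /adj finset.setUC. Qed.

Lemma connect_adj_sym E : connect_sym (adj E).
Proof. exact/sym_connect_sym/adj_sym. Qed.

Lemma simple_adj E u v : simple_graph E -> adj E u v -> u != v.
Proof. by move=> Es /(forall_inP Es); rewrite cards2; case: (u != v). Qed.

Lemma simple_edgeP E (e : {set V}) : simple_graph E -> e \in E ->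
  exists u v, u != v /\ e = [set u; v].
Proof. by move=> Es /(forall_inP Es)/cards2P. Qed.

Lemma set2_inj v u u' : u != v -> [set v; u] = [set v; u'] -> u = u'.
Proof.
move=> uv /setP/(_ u); rewrite !inE eqxx orbT (negbTE uv) /= => /esym/eqP.
by [].
Qed.

Lemma set2_eqP u v x y : [set u; v] = [set x; y] ->
  (u = x /\ v = y) \/ (u = y /\ v = x).
Proof.
move=> e; have := finset.set21 u v; have := finset.set22 u v.
have := finset.set21 x y; have := finset.set22 x y.
rewrite -{1 2}e {3 4}e !inE.
case/orP=> /eqP e1; case/orP=> /eqP e2; case/orP=> /eqP e3; case/orP=> /eqP e4;
  subst; auto.
Qed.

Lemma degree_adj E v : simple_graph E -> degree E v = #|[set u | adj E v u]|.
Proof.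
move=> Es; rewrite /degree.
rewrite -(card_in_imset (f := fun u => [set v; u]) (D := [set u | adj E v u])).
  apply: eq_card => e; rewrite inE; apply/andP/imsetP => [[eE ve]|[u]].
    have [x [y [xy ee]]] := simple_edgeP Es eE; move: ve; rewrite ee !inE => /orP[]/eqP ev.
      by exists y; rewrite ?inE /adj ?ev -?ee.
    by exists x; rewrite ?inE /adj ev finset.setUC -?ee // finset.setUC.
  by rewrite inE => vu ->; rewrite !inE eqxx.
move=> u u'; rewrite !inE => /(simple_adj Es) vu _; apply: set2_inj.
by rewrite eq_sym.
Qed.

Lemma simple_graph_eq E E' : simple_graph E -> simple_graph E' -> adj E =2 adj E' -> E = E'.
Proof.
move=> Es Es' H; apply/setP => e; apply/idP/idP => eE.
  by have [u [v [_ ee]]] := simple_edgeP Es eE; have := H u v; rewrite /adj -ee eE => <-.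
by have [u [v [_ ee]]] := simple_edgeP Es' eE; have := H u v; rewrite /adj -ee eE => ->.
Qed.

Lemma connect_crossing (r : rel V) (P : pred V) x y :
  connect r x y -> P x -> ~~ P y ->
  exists p q, [/\ connect r x p, r p q, P p & ~~ P q].
Proof.
move=> /connectP[s]; elim: s x => [|z s IH] x /= => [_ -> Px /negP//|/andP[xz zs] ly Px Py].
have [Pz|Pz] := boolP (P z); last by exists x, z; split=> //; apply: connect0.
have [p [q [zp pq Pp Pq]]] := IH z zs ly Pz Py.
by exists p, q; split=> //; apply: connect_trans zp; apply: connect1.
Qed.

Lemma connected_delete E a b : connected_graph E -> connect (adj (E :\ [set a; b])) a b ->
  connected_graph (E :\ [set a; b]).
Proof.
move=> /forallP cE ab; apply/forallP => u; apply/forallP => v.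
have /forallP/(_ v) := cE u; apply: connect_sub => x y xy.
have [e|ne] := eqVneq [set x; y] [set a; b]; last by apply: connect1; apply/setD1P.
by case: (set2_eqP e) => -[-> ->]; rewrite // connect_adj_sym.
Qed.

(* Otherwise every edge is a bridge; among the components of [E - uv]
   containing [v], over all edges [uv], a smallest one yields a smaller one. *)
Lemma exists_nonbridge E (v0 : V) : simple_graph E -> (forall v, 1 < degree E v) ->
  exists a b, adj E a b /\ connect (adj (E :\ [set a; b])) a b.
Proof.
move=> Es deg.
have [//|no] := pselect (exists a b, adj E a b /\ connect (adj (E :\ [set a; b])) a b).
pose side (p : V * V) := [set x | connect (adj (E :\ [set p.1; p.2])) p.2 x].
have nbr v u : exists2 w, adj E v w & w != u.
  have := deg v; rewrite degree_adj // => /card_gt1P[x [y [xv yv xy]]].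
  rewrite !inE in xv yv; have [xu|xu] := eqVneq x u; last by exists x.
  by exists y => //; rewrite -xu eq_sym.
have [w0 vw0 _] := nbr v0 v0.
have [[u v] /= uv umin] : exists2 p, adj E p.1 p.2 & forall q, adj E q.1 q.2 -> #|side p| <= #|side q|.
  case: (@arg_minnP _ (v0, w0) (fun p => adj E p.1 p.2) (fun p => #|side p|) vw0) => p pE pm.
  by exists p.
have [w vw wu] := nbr v u.
have br : ~ connect (adj (E :\ [set v; w])) w v.
  by rewrite connect_adj_sym => H; apply: no; exists v, w.
have : #|side (v, w)| < #|side (u, v)|; last by rewrite ltnNge (umin (v, w) vw).
apply: proper_card; apply/properP; split; last first.
  by exists v; rewrite !inE ?connect0 //; apply/negP.
apply/fintype.subsetP => x; rewrite !inE /= => wx; apply: contraT => nx.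
have [|p [q [wp pq Pp Pq]]] := @connect_crossing _ (connect (adj (E :\ [set u; v])) v) _ _ wx _ nx.
  apply/connect1/setD1P; split=> //; apply/eqP => /set2_eqP[[e1 e2]|[e1 e2]].
    by move: (simple_adj Es uv); rewrite e1 eqxx.
  by rewrite e2 eqxx in wu.
have [e|ne] := eqVneq [set p; q] [set u; v].
  case: br; case: (set2_eqP e) => -[e1 e2]; last by move: wp; rewrite e1.
  by apply: connect_trans wp _; apply: connect1; move: pq; rewrite e2.
case/negP: Pq; apply: connect_trans Pp _; apply: connect1.
by apply/setD1P; split=> //; move/setD1P: pq => [].
Qed.

End Graphs.

(** * Degrees, connectedness and recovery after gluing *)

Section GlueCombinatorics.
Variables (V1 V2 V : finType) (h1 : V1 -> V) (h2 : V2 -> V).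
Hypotheses (i1 : injective h1) (i2 : injective h2) (dis : forall x y, h1 x <> h2 y)
  (cov : forall v, (exists x, v = h1 x) \/ (exists y, v = h2 y)).
Variables (E1 : {set {set V1}}) (a b : V1) (E2 : {set {set V2}}) (c d : V2).
Let K := glue_edges h1 h2 E1 a b E2 c d.

Lemma glue_edges_sym : glue_edges h2 h1 E2 c d E1 a b = K.
Proof.
rewrite /K /glue_edges [X in X :|: _]finset.setUC.
by rewrite [[set h2 c; _]]finset.setUC [[set h2 d; _]]finset.setUC.
Qed.

Lemma imset_set2 (T T' : finType) (h : T -> T') x y : h @: [set x; y] = [set h x; h y].
Proof. by rewrite imsetU !imset_set1. Qed.

Lemma glue_adj11 x y : adj K (h1 x) (h1 y) = adj (E1 :\ [set a; b]) x y.
Proof.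
rewrite /adj /K /glue_edges; apply/idP/idP => [|xy].
  rewrite finset.in_setU => /orP[/finset.setUP[]|/finset.set2P[]].
  - by case/imsetP=> e eE; rewrite -imset_set2 => /(imset_inj i1) ->.
  - case/imsetP=> e _ ee; have : h1 x \in h2 @: e by rewrite -ee finset.set21.
    by case/imsetP=> z _ /dis.
  - by move/set2_eqP => -[[_ /dis]|[/dis]].
  - by move/set2_eqP => -[[_ /dis]|[/dis]].
by rewrite !finset.in_setU -imset_set2 (imset_f (fun e : {set V1} => h1 @: e)).
Qed.

Lemma glue_adj12 x y : adj K (h1 x) (h2 y) = (x == a) && (y == c) || (x == b) && (y == d).
Proof.
rewrite /adj /K /glue_edges; apply/idP/idP => [|].
  rewrite finset.in_setU => /orP[/finset.setUP[]|/finset.set2P[]].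
  - case/imsetP=> e _ ee; have : h2 y \in h1 @: e by rewrite -ee finset.set22.
    by case/imsetP=> z _ /esym/dis.
  - case/imsetP=> e _ ee; have : h1 x \in h2 @: e by rewrite -ee finset.set21.
    by case/imsetP=> z _ /dis.
  - by move/set2_eqP => -[[/i1-> /i2->]|[/dis//]]; rewrite !eqxx.
  - by move/set2_eqP => -[[/i1-> /i2->]|[/dis//]]; rewrite !eqxx orbT.
by case/orP=> /andP[/eqP-> /eqP->]; rewrite finset.in_setU !inE eqxx ?orbT.
Qed.

Hypotheses (Es1 : simple_graph E1) (Es2 : simple_graph E2).
Hypotheses (abE : adj E1 a b) (cdE : adj E2 c d).

Lemma glue_simple : simple_graph K.
Proof.
apply/forall_inP => e /finset.setUP[/finset.setUP[]|/finset.set2P[]->].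
- by case/imsetP=> f /setD1P[_ /(forall_inP Es1)] cf ->; rewrite card_imset.
- by case/imsetP=> f /setD1P[_ /(forall_inP Es2)] cf ->; rewrite card_imset.
- by rewrite cards2 (_ : h1 a != h2 c) //; apply/eqP/dis.
- by rewrite cards2 (_ : h1 b != h2 d) //; apply/eqP/dis.
Qed.

(** The ends [a] and [b] of the deleted edge lose one neighbour each and gain one on the other side;
    every other neighbourhood is unchanged. *)
Lemma glue_degree1 x : degree K (h1 x) = degree E1 x.
Proof.
have ab := simple_adj Es1 abE; rewrite !degree_adj //; last exact: glue_simple.
pose N1 := [set y | adj (E1 :\ [set a; b]) x y].
pose N2 := [set y | (x == a) && (y == c) || (x == b) && (y == d)].
have -> : [set u | adj K (h1 x) u] = h1 @: N1 :|: h2 @: N2.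
  apply/setP => u; rewrite inE finset.in_setU; case: (cov u) => -[y ->].
    rewrite glue_adj11 (mem_imset _ _ i1) inE; case: imsetP => [[z _ /dis//]|_].
    by rewrite orbF.
  rewrite glue_adj12 (mem_imset _ _ i2) [_ \in N2]inE; case: imsetP => // -[z _ /esym/dis//].
rewrite cardsU; have -> : h1 @: N1 :&: h2 @: N2 = finset.set0.
  by apply/setP => u; rewrite !inE; apply/negbTE/andP => -[/imsetP[y _ ->] /imsetP[z _ /dis]].
rewrite cards0 subn0 !card_imset //.
have other y : x != a -> x != b -> adj (E1 :\ [set a; b]) x y = adj E1 x y.
  move=> xa xb; rewrite /adj finset.in_setD1; case: eqP => //= e.
  by case: (set2_eqP e) => -[e1 _]; rewrite e1 eqxx in xa xb.
have [xa|xa] := eqVneq x a.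
  have -> : N2 = [set c] by apply/setP => y; rewrite !inE xa eqxx (negbTE ab) /= orbF.
  rewrite cards1 addn1 [RHS](cardsD1 b) inE xa abE /= add1n; congr _.+1.
  apply: eq_card => y; rewrite !inE xa /adj finset.in_setD1; congr (~~ _ && _).
  by apply/eqP/eqP => [/set2_eqP[[_ ->]|[e _]]//|->//]; rewrite e eqxx in ab.
have [xb|xb] := eqVneq x b.
  have -> : N2 = [set d] by apply/setP => y; rewrite !inE xb eqxx eq_sym (negbTE ab).
  rewrite cards1 addn1 [RHS](cardsD1 a) inE xb adj_sym abE /= add1n; congr _.+1.
  apply: eq_card => y; rewrite !inE xb /adj finset.in_setD1; congr (~~ _ && _).
  by apply/eqP/eqP => [/set2_eqP[[e _]|[_ ->]]//|->]; [rewrite e eqxx in ab|rewrite finset.setUC].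
have -> : N2 = finset.set0 by apply/setP => y; rewrite !inE (negbTE xa) (negbTE xb).
rewrite cards0 addn0; apply: eq_card => y.
by rewrite !inE other.
Qed.
End GlueCombinatorics.

Section GlueConnected.
Variables (V1 V2 V : finType) (h1 : V1 -> V) (h2 : V2 -> V).
Hypotheses (i1 : injective h1) (i2 : injective h2) (dis : forall x y, h1 x <> h2 y)
  (cov : forall v, (exists x, v = h1 x) \/ (exists y, v = h2 y)).
Variables (E1 : {set {set V1}}) (a b : V1) (E2 : {set {set V2}}) (c d : V2).
Hypotheses (ab : a != b) (cE1 : connected_graph (E1 :\ [set a; b]))
  (cE2 : connected_graph (E2 :\ [set c; d])).
Let K := glue_edges h1 h2 E1 a b E2 c d.
Let K' := K :\ [set h1 a; h2 c].

(** Both halves remain connected and the edge from [b] to [d] still joins them, so the new root edge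
    is no bridge and gluing can be iterated. *)
Lemma glue_connected_root : connected_graph K'.
Proof.
have s1 x y : connect (adj K') (h1 x) (h1 y).
  have /forallP/(_ x)/forallP/(_ y) := cE1; move/connectP => [s + ->].
  elim: s x => [|z s IH] x /=; first by rewrite connect0.
  case/andP=> xz /IH; apply: connect_trans; apply/connect1/setD1P; split.
    by apply/eqP => /set2_eqP[[_ /dis]|[/dis]].
  by have := glue_adj11 i1 dis E1 a b E2 c d x z; rewrite /adj => ->.
have s2 x y : connect (adj K') (h2 x) (h2 y).
  have /forallP/(_ x)/forallP/(_ y) := cE2; move/connectP => [s + ->].
  elim: s x => [|z s IH] x /=; first by rewrite connect0.
  case/andP=> xz /IH; apply: connect_trans; apply/connect1/setD1P; split.
    by apply/eqP => /set2_eqP[[/esym/dis]|[_ /esym/dis]].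
  have := glue_adj11 i2 (fun x y => nesym (@dis y x)) E2 c d E1 a b x z.
  by rewrite /adj glue_edges_sym => ->.
have bd : connect (adj K') (h1 b) (h2 d).
  apply/connect1/setD1P; split.
    by apply/eqP => /set2_eqP[[/i1 e _]|[/dis]//]; move: ab; rewrite e eqxx.
  by rewrite !inE eqxx !orbT.
have s12 x y : connect (adj K') (h1 x) (h2 y).
  exact: connect_trans (s1 x b) (connect_trans bd (s2 d y)).
apply/forallP => u; apply/forallP => v.
case: (cov u) => -[x ->]; case: (cov v) => -[y ->] //.
by rewrite connect_adj_sym.
Qed.

Lemma glue_connected : connected_graph K.
Proof.
apply/forallP => u; apply/forallP => v.
have /forallP/(_ u)/forallP/(_ v) := glue_connected_root.
by apply: connect_sub => x y /setD1P[_ xy]; apply: connect1.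
Qed.
End GlueConnected.

(* The vertex set of the first graph is determined by its size: it contains
   [root] but not [root'], induces a connected graph, as does its complement,
   and apart from the edge joining [root] to [root'] only one edge leaves it. *)
Lemma two_edge_cut_unique (V : finType) (r : rel V) (S S' : {set V}) (root root' b' d' : V) :
  #|S| = #|S'| -> root \in S -> root \in S' -> root' \notin S -> root' \notin S' ->
  (forall v, v \in S -> connect [rel x y | [&& r x y, x \in S & y \in S]] root v) ->
  (forall v, v \notin S -> connect [rel x y | [&& r x y, x \notin S & y \notin S]] root' v) ->
  (forall x y, r x y = r y x) ->
  (forall x y, r x y -> x \in S' -> y \notin S' -> (x = root /\ y = root') \/ (x = b' /\ y = d')) ->
  S = S'.
Proof.
move=> cS rS rS' r'S r'S' conS conS' rs cut.
apply/eqP; rewrite eqEcard cS leqnn andbT; apply: contraT => /subsetPn[u uS uS'].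
have [w wS' wS] : exists2 w, w \in S' & w \notin S.
  apply/subsetPn; apply: contra uS' => sub.
  suff -> : S' = S by [].
  by apply/eqP; rewrite eqEcard sub cS leqnn.
have [p [q [_ /and3P[pq pS qS] pS' qS']]] := connect_crossing (P := mem S') (conS _ uS) rS' uS'.
have bS : b' \in S.
  by case: (cut _ _ pq pS' qS') => -[ep eq]; [move: r'S; rewrite -eq qS|rewrite -ep].
have [|q2 [p2 [_ /and3P[qp2 q2S p2S] q2S' p2S']]] :=
  connect_crossing (P := [predC S']) (conS' _ wS) r'S'; first by rewrite /= wS'.
rewrite /= negbK in p2S'; rewrite /= rs in qp2.
case: (cut _ _ qp2 p2S' q2S') => -[ep eq]; first by move: p2S; rewrite ep rS.
by move: p2S; rewrite ep bS.
Qed.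

Section RegularPlanarGraphs.
Variables (R : realType) (D : nat).

Definition regular_planar n := planar_graphs R n D D.
Definition connected_regular n := [set E in regular_planar n | connected_graph E].
Definition rooted_regular n : {set {set {set 'I_n}} * ('I_n * 'I_n)} :=
  [set x | [&& x.1 \in connected_regular n, adj x.1 x.2.1 x.2.2 &
     connect (adj (x.1 :\ [set x.2.1; x.2.2])) x.2.1 x.2.2]].

Lemma regular_planarP n (E : {set {set 'I_n}}) : reflect
  [/\ simple_graph E, planar R E & forall v, degree E v = D] (E \in regular_planar n).
Proof.
rewrite inE; apply: (iffP and3P) => -[Es Ep Ed]; split=> //.
- exact/asboolP.
- by move=> v; have /forallP/(_ v) := Ed; rewrite -eqn_leq => /eqP.
- exact/asboolP.
- by apply/forallP => v; rewrite Ed leqnn.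
Qed.

Lemma connected_regularP n (E : {set {set 'I_n}}) :
  reflect (E \in regular_planar n /\ connected_graph E) (E \in connected_regular n).
Proof. by rewrite [X in reflect _ X]finset.in_set; apply: andP. Qed.

Lemma rooted_regularP n (E : {set {set 'I_n}}) a b : reflect
  [/\ E \in regular_planar n, connected_graph E, adj E a b &
     connect (adj (E :\ [set a; b])) a b] ((E, (a, b)) \in rooted_regular n).
Proof.
rewrite [X in reflect _ X]finset.in_set /=; apply: (iffP and3P) => [[/connected_regularP[? ?]]|[? ?]] //.
by split=> //; apply/connected_regularP.
Qed.

Lemma enum_subset n i (S : {set 'I_n}) : #|S| = i ->
  exists h : 'I_i -> 'I_n, injective h /\ forall v, v \in S <-> exists x, v = h x.
Proof.
move=> e; exists (fun k => enum_val (cast_ord (esym e) k)); split.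
  by move=> x y /enum_val_inj/cast_ord_inj.
move=> v; split=> [vS|[x ->]]; last exact: enum_valP.
by exists (cast_ord e (enum_rank_in vS v)); rewrite cast_ordK enum_rankK_in.
Qed.

Lemma rooted_glue i j n (h1 : 'I_i -> 'I_n) (h2 : 'I_j -> 'I_n) x y :
  injective h1 -> injective h2 -> (forall x y, h1 x <> h2 y) ->
  (forall v, (exists x, v = h1 x) \/ (exists y, v = h2 y)) ->
  x \in rooted_regular i -> y \in rooted_regular j ->
  (glue_edges h1 h2 x.1 x.2.1 x.2.2 y.1 y.2.1 y.2.2, (h1 x.2.1, h2 y.2.1)) \in rooted_regular n.
Proof.
move=> i1 i2 dis cov; case: x y => [E1 [a b]] [E2 [c d]].
move=> /rooted_regularP[/regular_planarP[Es1 Ep1 Ed1] c1 ab cab].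
move=> /rooted_regularP[/regular_planarP[Es2 Ep2 Ed2] c2 cd ccd].
have abn := simple_adj Es1 ab; have cdn := simple_adj Es2 cd.
have c1' := connected_delete c1 cab; have c2' := connected_delete c2 ccd.
apply/rooted_regularP; split.
- apply/regular_planarP; split.
  + exact: glue_simple.
  + exact: planar_glue.
  + move=> v; case: (cov v) => -[x ->]; first by rewrite glue_degree1.
    rewrite -glue_edges_sym glue_degree1 // => [x' y' /esym/dis//|v'].
    by case: (cov v'); [right|left].
- exact: (glue_connected i1 i2 dis cov abn c1' c2').
- by rewrite /adj !inE eqxx orbT.
- have /forallP/(_ (h1 a))/forallP/(_ (h2 c)) := glue_connected_root i1 i2 dis cov abn c1' c2'.
  by [].
Qed.

(** The binomial coefficient counts the label sets of the first graph, so the point is injectivity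
    of gluing. [two_edge_cut_unique] recovers the set and the new root recovers [a] and [c]; the
    other crossing edge then gives [b] and [d], and the two sides give back both graphs, whose
    deleted edges are now known. *)
Lemma supermultiplicative i j :
  'C(i + j, i) * #|rooted_regular i| * #|rooted_regular j| <= #|rooted_regular (i + j)|.
Proof.
set n := i + j.
have /choice[f fP] : forall S : {set 'I_n}, exists h : 'I_i -> 'I_n, #|S| = i ->
    injective h /\ forall v, v \in S <-> exists x, v = h x.
  move=> S; case: (eqVneq #|S| i) => [/enum_subset[h H]|/eqP ne]; first by exists h.
  (* An arbitrary map for sets of the wrong size. *)
  by exists (fun k => lshift j k).
have /choice[g gP] : forall S : {set 'I_n}, exists h : 'I_j -> 'I_n, #|S| = i ->
    injective h /\ forall v, v \notin S <-> exists x, v = h x.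
  move=> S; case: (eqVneq #|S| i) => [cS|/eqP ne]; last by exists (fun k => rshift i k).
  have cC : #|~: S| = j by have := cardsC S; rewrite cS card_ord /n => /addnI.
  have [h [hi hS]] := enum_subset cC; exists h => _; split=> // v.
  by rewrite -hS inE.
pose dom := finset.setX [set S : {set 'I_n} | #|S| == i]
  (finset.setX (rooted_regular i) (rooted_regular j)).
have -> : 'C(n, i) * #|rooted_regular i| * #|rooted_regular j| = #|dom|.
  by rewrite /dom !finset.cardsX mulnA -[n in 'C(n, _)]card_ord card_draws.
pose Phi (q : {set 'I_n} * (({set {set 'I_i}} * ('I_i * 'I_i)) * ({set {set 'I_j}} * ('I_j * 'I_j)))) :=
  let: (A, (x, y)) := q in
  (glue_edges (f A) (g A) x.1 x.2.1 x.2.2 y.1 y.2.1 y.2.2, (f A x.2.1, g A y.2.1)).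
have dis (S : {set 'I_n}) : #|S| = i -> forall x y, f S x <> g S y.
  move=> cS x y e; have [_ fS] := fP S cS; have [_ gS] := gP S cS.
  have h1 : f S x \in S by apply/fS; exists x.
  by have : f S x \notin S; [apply/gS; exists y|rewrite h1].
have cov (S : {set 'I_n}) : #|S| = i -> forall v, (exists x, v = f S x) \/ (exists y, v = g S y).
  move=> cS v; have [_ fS] := fP S cS; have [_ gS] := gP S cS.
  by case: (boolP (v \in S)) => [/fS|/gS]; [left|right].
have domP (S : {set 'I_n}) x y : (S, (x, y)) \in dom ->
    [/\ #|S| = i, x \in rooted_regular i & y \in rooted_regular j].
  rewrite !finset.in_setX => /and3P[cS xR yR]; split=> //; apply/eqP.
  by move: cS; rewrite inE.
have Phi_in q : q \in dom -> Phi q \in rooted_regular n.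
  case: q => S [x y] /domP[cS xR yR].
  have [fi _] := fP S cS; have [gi _] := gP S cS.
  exact: (rooted_glue fi gi (dis S cS) (cov S cS)).
suff Phi_inj : {in dom &, injective Phi}.
  rewrite -(card_in_imset Phi_inj); apply/subset_leq_card/fintype.subsetP => _ /imsetP[q qd ->].
  exact: Phi_in.
move=> [S [[E1 [a b]] [E2 [c d]]]] [S' [[E1' [a' b']] [E2' [c' d']]]].
move=> /domP[cS /rooted_regularP[/regular_planarP[Es1 _ _] c1 ab cab]
  /rooted_regularP[/regular_planarP[Es2 _ _] c2 cd ccd]].
move=> /domP[cS' /rooted_regularP[/regular_planarP[Es1' _ _] _ ab' _]
  /rooted_regularP[/regular_planarP[Es2' _ _] _ cd' _]].
have [fi fS] := fP S cS; have [gi gS] := gP S cS.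
have [fi' fS'] := fP S' cS'; have [gi' gS'] := gP S' cS'.
case=> eK ea ec.
have disS := dis S cS; have disS' := dis S' cS'.
have disS2 x y : g S x <> f S y by move/esym/disS.
have A11 x y : adj (glue_edges (f S) (g S) E1 a b E2 c d) (f S x) (f S y) = adj (E1 :\ [set a; b]) x y.
  exact: glue_adj11.
have A22 x y : adj (glue_edges (f S) (g S) E1 a b E2 c d) (g S x) (g S y) = adj (E2 :\ [set c; d]) x y.
  by rewrite -glue_edges_sym glue_adj11.
have eS : S = S'.
  apply: (@two_edge_cut_unique _ (adj (glue_edges (f S) (g S) E1 a b E2 c d)) S S'
    (f S a) (g S c) (f S' b') (g S' d')).
  - by rewrite cS cS'.
  - by apply/fS; exists a.
  - by apply/fS'; exists a'.
  - by apply/gS; exists c.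
  - by apply/gS'; exists c'.
  - move=> v /fS[y ->]; have := connected_delete c1 cab.
    move=> /forallP/(_ a)/forallP/(_ y)/connectP[s + ->].
    suff H x : path (adj (E1 :\ [set a; b])) x s -> connect [rel x y | [&&
        adj (glue_edges (f S) (g S) E1 a b E2 c d) x y, x \in S & y \in S]]
        (f S x) (f S (last x s)) by apply: H.
    elim: s x => [|z s IH] x /=; first by rewrite connect0.
    case/andP=> xz /IH; apply: connect_trans; apply/connect1 => /=; rewrite A11 xz /=.
    by apply/andP; split; apply/fS; [exists x|exists z].
  - move=> v /gS[y ->]; have := connected_delete c2 ccd.
    move=> /forallP/(_ c)/forallP/(_ y)/connectP[s + ->].
    suff H x : path (adj (E2 :\ [set c; d])) x s -> connect [rel x y | [&&
        adj (glue_edges (f S) (g S) E1 a b E2 c d) x y, x \notin S & y \notin S]]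
        (g S x) (g S (last x s)) by apply: H.
    elim: s x => [|z s IH] x /=; first by rewrite connect0.
    case/andP=> xz /IH; apply: connect_trans; apply/connect1 => /=; rewrite A22 xz /=.
    by apply/andP; split; apply/gS; [exists x|exists z].
  - exact: adj_sym.
  - move=> x y; rewrite eK => + /fS'[x' ex] /gS'[y' ey]; rewrite ex ey glue_adj12 //.
    by case/orP=> /andP[/eqP-> /eqP->]; [left; rewrite ea ec|right].
subst S'; have {}ea := fi _ _ ea; have {}ec := gi _ _ ec; subst a' c'.
have [ebb edd] : b = b' /\ d = d'.
  have : adj (glue_edges (f S) (g S) E1 a b E2 c d) (f S b) (g S d).
    by rewrite glue_adj12 // !eqxx orbT.
  rewrite eK glue_adj12 // => /orP[]/andP[/eqP e1 /eqP e2]; last by [].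
  by move: (simple_adj Es1 ab); rewrite e1 eqxx.
subst b' d'.
have E11 : E1 = E1'.
  apply: simple_graph_eq => // x y.
  have [e|ne] := eqVneq [set x; y] [set a; b]; first by rewrite /adj e -/(adj E1 a b) ab -/(adj E1' a b) ab'.
  have := A11 x y; rewrite eK glue_adj11 //.
  by rewrite /adj !finset.in_setD1 ne.
have E22 : E2 = E2'.
  apply: simple_graph_eq => // x y.
  have [e|ne] := eqVneq [set x; y] [set c; d]; first by rewrite /adj e -/(adj E2 c d) cd -/(adj E2' c d) cd'.
  have := A22 x y; rewrite eK -glue_edges_sym glue_adj11 //.
  by rewrite /adj !finset.in_setD1 ne.
by rewrite E11 E22.
Qed.

Lemma rooted_le n : #|rooted_regular n| <= #|regular_planar n| * (n * n).
Proof.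
apply: (@leq_trans #|finset.setX (regular_planar n) [set: 'I_n * 'I_n]|); last first.
  by rewrite finset.cardsX cardsT card_prod card_ord.
apply/subset_leq_card/fintype.subsetP => -[E [a b]] /rooted_regularP[EP _ _ _].
by rewrite finset.in_setX EP finset.in_setT.
Qed.

(** Every such graph has a non-bridge, so forgetting the root is onto. The order is positive because
    the empty graph is connected but has no root. *)
Lemma connected_le_rooted n : 1 < D -> #|connected_regular n.+1| <= #|rooted_regular n.+1|.
Proof.
move=> D1; apply: leq_trans (leq_imset_card fst (rooted_regular n.+1)).
apply/subset_leq_card/fintype.subsetP => E.
move=> /connected_regularP[EP cE]; have /regular_planarP[Es _ Ed] := EP.
have [|a [b [ab cab]]] := exists_nonbridge ord0 Es; first by move=> v; rewrite Ed.
by apply/imsetP; exists (E, (a, b)) => //; apply/rooted_regularP.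
Qed.
End RegularPlanarGraphs.

(** * Decomposition at the component of a vertex *)

Section ComponentRecursion.
Variables (R : realType) (D : nat).

Definition pullback (V' V : finType) (h : V' -> V) (E : {set {set V}}) : {set {set V'}} :=
  [set e | h @: (e : {set V'}) \in E].

Lemma adj_pullback (V' V : finType) (h : V' -> V) (E : {set {set V}}) x y :
  adj (pullback h E) x y = adj E (h x) (h y).
Proof. by rewrite /adj inE imset_set2. Qed.

Lemma pullback_regular i n (h : 'I_i -> 'I_n) E : injective h ->
  (forall x w, adj E (h x) w -> exists y, w = h y) ->
  E \in regular_planar R D n -> pullback h E \in regular_planar R D i.
Proof.
move=> hi closed /regular_planarP[Es Ep Ed].
have Ps : simple_graph (pullback h E).
  by apply/forall_inP => e; rewrite inE => /(forall_inP Es); rewrite card_imset.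
apply/regular_planarP; split=> //; first exact: planar_pullback.
move=> x; rewrite -(Ed (h x)) !degree_adj // -(card_imset _ hi).
apply: eq_card => w; rewrite [RHS]inE; apply/imsetP/idP => [[y]|xw].
  by rewrite inE adj_pullback => xy ->.
by have [y ey] := closed _ _ xw; exists y; rewrite // inE adj_pullback -ey.
Qed.

Definition component n (E : {set {set 'I_n}}) v := [set w | connect (adj E) v w].

(** No edge leaves the component [S], so a graph is determined by its restrictions to [S] and to the
    complement, and both restrictions keep all degrees. *)
Lemma component_count n (v : 'I_n) (S : {set 'I_n}) :
  #|[set E in regular_planar R D n | component E v == S]| <=
  #|connected_regular R D #|S| | * #|regular_planar R D (n - #|S|)|.
Proof.
have [f [fi fS]] := enum_subset (erefl #|S|).
have cC : #|~: S| = n - #|S| by have := cardsC S; rewrite card_ord; lia.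
have [g [gi gS]] := enum_subset cC.
have inC (E : {set {set 'I_n}}) : E \in [set E in regular_planar R D n | component E v == S] ->
    E \in regular_planar R D n /\ component E v = S.
  by rewrite finset.in_set => /andP[EP /eqP eS]; split.
have memS (E : {set {set 'I_n}}) w : component E v = S -> (w \in S) = connect (adj E) v w.
  by move=> <-; rewrite inE.
have closed (E : {set {set 'I_n}}) w w' : component E v = S -> adj E w w' -> (w \in S) = (w' \in S).
  move=> eS ww'; rewrite !(memS E) //; apply/idP/idP => vw.
    by apply: connect_trans vw (connect1 ww').
  by apply: connect_trans vw (connect1 _); rewrite adj_sym.
pose Phi (E : {set {set 'I_n}}) := (pullback f E, pullback g E).
rewrite -finset.cardsX -(card_in_imset (f := Phi)); last first.
  move=> E E' /inC[/regular_planarP[Es _ _] eS] /inC[/regular_planarP[Es' _ _] eS'] [ef eg].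
  apply: simple_graph_eq => // p q.
  case: (boolP (p \in S)) => pS; case: (boolP (q \in S)) => qS.
  - have [x ->] := (fS p).1 pS; have [y ->] := (fS q).1 qS.
    by rewrite -!(adj_pullback f) ef.
  - apply/idP/idP => pq.
      by have := closed _ _ _ eS pq; rewrite pS (negbTE qS).
    by have := closed _ _ _ eS' pq; rewrite pS (negbTE qS).
  - apply/idP/idP => pq.
      by have := closed _ _ _ eS pq; rewrite qS (negbTE pS).
    by have := closed _ _ _ eS' pq; rewrite qS (negbTE pS).
  - have [|x ->] := (gS p).1; first by rewrite inE.
    have [|y ->] := (gS q).1; first by rewrite inE.
    by rewrite -!(adj_pullback g) eg.
apply/subset_leq_card/fintype.subsetP => _ /imsetP[E /inC[EP eS] ->].
rewrite finset.in_setX; apply/andP; split.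
  apply/connected_regularP; split.
    apply: pullback_regular => // x w xw.
    by apply/fS; rewrite -(closed _ _ _ eS xw); apply/fS; exists x.
  have fromv y : connect (adj E) v (f y) by rewrite -(memS E) //; apply/fS; exists y.
  apply/forallP => x; apply/forallP => y.
  have xy : connect (adj E) (f x) (f y).
    by apply: connect_trans (fromv y); rewrite connect_adj_sym.
  (* Vertices reached inside the pullback; an edge of [E] leaving this set would stay in [S], so its
     end would be reached after all. *)
  pose P w := [exists z, (w == f z) && connect (adj (pullback f E)) x z].
  have Px : P (f x) by apply/existsP; exists x; rewrite eqxx connect0.
  suff /existsP[z /andP[/eqP/fi->]] : P (f y) by [].
  apply: contraT => nPy; have [p [q [_ pq /existsP[z /andP[/eqP ep xz]] /negP[]]]] := connect_crossing xy Px nPy.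
  have [|z' eq] := (fS q).1; first by rewrite -(closed _ _ _ eS pq); apply/fS; exists z.
  apply/existsP; exists z'; rewrite eq eqxx /=; apply: connect_trans xz (connect1 _).
  by rewrite adj_pullback -ep -eq.
apply: pullback_regular => // x w xw; apply/gS; rewrite inE -(closed _ _ _ eS xw).
by have := (gS (g x)).2; rewrite inE; apply; exists x.
Qed.

(** Counts pairs of a graph and a vertex by the component of the vertex: there are ['C(n, k)] sets
    of size [k], each with [k] choices of the vertex. *)
Lemma component_recursion n : n * #|regular_planar R D n| <=
  \sum_(k < n.+1) 'C(n, k) * (k * (#|connected_regular R D k| * #|regular_planar R D (n - k)|)).
Proof.
pose F k := #|connected_regular R D k| * #|regular_planar R D (n - k)|.
apply: (@leq_trans (\sum_(v : 'I_n) \sum_(S : {set 'I_n} | v \in S) F #|S|)).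
  rewrite -[n in n * _]card_ord -sum_nat_const; apply: leq_sum => v _.
  rewrite -sum1_card (partition_big (fun E => component E v) (fun S => v \in S)) /=; last first.
    by move=> E _; rewrite inE connect0.
  apply: leq_sum => S _; rewrite sum1_card; apply: leq_trans (component_count v S).
  by apply/eq_leq/eq_card => E; rewrite [RHS]finset.in_set.
rewrite (exchange_big_dep predT) //=.
under eq_bigr do rewrite sum_nat_const.
rewrite (partition_big (fun S : {set 'I_n} => inord #|S| : 'I_n.+1) predT) //=.
apply: leq_sum => k _; rewrite -[n in 'C(n, _)]card_ord -card_draws -sum_nat_const.
rewrite [leqRHS](eq_bigl (fun S : {set 'I_n} => #|S| == k)); last by move=> S; rewrite inE.
have cS (S : {set 'I_n}) : #|S| < n.+1 by rewrite ltnS -[leqRHS]card_ord max_card.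
rewrite (eq_bigl (fun S : {set 'I_n} => #|S| == k)); last first.
  by move=> S; rewrite -val_eqE /= inordK.
by apply: leq_sum => S /eqP <-; rewrite leq_mul2r; apply/orP; right; apply/eq_leq/eq_card.
Qed.
End ComponentRecursion.

(** * Straight-line drawings *)

Section StraightLine.
Local Open Scope ring_scope.
Variable R : realType.
Implicit Types p q r u v w : R * R.

Definition orient p q r : R := (q.1 - p.1) * (r.2 - p.2) - (q.2 - p.2) * (r.1 - p.1).
Definition segment u v (t : R) : R * R := ((1 - t) * u.1 + t * v.1, (1 - t) * u.2 + t * v.2).

Lemma orient_segment u v p q t :
  orient u v (segment p q t) = (1 - t) * orient u v p + t * orient u v q.
Proof. rewrite /orient /segment /=; ring. Qed.

Lemma orient_on_segment u v t : orient u v (segment u v t) = 0.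
Proof. rewrite /orient /segment /=; ring. Qed.

(** Weak signs allow one end to lie on the line, as happens for edges with a common vertex; since
    not both ends do, the open segment still misses the line. *)
Definition same_side (o1 o2 : R) :=
  ((0 <= o1) && (0 <= o2) || (o1 <= 0) && (o2 <= 0)) && ((o1 != 0) || (o2 != 0)).

Lemma same_side_convex (o1 o2 t : R) : 0 < t < 1 -> same_side o1 o2 ->
  (1 - t) * o1 + t * o2 <> 0.
Proof.
have pos (x y s : R) : 0 < s < 1 -> 0 <= x -> 0 <= y -> (x != 0) || (y != 0) -> (1 - s) * x + s * y != 0.
  move=> /andP[s0 s1] x0 y0 xy; have s1' : 0 < 1 - s by rewrite subr_gt0.
  have h1 : 0 <= (1 - s) * x by rewrite mulr_ge0 // ltW.
  have h2 : 0 <= s * y by rewrite mulr_ge0 // ltW.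
  by rewrite paddr_eq0 // !mulf_eq0 (gt_eqF s1') (gt_eqF s0) /= negb_and.
move=> t01 /andP[/orP[]/andP[a1 a2] nz]; first by apply/eqP/pos.
move/eqP; rewrite -oppr_eq0 opprD -!mulrN; apply/negP/pos; rewrite ?oppr_ge0 ?oppr_eq0 //.
Qed.

Lemma segment_arc u v : u <> v -> arc (segment u v).
Proof.
move=> uv; split.
  apply/within_unitP => s s01 eps e0; pose L := `|v.1 - u.1| + `|v.2 - u.2| + 1.
  have L1 : `|v.1 - u.1| < L by rewrite /L; have := normr_ge0 (v.2 - u.2); lra.
  have L2 : `|v.2 - u.2| < L by rewrite /L; have := normr_ge0 (v.1 - u.1); lra.
  have L0 : 0 < L by apply: le_lt_trans (normr_ge0 _) L1.
  exists (eps / L); first by rewrite divr_gt0.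
  move=> t t01; rewrite ltr_pdivlMr // => st.
  have bound x y : `|y - x| < L ->
      `|(1 - s) * x + s * y - ((1 - t) * x + t * y)| < eps.
    move=> yx; have -> : (1 - s) * x + s * y - ((1 - t) * x + t * y) = (s - t) * (y - x) by ring.
    by rewrite normrM; apply: le_lt_trans st; rewrite ler_wpM2l // ltW.
  by split; apply: bound.
move=> s t _ _ [e1 e2].
have [e|ne] := eqVneq u.1 v.1.
  have ne : u.2 != v.2.
    by apply/eqP => e'; apply: uv; rewrite [u]surjective_pairing e e' -surjective_pairing.
  have : (s - t) * (v.2 - u.2) = 0 by rewrite -[RHS](subrr ((1 - s) * u.2 + s * v.2)) {2}e2; ring.
  by move/eqP; rewrite mulf_eq0 !subr_eq0 [v.2 == _]eq_sym (negbTE ne) orbF => /eqP.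
have : (s - t) * (v.1 - u.1) = 0 by rewrite -[RHS](subrr ((1 - s) * u.1 + s * v.1)) {2}e1; ring.
by move/eqP; rewrite mulf_eq0 !subr_eq0 [v.1 == _]eq_sym (negbTE ne) orbF => /eqP.
Qed.

(** Two open segments are disjoint as soon as one of them misses the line through the other, so one
    of the two sign tests is enough for each pair of edges. *)
Lemma straight_line_planar (V : finType) (E : {set {set V}}) (pos : V -> R * R) :
  simple_graph E -> injective pos ->
  (forall u v w : V, adj E u v -> w != u -> w != v -> orient (pos u) (pos v) (pos w) != 0) ->
  (forall u v u' v' : V, adj E u v -> adj E u' v' -> [set u; v]%SET != [set u'; v']%SET ->
    same_side (orient (pos u) (pos v) (pos u')) (orient (pos u) (pos v) (pos v')) \/
    same_side (orient (pos u') (pos v') (pos u)) (orient (pos u') (pos v') (pos v))) ->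
  planar R E.
Proof.
move=> Es pinj gen cross.
have [v0 _|noV] := pickP (fun _ : V => true); last first.
  exists pos, (fun _ _ => (0, 0)); split=> // [e eE|e t v|e f s t eE].
  - by have [u _] := simple_edgeP Es eE; have := noV u.
  - by have := noV v.
  - by have [u _] := simple_edgeP Es eE; have := noV u.
have /choice[st stP] : forall e : {set V}, exists s : V * V, e \in E ->
    s.1 != s.2 /\ e = [set s.1; s.2]%SET.
  move=> e; case: (boolP (e \in E)) => [/(simple_edgeP Es)[u [v H]]|_]; last by exists (v0, v0).
  by exists (u, v).
have stE e : e \in E -> adj E (st e).1 (st e).2 by move=> eE; rewrite /adj; have [_ <-] := stP _ eE.
exists pos, (fun e => segment (pos (st e).1) (pos (st e).2)); split=> //.
- move=> e eE; have [ne ee] := stP _ eE.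
  have [? ?] := @segment_arc (pos (st e).1) (pos (st e).2) (fun h => elimN eqP ne (pinj _ _ h)).
  split=> //; exists (st e).1, (st e).2.
  rewrite /segment subr0 subrr !mul1r !mul0r !addr0 !add0r -!surjective_pairing.
  by split.
- move=> e t v eE; rewrite in_itv /= => t01 ev; have [ne ee] := stP _ eE.
  have o0 := orient_on_segment (pos (st e).1) (pos (st e).2) t; rewrite ev in o0.
  have [v1|v1] := eqVneq v (st e).1.
    have /segment_arc[_ inj] : pos (st e).1 <> pos (st e).2 by move/pinj/eqP; apply/negP.
    have : t = 0.
      apply: inj; rewrite ?in_itv /= ?lexx ?ler01 //; first lra.
      by rewrite ev v1 /segment subr0 !mul1r !mul0r !addr0 -surjective_pairing.
    by lra.
  have [v2|v2] := eqVneq v (st e).2.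
    have /segment_arc[_ inj] : pos (st e).1 <> pos (st e).2 by move/pinj/eqP; apply/negP.
    have : t = 1.
      apply: inj; rewrite ?in_itv /= ?lexx ?ler01 //; first lra.
      by rewrite ev v2 /segment subrr !mul1r !mul0r !add0r -surjective_pairing.
    by lra.
  by have := gen _ _ v (stE e eE) v1 v2; rewrite o0 eqxx.
- move=> e f s t eE fE ef; rewrite !in_itv /= => s01 t01 est.
  have [_ ee] := stP _ eE; have [_ ff] := stP _ fE.
  have [|c|c] := cross _ _ _ _ (stE e eE) (stE f fE); first by rewrite -ee -ff.
    apply: (same_side_convex t01 c); rewrite -orient_segment -est; exact: orient_on_segment.
  apply: (same_side_convex s01 c); rewrite -orient_segment est; exact: orient_on_segment.
Qed.
End StraightLine.

(** * Starting graphs, verified by computation *)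

Module IntegerDrawings.
Import ZArith.

(* Integer coordinates, so that the conditions on a straight-line drawing can
   be evaluated in [Z]. *)
Section IntegerDrawing.
Variables (n D : nat) (es : seq (nat * nat)) (pts : seq (Z * Z)).

Definition adjn (u v : nat) := ((u, v) \in es) || ((v, u) \in es).
Definition pt i : Z * Z := nth (0, 0)%Z pts i.
Definition zorient (p q r : Z * Z) : Z :=
  ((q.1 - p.1) * (r.2 - p.2) - (q.2 - p.2) * (r.1 - p.1))%Z.
Definition zsame_side (a b : Z) : bool :=
  ((0 <=? a)%Z && (0 <=? b)%Z || (a <=? 0)%Z && (b <=? 0)%Z) && (~~ (a =? 0)%Z || ~~ (b =? 0)%Z).

(** The last two tests concern the root. If each vertex other than 0 has a smaller neighbour, all
    are joined to 0; and the triangle [0, 1, 2] makes the edge from 0 to 1 a non-bridge. Edges occur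
    in both directions, hence the exception for a reversed pair in the crossing test. *)
Definition drawing_check : bool :=
  let vs := iota 0 n in
  let arcs := [seq p <- [seq (u, v) | u <- vs, v <- vs] | adjn p.1 p.2] in
  [&& all (fun u => ~~ adjn u u) vs,
      all (fun u => count (adjn u) vs == D) vs,
      all (fun u => all (fun v => (u == v) ||
        ~~ ((pt u).1 =? (pt v).1)%Z || ~~ ((pt u).2 =? (pt v).2)%Z) vs) vs,
      all (fun a => all (fun w => [|| w == a.1, w == a.2 |
        ~~ (zorient (pt a.1) (pt a.2) (pt w) =? 0)%Z]) vs) arcs,
      all (fun a => all (fun b => [|| (a == b), (a == (b.2, b.1)),
        zsame_side (zorient (pt a.1) (pt a.2) (pt b.1)) (zorient (pt a.1) (pt a.2) (pt b.2)) |
        zsame_side (zorient (pt b.1) (pt b.2) (pt a.1)) (zorient (pt b.1) (pt b.2) (pt a.2))]) arcs) arcs,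
      all (fun u => (u == 0) || has (fun w => (w < u) && adjn u w) vs) vs &
      [&& 2 < n, adjn 0 1, adjn 0 2 & adjn 1 2]].
End IntegerDrawing.

Definition k4_edges := [:: (0, 1); (0, 2); (0, 3); (1, 2); (1, 3); (2, 3)].
Definition k4_points := [:: (0, 0); (7, 1); (2, 9); (3, 4)]%Z.
Definition prism_edges := [:: (0, 1); (0, 2); (1, 2); (0, 3); (1, 4); (2, 5); (3, 4); (3, 5); (4, 5)].
Definition prism_points := [:: (0, 0); (20, 1); (9, 23); (6, 5); (13, 6); (10, 13)]%Z.
(** The snub of a polyhedral graph with [m] edges has [2 * m] vertices, all of degree 5. For the
    tetrahedron, with 6 edges, it is the icosahedron. *)
Definition snub_tetrahedron_edges := [::
  (0, 1); (0, 2); (0, 3); (0, 4); (0, 5); (1, 2); (1, 5); (1, 6); (1, 7);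
  (2, 3); (2, 7); (2, 8); (3, 4); (3, 8); (3, 9); (4, 5); (4, 9); (4, 10);
  (5, 6); (5, 10); (6, 7); (6, 10); (6, 11); (7, 8); (7, 11); (8, 9); (8, 11);
  (9, 10); (9, 11); (10, 11)].
Definition snub_tetrahedron_points := [::
  (33, 25); (0, 33); (10, 0); (18, 16); (20, 21); (16, 25); (10, 23); (9, 18);
  (13, 14); (16, 18); (15, 21); (13, 19)]%Z.
(** The octahedron without one edge has 11 edges, whence 22 vertices. *)
Definition snub_octahedron_minus_edge_edges := [::
  (0, 1); (0, 2); (0, 3); (0, 4); (0, 5); (1, 2); (1, 6); (1, 7); (1, 8);
  (2, 7); (2, 9); (2, 10); (3, 5); (3, 6); (3, 11); (3, 12); (4, 5); (4, 10);
  (4, 13); (4, 14); (5, 11); (5, 13); (6, 8); (6, 12); (6, 15); (7, 8);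
  (7, 9); (7, 16); (8, 15); (8, 16); (9, 10); (9, 16); (9, 17); (10, 14);
  (10, 17); (11, 12); (11, 13); (11, 18); (12, 15); (12, 19); (13, 14);
  (13, 18); (14, 18); (14, 20); (15, 19); (15, 21); (16, 17); (16, 21);
  (17, 20); (17, 21); (18, 19); (18, 20); (19, 20); (19, 21); (20, 21)].
Definition snub_octahedron_minus_edge_points := [::
  (68, 51); (0, 67); (21, 0); (42, 47); (45, 41); (47, 45); (24, 50);
  (17, 35); (18, 46); (24, 27); (31, 28); (40, 44); (33, 45); (41, 42);
  (37, 38); (27, 44); (23, 36); (28, 34); (36, 41); (31, 42); (32, 39);
  (28, 39)]%Z.

Section DrawingCheck.
Variables (R : realType) (n D : nat) (es : seq (nat * nat)) (pts : seq (Z * Z)).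

Definition real_of_Z (z : Z) : R := (int_of_Z z)%:~R%R.

Lemma real_of_ZM x y : real_of_Z (x * y)%Z = (real_of_Z x * real_of_Z y)%R.
Proof. by rewrite /real_of_Z -intrM -rmorphM. Qed.

Lemma real_of_ZB x y : real_of_Z (x - y)%Z = (real_of_Z x - real_of_Z y)%R.
Proof. by rewrite /real_of_Z -intrB -rmorphB. Qed.

Lemma real_of_Z_ge0 x : (0 <=? x)%Z -> (0 <= real_of_Z x)%R.
Proof. by move=> h; rewrite /real_of_Z ler0z; lia. Qed.

Lemma real_of_Z_le0 x : (x <=? 0)%Z -> (real_of_Z x <= 0)%R.
Proof. by move=> h; rewrite /real_of_Z lerz0; lia. Qed.

Lemma real_of_Z_neq0 x : ~~ (x =? 0)%Z -> (real_of_Z x != 0)%R.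
Proof. by move=> h; rewrite /real_of_Z intr_eq0; lia. Qed.

Definition real_point (p : Z * Z) : R * R := (real_of_Z p.1, real_of_Z p.2).

Lemma orient_real_point p q r :
  orient (real_point p) (real_point q) (real_point r) = real_of_Z (zorient p q r).
Proof. by rewrite /orient /zorient real_of_ZB !real_of_ZM !real_of_ZB. Qed.

Lemma same_side_real a b : zsame_side a b -> same_side (real_of_Z a) (real_of_Z b).
Proof.
move=> /andP[/orP s /orP z]; apply/andP; split.
  by case: s => /andP[ha hb]; apply/orP; [left|right]; rewrite ?real_of_Z_ge0 ?real_of_Z_le0.
by apply/orP; case: z => h; [left|right]; apply: real_of_Z_neq0.
Qed.

Lemma card_ord_pred m (P : pred nat) : #|[set u : 'I_m | P u]| = count P (iota 0 m).
Proof.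
rewrite -sum1_card -sum1_count -[X in iota 0 X]subn0 -/(index_iota 0 m) big_mkord.
by apply: eq_bigl => u; rewrite inE.
Qed.

Lemma drawing_check_rooted : drawing_check n D es pts -> 0 < #|rooted_regular R D n|.
Proof.
case/and5P=> /allP irr /allP deg /allP inj /allP gen.
case/and3P=> /allP cross /allP par /and4P[n2 a01 a02 a12].
have vs (u : 'I_n) : (u : nat) \in iota 0 n by rewrite mem_iota ltn_ord.
pose E : {set {set 'I_n}} := [set [set p.1; p.2] | p in [set p : 'I_n * 'I_n | adjn es p.1 p.2]].
have adjnC u v : adjn es u v = adjn es v u by rewrite /adjn orbC.
have adjE u v : adj E u v = adjn es u v.
  rewrite /adj /E; apply/imsetP/idP => [[[x y]]|uv]; last by exists (u, v); rewrite ?inE.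
  by rewrite inE /= => xy /set2_eqP[[-> ->]//|[-> ->]]; rewrite adjnC.
have ine (u : 'I_n) : ~~ adjn es u u by apply: irr.
have Es : simple_graph E.
  apply/forall_inP => _ /imsetP[[x y] + ->] /=; rewrite inE /= cards2 => xy.
  by rewrite (_ : x != y) //; apply: contraTneq xy => ->; apply: ine.
have arcs u v : adj E u v ->
    (u : nat, v : nat) \in [seq p <- [seq (u, v) | u <- iota 0 n, v <- iota 0 n] | adjn es p.1 p.2].
  rewrite adjE => uv; rewrite mem_filter /= uv.
  by apply/allpairsP; exists (u : nat, v : nat); rewrite !vs.
pose pos (v : 'I_n) := real_point (pt pts v).
have pinj : injective pos.
  move=> u v [e1 e2]; apply/eqP; have /allP/(_ v (vs v)) := inj u (vs u).
  have sub0 (x y : Z) : real_of_Z x = real_of_Z y -> (x =? y)%Z.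
    move=> e; apply: contraT => ne; have : ~~ (x - y =? 0)%Z by lia.
    by move/real_of_Z_neq0; rewrite real_of_ZB e subrr eqxx.
  by rewrite -orbA (sub0 _ _ e1) (sub0 _ _ e2) /= orbF.
have EP : E \in regular_planar R D n.
  apply/regular_planarP; split=> //.
    apply: (straight_line_planar Es pinj).
      move=> u v w uv wu wv; have /allP/(_ w (vs w)) := gen _ (arcs _ _ uv).
      rewrite /= !(eqtype.inj_eq val_inj) (negbTE wu) (negbTE wv) /= => /real_of_Z_neq0.
      by rewrite -orient_real_point.
    move=> u v u' v' uv uv' ne; have /allP/(_ _ (arcs _ _ uv')) := cross _ (arcs _ _ uv).
    have neq1 : ((u : nat, v : nat) == (u' : nat, v' : nat)) = false.
      by apply/negbTE; apply: contra ne => /eqP[/val_inj-> /val_inj->].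
    have neq2 : ((u : nat, v : nat) == (v' : nat, u' : nat)) = false.
      by apply/negbTE; apply: contra ne => /eqP[/val_inj-> /val_inj->]; rewrite finset.setUC.
    rewrite /= neq1 neq2 /= => /orP[/same_side_real h|/same_side_real h]; [left|right];
      by move: h; rewrite -!orient_real_point.
  move=> v; rewrite degree_adj //; have /eqP <- := deg v (vs v).
  rewrite -card_ord_pred; apply: eq_card => u; by rewrite !inE adjE.
have [n0 n1] : 0 < n /\ 1 < n by split; apply: leq_trans n2.
pose o0 := Ordinal n0; pose o1 := Ordinal n1; pose o2 := Ordinal n2.
have to0 u : connect (adj E) u o0.
  have [k] := ubnP (u : nat); elim: k u => // k IH u uk.
  have := par u (vs u); case/orP=> [/eqP u0|/hasP[w]].
    by have -> : u = o0 by apply: val_inj.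
  rewrite mem_iota /= => wn /andP[wu uw].
  apply: connect_trans (IH (Ordinal wn) (leq_trans wu uk)).
  by apply: connect1; rewrite adjE.
have cE : connected_graph E.
  apply/forallP => u; apply/forallP => v; apply: connect_trans (to0 u) _.
  by rewrite connect_adj_sym.
apply/card_gt0P; exists (E, (o0, o1)); apply/rooted_regularP; split=> //.
  by rewrite adjE.
apply: (@connect_trans _ _ o2); apply/connect1/setD1P; split.
- by apply/eqP => /set2_eqP[[_ /(congr1 val)]|[/(congr1 val)]].
- by rewrite -/(adj E o0 o2) adjE.
- by apply/eqP => /set2_eqP[[/(congr1 val)]|[_ /(congr1 val)]].
- by rewrite -/(adj E o2 o1) adjE adjnC.
Qed.
End DrawingCheck.

Lemma rooted_cubic4 (R : realType) : 0 < #|rooted_regular R 3 4|.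
Proof. by apply: (@drawing_check_rooted R 4 3 k4_edges k4_points); vm_compute. Qed.

Lemma rooted_cubic6 (R : realType) : 0 < #|rooted_regular R 3 6|.
Proof. by apply: (@drawing_check_rooted R 6 3 prism_edges prism_points); vm_compute. Qed.

Lemma rooted_quintic12 (R : realType) : 0 < #|rooted_regular R 5 12|.
Proof.
by apply: (@drawing_check_rooted R 12 5 snub_tetrahedron_edges snub_tetrahedron_points); vm_compute.
Qed.

Lemma rooted_quintic22 (R : realType) : 0 < #|rooted_regular R 5 22|.
Proof.
by apply: (@drawing_check_rooted R 22 5 snub_octahedron_minus_edge_edges
  snub_octahedron_minus_edge_points); vm_compute.
Qed.
End IntegerDrawings.
Import IntegerDrawings.

(** * Growth rates *)

Section GrowthRates.
Local Open Scope classical_set_scope.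
Local Open Scope ring_scope.
Variable R : realType.
Implicit Types (a c u x : nat -> R).

Lemma bernoulli (t : R) m : 0 <= t -> 1 + m%:R * t <= (1 + t) ^+ m.
Proof.
move=> t0; elim: m => [|m IH]; first by rewrite mul0r addr0 expr0.
rewrite exprS; apply: (@le_trans _ _ ((1 + t) * (1 + m%:R * t))); last first.
  by rewrite ler_wpM2l // addr_ge0.
rewrite -natr1; have := mulr_ge0 (mulr_ge0 (ler0n R m) t0) t0; nra.
Qed.

Lemma geometric_absorbs (s t C : R) : 0 < s -> s < t ->
  exists N, forall n, (N <= n)%N -> C * s ^+ n <= t ^+ n.
Proof.
move=> s0 st; pose d := t / s - 1; have d0 : 0 < d by rewrite subr_gt0 ltr_pdivlMr // mul1r.
exists (Num.truncn (`|C| / d)).+1 => n Nn.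
have tE : t = (1 + d) * s by rewrite /d addrC subrK divfK // gt_eqF.
rewrite tE exprMn ler_pM2r ?exprn_gt0 //.
apply: (le_trans _ (bernoulli n (ltW d0))); apply: le_trans (ler_norm C) _.
have : `|C| / d <= n%:R.
  by apply/ltW/(lt_le_trans (truncnS_gt _)); rewrite ler_nat.
by rewrite ler_pdivrMr // => h; lra.
Qed.

Lemma powR_root (y : R) m : 0 <= y -> (y ^+ m.+1) `^ (m.+1%:R^-1) = y.
Proof. by move=> y0; rewrite -powR_mulrn // -powRrM divff ?powRr1 // pnatr_eq0. Qed.

Lemma root_powR (y : R) m : 0 <= y -> (y `^ (m.+1%:R^-1)) ^+ m.+1 = y.
Proof. by move=> y0; rewrite -powR_mulrn ?powR_ge0 // -powRrM mulVf ?powRr1 // pnatr_eq0. Qed.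

(** Constant factors are absorbed by a slight change of the base, so exponential bounds for every
    base below and above [gamma] determine the limit of the roots. *)
Lemma root_growth_cvg x (gamma : R) : 0 < gamma -> (forall n, 0 <= x n) ->
  (forall rho, 0 < rho -> rho < gamma -> exists2 C, 0 < C &
     exists N, forall n, (N <= n)%N -> rho ^+ (2 * n) <= C * x n) ->
  (forall rho, gamma < rho -> exists C, forall n, x n <= C * rho ^+ (2 * n)) ->
  (fun n => x n `^ ((2 * n)%:R^-1)) @ \oo --> gamma.
Proof.
move=> g0 x0 lower upper; apply/cvgrPdist_le => eps e0.
(* The bound [gamma / 2] keeps the smaller base [gamma - d] positive. *)
pose d := Num.min eps (gamma / 2).
have d0 : 0 < d by rewrite lt_min e0 divr_gt0.
have de : d <= eps by rewrite /d ge_min lexx.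
have dg : d <= gamma / 2 by rewrite /d ge_min lexx orbT.
have [C HC] := upper (gamma + d / 2) ltac:(lra).
have [|N1 HN1] := @geometric_absorbs (gamma + d / 2) (gamma + d) C ltac:(lra); first by lra.
have [C' C0 [N HN]] := lower (gamma - d / 2) ltac:(lra) ltac:(lra).
have [|N2 HN2] := @geometric_absorbs (gamma - d) (gamma - d / 2) C' ltac:(lra); first by lra.
exists (maxn 1 (maxn N (maxn N1 N2))) => // n /=; rewrite !geq_max => /and4P[n1 nN nN1 nN2].
have n2 : (n <= 2 * n)%N by lia.
have -> : (2 * n = (2 * n).-1.+1)%N by lia.
set m := (2 * n).-1; have mE : m.+1 = (2 * n)%N by rewrite /m; lia.
have up : x n <= (gamma + d) ^+ m.+1.
  by rewrite mE; apply: le_trans (HC n) (HN1 _ (leq_trans nN1 n2)).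
have lo : (gamma - d) ^+ m.+1 <= x n.
  rewrite mE -(ler_pM2l C0); apply: le_trans (HN2 _ (leq_trans nN2 n2)) (HN _ nN).
have gd : 0 <= gamma - d by lra.
have gd' : 0 <= gamma + d by lra.
have mi : 0 <= (m.+1%:R^-1 : R) by rewrite invr_ge0.
have h1 : x n `^ (m.+1%:R^-1) <= gamma + d.
  by rewrite -[leRHS](powR_root m gd'); apply: ge0_ler_powR => //; rewrite nnegrE ?exprn_ge0.
have h2 : gamma - d <= x n `^ (m.+1%:R^-1).
  by rewrite -[leLHS](powR_root m gd); apply: ge0_ler_powR => //; rewrite nnegrE ?exprn_ge0.
by rewrite ler_norml; apply/andP; split; lra.
Qed.

Lemma finite_lower_bound (f : nat -> R) M : (forall s, (s < M)%N -> 0 < f s) ->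
  exists2 c, 0 < c & forall s, (s < M)%N -> c <= f s.
Proof.
elim: M => [|M IH] f0; first by exists 1.
have [c c0 H] := IH (fun s sM => f0 s (ltnW sM)).
exists (Num.min c (f M)); first by rewrite lt_min c0 f0.
move=> s; rewrite ltnS leq_eqVlt => /orP[/eqP->|/H sc]; rewrite ge_min ?lexx ?orbT //.
by rewrite sc.
Qed.

(** * Fekete's lemma along even orders *)

Section Supermultiplicative.
Variable u : nat -> R.
Hypotheses (u0 : forall n, 0 <= u n) (um : forall i j, u i * u j <= u (i + j)%N).

Lemma superm_iter i s q : u i ^+ q * u s <= u (q * i + s)%N.
Proof.
elim: q => [|q IH]; first by rewrite expr0 mul1r.
rewrite exprS -mulrA mulSn -addnA; apply: (le_trans _ (um _ _)); exact: ler_wpM2l.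
Qed.

Lemma superm_gt0_eventually p q : (0 < p)%N -> (0 < q)%N -> coprime p q -> 0 < u (2 * p)%N ->
  0 < u (2 * q)%N -> exists N, forall s, (N <= s)%N -> 0 < u (2 * s)%N.
Proof.
move=> p0 q0 cpq up uq; exists (p * q + p + q)%N => s sN.
have pos i k : 0 < u (2 * i)%N -> 0 < u (2 * (k.+1 * i))%N.
  move=> ui; elim: k => [|k IH]; first by rewrite mul1n.
  rewrite [(k.+2 * i)%N]mulSn mulnDr; apply: (lt_le_trans _ (um _ _)); exact: mulr_gt0.
have [[k1 k2] /= kE] := coprimeP _ q0 (etrans (coprime_sym q p) cpq).
pose s' := (s - p - q)%N; pose b := ((s' * k1) %% p)%N.
have bp : (b < p)%N by rewrite ltn_mod.
have bq : (b * q <= s')%N.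
  by apply: (@leq_trans (p * q)%N); [rewrite leq_mul2r ltnW ?orbT|rewrite /s'; lia].
have : (p %| s' - b * q)%N.
  rewrite -eqn_mod_dvd // /b modnMml -mulnA (_ : (k1 * q = 1 + k2 * p)%N); last by lia.
  by rewrite mulnDr muln1 mulnA addnC modnMDl.
case/dvdnP=> al alE; have sE : s = (al.+1 * p + b.+1 * q)%N by rewrite /s' in alE bq; lia.
by rewrite sE mulnDr; apply: (lt_le_trans _ (um _ _)); apply: mulr_gt0; apply: pos.
Qed.

Variable B : R.
Hypothesis uB : forall n, u n <= B ^+ n.
Hypothesis B0 : 0 <= B.
Variable N0 : nat.
Hypothesis upos : forall s, (N0 <= s)%N -> 0 < u (2 * s)%N.

(** Fekete's limit, as a supremum over all positive orders; an order at which [u] vanishes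
    contributes the root 0. *)
Let roots := [set r | exists n, r = u n.+1 `^ (n.+1%:R^-1)].
Definition growth : R := sup roots.

Let has_sup_roots : has_sup roots.
Proof.
split; first by exists (u 1 `^ (1%:R^-1)); exists 0%N.
exists B => _ [n ->]; rewrite -[leRHS](powR_root n B0).
by apply: ge0_ler_powR; rewrite ?nnegrE ?exprn_ge0 ?invr_ge0.
Qed.

Lemma growth_ge n : u n.+1 `^ (n.+1%:R^-1) <= growth.
Proof. by apply: sup_upper_bound => //; exists n. Qed.

Lemma growth_gt0 : 0 < growth.
Proof.
have u1 : 0 < u (2 * N0.+1)%N by apply: upos.
have e : (2 * N0.+1 = (2 * N0).+1.+1)%N by lia.
by rewrite e in u1; apply: (lt_le_trans _ (growth_ge (2 * N0).+1)); apply: powR_gt0.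
Qed.

Lemma superm_le_growth n : u n.+1 <= growth ^+ n.+1.
Proof.
rewrite -[leLHS](root_powR n (u0 _)).
by apply: lerXn2r; rewrite ?nnegrE ?powR_ge0 ?growth_ge // ltW // growth_gt0.
Qed.

Lemma growth_lower rho : 0 < rho -> rho < growth -> exists2 C, 0 < C &
  forall n, (N0 <= n)%N -> rho ^+ (2 * n) <= C * u (2 * n)%N.
Proof.
move=> r0 rg.
have gr0 : 0 < growth - rho by rewrite subr_gt0.
have [_ [m ->] mr] := sup_adherent gr0 has_sup_roots.
have rm : rho ^+ m.+1 <= u m.+1.
  rewrite -[leRHS](root_powR m (u0 _)); apply: lerXn2r; rewrite ?nnegrE ?powR_ge0 ?ltW //.
  by move: mr; rewrite -/growth; lra.
(* The block length is doubled so that the remainder of an even order is even. Remainders are then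
   taken from [2 * N0] on, where [u] is positive, and only finitely many occur. *)
have r2m : rho ^+ (2 * m.+1) <= u (2 * m.+1)%N.
  rewrite mul2n -addnn exprD; apply: (le_trans _ (um _ _)).
  by apply: ler_pM => //; rewrite exprn_ge0 // ltW.
have [c c0 Hc] := @finite_lower_bound (fun s => u (2 * (N0 + s))%N / rho ^+ (2 * (N0 + s))) m.+1
  (fun s _ => divr_gt0 (upos (leq_addr s N0)) (exprn_gt0 _ r0)).
exists c^-1 => [|n nN]; first by rewrite invr_gt0.
pose q := ((n - N0) %/ m.+1)%N; pose s := ((n - N0) %% m.+1)%N.
have nE : n = (q * m.+1 + (N0 + s))%N by have := divn_eq (n - N0) m.+1; rewrite -/q -/s; lia.
have sm : (s < m.+1)%N by rewrite ltn_mod.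
rewrite mulrC ler_pdivlMr // nE mulnDr exprD (_ : (2 * (q * m.+1) = q * (2 * m.+1))%N); last by lia.
apply: (le_trans _ (superm_iter _ _ _)).
have := Hc s sm; rewrite ler_pdivlMr ?exprn_gt0 // => hc.
have r00 := ltW r0; have c00 := ltW c0.
rewrite -mulrA; apply: ler_pM; rewrite ?mulr_ge0 ?exprn_ge0 //.
  by rewrite [(q * _)%N]mulnC exprM; apply: lerXn2r; rewrite ?nnegrE ?exprn_ge0.
by rewrite mulrC.
Qed.
End Supermultiplicative.

Lemma sum_k_geometric (y : R) n : 0 <= y < 1 ->
  \sum_(k < n.+1) k%:R * y ^+ k <= y / (1 - y) ^+ 2.
Proof.
move=> /andP[y0 y1]; have d0 : 0 < 1 - y by rewrite subr_gt0.
rewrite ler_pdivlMr ?exprn_gt0 //.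
suff -> : (\sum_(k < n.+1) k%:R * y ^+ k) * (1 - y) ^+ 2 = y - y ^+ n.+1 * (1 + n%:R * (1 - y)).
  by rewrite lerBlDr lerDl mulr_ge0 ?exprn_ge0 // addr_ge0 // mulr_ge0 // ltW.
elim: n => [|n IH]; first by rewrite big_ord1 expr1 !mul0r addr0 mulr1 subrr.
rewrite big_ord_recr /= mulrDl IH -natr1 !exprS; ring.
Qed.

(** Inserting [a n <= C * rho ^+ n] into the recursion leaves the sum of [k * y ^ k] with
    [y = g / rho < 1], bounded by [T]. For [n >= T] the factor [n] on the left closes the induction,
    and [C] is chosen to cover the smaller orders. *)
Lemma recursion_upper a c (g rho : R) : 0 < g -> g < rho -> (forall n, 0 <= a n) ->
  (forall k, c k.+1 <= g ^+ k.+1) ->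
  (forall n, n%:R * a n <= \sum_(k < n.+1) k%:R * (c k * a (n - k)%N)) ->
  exists2 C, 0 < C & forall n, a n <= C * rho ^+ n.
Proof.
move=> g0 gr a0 cg rec; have r0 := lt_trans g0 gr.
pose y := g / rho; have y01 : 0 <= y < 1.
  by rewrite /y divr_ge0 ?ltW //= ltr_pdivrMr // mul1r.
pose T := y / (1 - y) ^+ 2; pose N := (Num.truncn T).+1.
pose C := 1 + \sum_(n < N) a n / rho ^+ n.
have C1 : 0 < C.
  by rewrite ltr_pwDl // sumr_ge0 // => n _; rewrite divr_ge0 ?exprn_ge0 // ltW.
exists C => // n; have [k] := ubnP n; elim: k n => // k IH n nk.
have [nN|Nn] := ltnP n N.
  rewrite -ler_pdivrMr ?exprn_gt0 // /C (bigD1 (Ordinal nN)) //= addrCA lerDl.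
  by rewrite addr_ge0 // sumr_ge0 // => i _; rewrite divr_ge0 ?exprn_ge0 // ltW.
have n0 : 0 < n%:R :> R by rewrite ltr0n; apply: leq_trans Nn.
have Tn : T <= n%:R.
  by apply/ltW/(lt_le_trans (truncnS_gt _)); rewrite ler_nat.
rewrite -(ler_pM2l n0); apply: le_trans (rec n) _.
apply: (@le_trans _ _ (\sum_(k < n.+1) (k%:R * y ^+ k) * (C * rho ^+ n))); last first.
  rewrite -mulr_suml ler_pM2r ?mulr_gt0 ?exprn_gt0 //.
  exact: le_trans (sum_k_geometric n y01) Tn.
apply: ler_sum => i _; rewrite -mulrA.
case: i => -[|i] /= ilt; first by rewrite !mul0r.
rewrite ler_wpM2l //; apply: (@le_trans _ _ (g ^+ i.+1 * (C * rho ^+ (n - i.+1)))).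
  apply: (@le_trans _ _ (g ^+ i.+1 * a (n - i.+1)%N)); first exact: ler_wpM2r.
  have g00 := ltW g0.
  by rewrite ler_wpM2l ?exprn_ge0 //; apply: IH; lia.
have rE : rho ^+ n = rho ^+ i.+1 * rho ^+ (n - i.+1) by rewrite -exprD subnKC.
rewrite rE /y expr_div_n le_eqVlt; apply/orP; left; apply/eqP.
have ri : rho ^+ i.+1 != 0 by rewrite expf_neq0 // gt_eqF.
by field.
Qed.

Lemma growth_limit a c u (B : R) p q : (forall n, 0 <= a n) -> (forall n, 0 <= u n) ->
  (forall i j, u i * u j <= u (i + j)%N) -> 0 <= B ->
  (forall n, a n <= B ^+ n) -> (forall n, u n <= (n * n)%:R * a n) ->
  (forall k, c k.+1 <= u k.+1) ->
  (forall n, n%:R * a n <= \sum_(k < n.+1) k%:R * (c k * a (n - k)%N)) ->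
  (0 < p)%N -> (0 < q)%N -> coprime p q -> 0 < u (2 * p)%N -> 0 < u (2 * q)%N ->
  exists2 gamma : R, 0 < gamma &
    (fun n => a (2 * n)%N `^ ((2 * n)%:R^-1)) @ \oo --> gamma.
Proof.
move=> a0 u0 um B0 aB ua cu rec p0 q0 cpq up uq.
have [N0 upos] := superm_gt0_eventually um p0 q0 cpq up uq.
(* The factor [n * n] from forgetting the root costs only a base [(1 + t) ^+ 2], as close to 1 as
   desired. *)
have sq n (t : R) : 0 < t -> (n * n)%:R <= t^-1 ^+ 2 * ((1 + t) ^+ 2) ^+ n.
  move=> t0; have : n%:R <= t^-1 * (1 + t) ^+ n.
    by rewrite ler_pdivlMl //; have := bernoulli n (ltW t0); lra.
  move=> h; have := ler_pM (ler0n _ n) (ler0n _ n) h h.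
  by rewrite -natrM -!expr2 exprMn -!exprM mulnC.
have uB n : u n <= (4 * B) ^+ n.
  apply: le_trans (ua n) _; rewrite exprMn; apply: ler_pM => //.
  by have := sq n 1 ltr01; rewrite invr1 expr1n mul1r (_ : (1 + 1) ^+ 2 = 4) //; ring.
have B40 : 0 <= 4 * B by rewrite mulr_ge0.
have g0 := growth_gt0 u0 uB B40 upos.
exists (growth u) => //; apply: root_growth_cvg => //.
- move=> rho r0 rg.
  have [t t0 rt] : exists2 t, 0 < t & rho * (1 + t) ^+ 2 < growth u.
    (* For [t <= 1] one has [(1 + t) ^+ 2 <= 1 + 3 * t], and [3 * rho * t] is at most three quarters
       of the gap [growth u - rho]. *)
    exists (Num.min 1 ((growth u - rho) / (4 * rho))).
      by rewrite lt_min ltr01 divr_gt0 ?subr_gt0 ?mulr_gt0.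
    set t := Num.min _ _; have t1 : t <= 1 by rewrite /t ge_min lexx.
    have t0 : 0 < t by rewrite /t lt_min ltr01 divr_gt0 ?subr_gt0 ?mulr_gt0.
    have : t <= (growth u - rho) / (4 * rho) by rewrite /t ge_min lexx orbT.
    rewrite ler_pdivlMr ?mulr_gt0 // => rt.
    have : rho * (1 + t) ^+ 2 <= rho * (1 + 3 * t) by rewrite ler_pM2l //; nra.
    nra.
  have s0 : 0 < rho * (1 + t) ^+ 2 by rewrite mulr_gt0 // exprn_gt0 // addr_gt0.
  have [C C0 HC] := growth_lower u0 um uB B40 upos s0 rt.
  exists (C * t^-1 ^+ 2); first by rewrite mulr_gt0 // exprn_gt0 // invr_gt0.
  exists N0 => n nN; have := HC n nN; rewrite exprMn => h.
  have p2 : 0 < ((1 + t) ^+ 2) ^+ (2 * n) by rewrite !exprn_gt0 // addr_gt0.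
  rewrite -(ler_pM2r p2); apply: le_trans h _.
  have h2 := le_trans (ua (2 * n)%N) (ler_wpM2r (a0 _) (sq (2 * n)%N t t0)).
  by apply: le_trans (ler_wpM2l (ltW C0) h2) _; rewrite le_eqVlt; apply/orP; left; apply/eqP; ring.
- move=> rho gr.
  have [|C C0 HC] := @recursion_upper a c (growth u) rho g0 gr a0 _ rec.
    by move=> k; apply: le_trans (cu k) _; exact: (superm_le_growth u0 uB B40 upos).
  by exists C => n; apply: HC.
Qed.
End GrowthRates.

(** * Growth of the number of regular planar graphs *)

Section RegularGrowth.
Local Open Scope classical_set_scope.
Local Open Scope ring_scope.
Variables (R : realType) (D : nat).

Let density (k n : nat) : R := k%:R / n`!%:R.

Lemma planar_regular_bound n : (#|regular_planar R D n| <= n`! * 2 ^ (960 * n))%N.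
Proof.
apply: (@labelled_bound n _ (regular_planar R D n) (fun E => adj E)).
  move=> E /regular_planarP[Es Ep _]; split; first exact: adj_sym.
    by move=> v; apply/negbTE/negP => /(simple_adj Es); rewrite eqxx.
  exact: planar_grid_model Es Ep.
by move=> E E' /regular_planarP[Es _ _] /regular_planarP[Es' _ _]; apply: simple_graph_eq.
Qed.

Lemma regular_growth p q : (1 < D)%N -> (0 < p)%N -> (0 < q)%N -> coprime p q ->
  (0 < #|rooted_regular R D (2 * p)|)%N -> (0 < #|rooted_regular R D (2 * q)|)%N ->
  exists2 gamma : R, 0 < gamma &
    (fun n => density #|regular_planar R D (2 * n)| (2 * n) `^ ((2 * n)%:R^-1)) @ \oo --> gamma.
Proof.
move=> D1 p0 q0 cpq rp rq.
have f0 n : 0 < n`!%:R :> R by rewrite ltr0n fact_gt0.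
have fu n : n`!%:R \is a @GRing.unit R by rewrite unitfE gt_eqF.
(* Division by [n!] absorbs the binomial coefficients of supermultiplicativity and of the component
   recursion. *)
have binE n k : (k <= n)%N -> ('C(n, k)%:R / n`!%:R = (k`!%:R)^-1 * ((n - k)`!%:R)^-1 :> R).
  move=> kn; rewrite -(bin_fact kn) natrM invfM mulrA divff; first by rewrite mul1r natrM invfM.
  by rewrite pnatr_eq0 -lt0n bin_gt0.
apply: (@growth_limit R (fun n => density #|regular_planar R D n| n)
  (fun n => density #|connected_regular R D n| n) (fun n => density #|rooted_regular R D n| n)
  (2 ^+ 960) p q) => //; rewrite /density.
- by move=> n; rewrite divr_ge0.
- by move=> n; rewrite divr_ge0.
- move=> i j; rewrite ler_pdivlMr //.
  apply: le_trans (_ : ('C(i + j, i) * #|rooted_regular R D i| * #|rooted_regular R D j|)%N%:R <= _); last first.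
    by rewrite ler_nat supermultiplicative.
  have := binE (i + j)%N i (leq_addr j i); rewrite addKn => /(canRL (divrK (fu _))) b.
  rewrite !natrM b le_eqVlt; apply/orP; left; apply/eqP; ring.
- move=> n; rewrite ler_pdivrMr // -exprM -natrX -natrM ler_nat mulnC.
  exact: planar_regular_bound.
- move=> n; rewrite mulrA ler_pM2r ?invr_gt0 // -natrM ler_nat mulnC; exact: rooted_le.
- by move=> k; rewrite ler_pM2r ?invr_gt0 // ler_nat; apply: connected_le_rooted.
- move=> n; rewrite mulrA ler_pdivrMr // -natrM.
  apply: (@le_trans _ _ (\sum_(k < n.+1) 'C(n, k) * (k * (#|connected_regular R D k| *
      #|regular_planar R D (n - k)|)))%N%:R); first by rewrite ler_nat component_recursion.
  rewrite natr_sum mulr_suml; apply: ler_sum => k _.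
  have := binE n k (ltn_ord k) => /(canRL (divrK (fu _))) b.
  rewrite !natrM b le_eqVlt; apply/orP; left; apply/eqP; ring.
- by rewrite divr_gt0 // ltr0n.
- by rewrite divr_gt0 // ltr0n.
Qed.
End RegularGrowth.

Unset Implicit Arguments.
Local Open Scope classical_set_scope.
Local Open Scope ring_scope.

Theorem theorem3 (R : realType) (D : nat) (hD : D = 3%N \/ D = 5%N) :
  exists gamma : R, 0 < gamma /\
    (fun n : nat =>
       (#|planar_graphs R (2 * n) D D|%:R / ((2 * n)`!)%:R : R)
         `^ ((2 * n)%:R^-1)) @ \oo --> gamma.
Proof.
suff [gamma g0 glim] : exists2 gamma : R, 0 < gamma &
    (fun n => (#|regular_planar R D (2 * n)|%:R / ((2 * n)`!)%:R) `^ ((2 * n)%:R^-1)) @ \oo --> gamma.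
  by exists gamma.
(* The starting orders are 4 and 6, respectively 12 and 22; the halves 2, 3 and 6, 11 are
   coprime. *)
case: hD => ->.
  apply: (@regular_growth R 3 2 3) => //; [exact: rooted_cubic4|exact: rooted_cubic6].
apply: (@regular_growth R 5 6 11) => //; [exact: rooted_quintic12|exact: rooted_quintic22].
Qed.
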